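(* Let $\Omega$ be an open set in $\mathbb{R}^N$ with $N\ge 5$ and let $g$ be a nonnegative measurable function on $\Omega$. (i) (A sufficient condition) If $g\in L^{\frac N4,\infty}(\Omega)$, then $g$ is admissible. (ii) (A necessary condition) In addition, let $\Omega$ be a ball centered at the origin or the entire space $\mathbb{R}^N$, and let $g$ be radial and radially decreasing. Then $g$ is admissible only if $g\in L^{\frac N4,\infty}(\Omega)$.
   Context: $\mathcal{D}^{2,2}_0(\Omega)$ denotes the completion of $C_c^\infty(\Omega)$ with respect to the norm $\|\Delta u\|_{L^2(\Omega)}$ (for $N\ge 5$ it is a function space). A function $g$ on $\Omega$ is called admissible if there is a constant $C>0$ such that $$\int_\Omega g(x)u^2\,dx\le C\int_\Omega|\Delta u|^2\,dx\qquad\text{for all }u\in\mathcal{D}^{2,2}_0(\Omega).$$ Let $|A|$ denote Lebesgue measure. For an extended real-valued measurable function $f$ on $\Omega$, finite a.e., let $\alpha_f(s)=|\{x\in\Omega:|f(x)|>s\}|$ for $s>0$, and let $f^*(t)=\inf\{s>0:\alpha_f(s)<t\}$ for $t>0$ be its decreasing rearrangement. For $1\le p<\infty$, $L^{p,\infty}(\Omega)$ is the set of such $f$ with $\sup_{t>0}t^{1/p}f^*(t)<\infty$. ''Radial and radially decreasing'' means that $g(x)$ depends only on $|x|$ and is a nonincreasing function of $|x|$. *)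

(* Defs.v *)
From HB Require Import structures.
From mathcomp Require Import all_boot all_order all_algebra.
From mathcomp Require Import all_classical all_reals all_analysis.
From mathcomp Require Import measurable_realfun.

Set Implicit Arguments.
Unset Strict Implicit.
Unset Printing Implicit Defensive.

Import Order.TTheory GRing.Theory Num.Theory.
Import numFieldNormedType.Exports.

Local Open Scope classical_set_scope.
Local Open Scope ring_scope.

(* The library norm on 'rV[R]_N is the sup norm, so balls and radial functions
   need the Euclidean norm. *)
Definition enorm (R : realType) (N : nat) (x : 'rV[R]_N) : R :=
  Num.sqrt (\sum_(i < N) x ord0 i ^+ 2).

Definition eball (R : realType) (N : nat) (r : R) : set 'rV[R]_N :=
  [set x | enorm x < r].

(* Lebesgue measure on R^N: the Caratheodory restriction of the Lebesgue outer
   measure, so that measurable means Lebesgue (not only Borel) measurable. *)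
Section lebesgue_outer.
Context (R : realType) (N : nat).
Implicit Types (A : set 'rV[R]_N) (ab : 'rV[R]_N * 'rV[R]_N).
Local Open Scope ereal_scope.

Definition box ab : set 'rV[R]_N :=
  [set x | forall i, (ab.1 ord0 i < x ord0 i <= ab.2 ord0 i)%R].

(* The truncation at 0 gives volume 0 to a pair of corners with empty box. *)
Definition box_vol ab : R :=
  (\prod_(i < N) Num.max 0 (ab.2 ord0 i - ab.1 ord0 i))%R.

Definition box_cover A : set (set ('rV[R]_N * 'rV[R]_N)) :=
  [set C | countable C /\ A `<=` \bigcup_(ab in C) box ab].

Definition lebesgue_outer A : \bar R :=
  ereal_inf [set \esum_(ab in C) (box_vol ab)%:E | C in box_cover A].

Let box_vol_ge0 ab : 0 <= (box_vol ab)%:E.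
Proof. by rewrite lee_fin prodr_ge0// => i _; rewrite le_max lexx. Qed.

Let lebesgue_outer_ge0 A : 0 <= lebesgue_outer A.
Proof.
by apply: le_ereal_inf_tmp => _ [C _ <-]; apply: esum_ge0 => ab _.
Qed.

Let lebesgue_outer0 : lebesgue_outer set0 = 0.
Proof.
apply/eqP; rewrite eq_le lebesgue_outer_ge0 andbT.
apply: ereal_inf_lbound; exists set0; last exact: esum_set0.
by split=> //; exact: countable0.
Qed.

Let le_lebesgue_outer : {homo lebesgue_outer : A B / A `<=` B >-> A <= B}.
Proof.
move=> A B AB; apply/ereal_inf_le_tmp => _ [C [cC BC] <-].
by exists C => //; split=> //; exact: subset_trans BC.
Qed.

Let le_esum_bigcup (T : choiceType) (G : (set T)^nat) (a : T -> \bar R) :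
  (forall x, 0 <= a x) ->
  \esum_(x in \bigcup_n G n) a x <= \sum_(n <oo) \esum_(x in G n) a x.
Proof.
move=> a0; rewrite nneseries_esumT; last by move=> n; exact: esum_ge0.
rewrite (@esum_esum _ _ _ _ _ (fun _ x => a x))//.
have /choice[e eP] : forall x, exists n, (\bigcup_n G n) x -> G n x.
  by move=> x; have [[n _ Gnx]|] := pselect ((\bigcup_n G n) x);
    [exists n|exists 0%N].
have einj : set_inj (\bigcup_n G n) (fun x => (e x, x)) by move=> x y _ _ [].
rewrite -(@esum_image _ _ _ _ _ (fun k => a k.2) einj).
rewrite esum_mkcond [leRHS]esum_mkcond; apply: le_esum => -[n x] _.
case: ifPn => [|_]; last by case: ifPn.
rewrite inE => -[y Gy [<- <-]]; rewrite ifT//.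
by rewrite inE; split=> //=; exact: eP.
Qed.

Let lebesgue_outer_sigma_subadditive : sigma_subadditive lebesgue_outer.
Proof.
move=> A; have [[i ioo]|] := pselect (exists i, lebesgue_outer (A i) = +oo).
  by rewrite (eseries_pinfty _ _ ioo) ?leey// => n _;
    rewrite -ltNye (lt_le_trans _ (lebesgue_outer_ge0 _)).
rewrite -forallNE => Aoo; apply/lee_addgt0Pr => e e0.
rewrite (le_trans _ (epsilon_trick _ _ _))//; last exact: ltW.
pose P n C := box_cover (A n) C /\ \esum_(ab in C) (box_vol ab)%:E <=
  lebesgue_outer (A n) + (e / (2 ^ n.+1)%:R)%:E.
have [G PG] : {G & forall n, P n (G n)}.
  apply: (@choice _ _ P) => n.
  have en0 : (0 < e / (2 ^ n.+1)%:R)%R by rewrite divr_gt0// ltr0n expn_gt0.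
  have fA : lebesgue_outer (A n) \is a fin_num.
    by rewrite ge0_fin_numE ?lebesgue_outer_ge0// ltey; apply/eqP/Aoo.
  have [_ [C AC <-] lt] := lb_ereal_inf_adherent en0 fA.
  by exists C; split=> //; exact: ltW.
apply: (@le_trans _ _ (\esum_(ab in \bigcup_n G n) (box_vol ab)%:E)).
  apply: ereal_inf_lbound; exists (\bigcup_n G n) => //; split.
    by apply: bigcup_countable => // n _; exact: (PG n).1.1.
  move=> x [n _ /(PG n).1.2[ab Gab xab]].
  by exists ab => //; exists n.
apply: (le_trans (le_esum_bigcup _ box_vol_ge0)).
apply: lee_nneseries => [n _ _|n _]; first exact: esum_ge0.
exact: (PG n).2.
Qed.

HB.instance Definition _ := isOuterMeasure.Build R _ lebesgue_outer
  lebesgue_outer0 lebesgue_outer_ge0 le_lebesgue_outer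
  lebesgue_outer_sigma_subadditive.

End lebesgue_outer.

Notation lebesgue_rVType R N := (caratheodory_type (@lebesgue_outer R N)).

Definition lebesgue_rV (R : realType) (N : nat) :
    set (lebesgue_rVType R N) -> \bar R := @lebesgue_outer R N.

HB.instance Definition _ (R : realType) (N : nat) := isMeasure.Build _ _ _
  (@lebesgue_rV R N)
  (caratheodory_measure0 (@lebesgue_outer R N))
  (caratheodory_measure_ge0 (mu := @lebesgue_outer R N))
  (caratheodory_measure_sigma_additive (mu := @lebesgue_outer R N)).

Definition lebesgue_measurable_fun (R : realType) (N : nat)
    d (T : measurableType d) (Omega : set 'rV[R]_N) (f : 'rV[R]_N -> T) :=
  measurable_fun (Omega : set (lebesgue_rVType R N)) f.

Definition partial (R : realType) (N : nat) (i : 'I_N) (f : 'rV[R]_N -> R) :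
    'rV[R]_N -> R := fun x => 'D_(delta_mx ord0 i) f x.

Definition laplacian (R : realType) (N : nat) (f : 'rV[R]_N -> R) :
    'rV[R]_N -> R := fun x => \sum_(i < N) partial i (partial i f) x.

(* C^oo: all iterated partial derivatives exist and are continuous. *)
Definition smooth (R : realType) (N : nat) (f : 'rV[R]_N -> R) : Prop :=
  forall s : seq 'I_N, let h := foldr (@partial R N) f s in
    continuous h /\ forall i x, derivable h x (delta_mx ord0 i).

(* Elements of C_c^oo(Omega) are extended by 0 to R^N. *)
Definition Cc_infty (R : realType) (N : nat) (Omega : set 'rV[R]_N) :
    set ('rV[R]_N -> R) :=
  [set f | let K := closure [set x | f x != 0] in
    [/\ smooth f, compact K & K `<=` Omega]].

Section D220.
Context (R : realType) (N : nat) (Omega : set 'rV[R]_N).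
Implicit Types (phi : nat -> 'rV[R]_N -> R) (u v w : 'rV[R]_N -> R).
Local Open Scope ereal_scope.
Local Notation mu := (@lebesgue_rV R N).

Definition L2dist2 v w : \bar R := \int[mu]_(x in Omega) ((v x - w x) ^+ 2)%:E.

Definition laplacian_cauchy phi : Prop :=
  forall e : R, (0 < e)%R -> exists n0, forall m n, (n0 <= m)%N -> (n0 <= n)%N ->
    L2dist2 (laplacian (phi m)) (laplacian (phi n)) < e%:E.

Definition L1loc_cvg phi u : Prop :=
  lebesgue_measurable_fun Omega u /\
  forall K : set 'rV[R]_N, compact K -> K `<=` Omega ->
    \int[mu]_(x in K) (`|phi n x - u x|)%:E @[n --> \oo] --> 0.

(* An element of the completion of C_c^oo(Omega) for the norm |Delta phi|_2 is
   the class of a Cauchy sequence phi; for N >= 5 it is identified with the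
   function u that is the limit of phi in L^1_loc(Omega). *)
Definition D220_repr phi u : Prop :=
  [/\ forall n, Cc_infty Omega (phi n), laplacian_cauchy phi &
      L1loc_cvg phi u].

Definition D220 : set ('rV[R]_N -> R) := [set u | exists phi, D220_repr phi u].

(* Delta u = w for u in the completion: Delta is extended from C_c^oo(Omega)
   as an isometry into L^2(Omega).  As L^2 is complete, every u in D220 has such
   a w; it is unique a.e., being the distributional Laplacian of u. *)
Definition D220_laplacian u w : Prop :=
  exists phi, [/\ D220_repr phi u, lebesgue_measurable_fun Omega w &
    L2dist2 (laplacian (phi n)) w @[n --> \oo] --> 0].

Definition admissible (g : 'rV[R]_N -> \bar R) : Prop :=
  exists C : R, (0 < C)%R /\
    forall u w, D220 u -> D220_laplacian u w ->
      \int[mu]_(x in Omega) (g x * (u x ^+ 2)%:E) <=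
      C%:E * \int[mu]_(x in Omega) (`|w x| ^+ 2)%:E.

End D220.

Section weak_Lp.
Context (R : realType) (N : nat) (Omega : set 'rV[R]_N).
Implicit Types f : 'rV[R]_N -> \bar R.
Local Open Scope ereal_scope.
Local Notation mu := (@lebesgue_rV R N).

Definition distribution_fun f (s : R) : \bar R :=
  mu [set x | Omega x /\ s%:E < `|f x|].

Definition decreasing_rearrangement f (t : R) : \bar R :=
  ereal_inf [set s%:E | s in [set s : R |
    (0 < s)%R /\ distribution_fun f s < t%:E]].

Definition weak_Lp (p : R) : set ('rV[R]_N -> \bar R) :=
  [set f : 'rV[R]_N -> \bar R | [/\ lebesgue_measurable_fun Omega f,
    {ae mu, forall x, Omega x -> f x \is a fin_num} &
    ereal_sup [set (t `^ p^-1)%:E * decreasing_rearrangement f t |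
      t in [set t : R | (0 < t)%R]] < +oo]].

End weak_Lp.

Definition radially_decreasing (R : realType) (N : nat)
    (Omega : set 'rV[R]_N) (g : 'rV[R]_N -> \bar R) : Prop :=
  exists h : R -> \bar R,
    (forall r s : R, 0 <= r -> r <= s -> (h s <= h r)%E) /\
    forall x, Omega x -> g x = h (enorm x).

(* Main.v *)
Require Import Defs.
From HB Require Import structures.
From mathcomp Require Import all_boot all_order all_algebra.
From mathcomp Require Import all_classical all_reals all_analysis.
From mathcomp Require Import measurable_realfun ring lra.

Set Implicit Arguments.
Unset Strict Implicit.
Unset Printing Implicit Defensive.

Import Order.TTheory GRing.Theory Num.Theory.
Import numFieldNormedType.Exports.

Local Open Scope classical_set_scope.
Local Open Scope ring_scope.

(** Sufficiency. For test functions the inequality follows from a first order estimate that is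
    applied twice. Let [u] be C^1 with bounded support, let [l_j = M / 2 ^ j] be dyadic levels, [a_j]
    the measure of the set [l_j < |u|], and [E_j] the energy of [u] on the shell
    [l_j < |u| <= 2 * l_j]. Translating a layer of [u] by the points of a cube twice as large as
    the set [l < |u|] shows that [l ^ 2 * |{2 * l < |u|}|] is at most
    [|{l < |u|}| ^ (2 / N)] times the energy of [u] on the shell, up to a constant
    ([level_set_estimate]). When this is summed over the levels, those at which the
    distribution function jumps are absorbed, and one obtains [weighted_estimate]: if a
    potential [W] has integral at most [K * |F| ^ theta] on all sets [F] of finite measure, then
    the integral of [W * u ^ 2] is at most a constant times [K] times the sum of the
    [a_j ^ eta * E_j], where [eta = 2 / N + theta - 1].

    A function [g] of weak L^(N/4) satisfies this hypothesis with [theta = 1 - 4 / N]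
    ([weak_type_integral]). For [u = phi] the bound is then the integral of the squared
    gradient of [phi] against the potential with value [a_j ^ (- 2 / N)] on the [j]-th shell, and this
    potential satisfies the hypothesis with [theta = 1 - 2 / N] ([integral_step_potential]).
    For [u = d_i phi] and this potential [eta] is 0, so that only the L^2 norm of the
    Hessian of [phi] is left, which is that of the Laplacian ([Rintegral_hessian]). The inequality
    extends to the completion by lower semicontinuity ([test_inequality_admissible]).

    Necessity. A smooth bump on a cube of half side [r] has a Laplacian of order [r ^- 2], so the
    right side of the inequality is of order [r ^ (N - 4)]. If [g] is radially decreasing and
    [r] is a small multiple of [|x|], the left side is at least of order [g x * r ^ N]. Hence
    [g x] is at most a constant times [|x| ^- 4] ([radial_decay]), and the distribution function of
    this power at [s] is a constant times [s ^ (- N / 4)]. *)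

(** * Lebesgue measure: boxes, cubes and translations *)

Section outer_measure_boxes.
Context (R : realType) (N : nat).
Local Notation corners := ('rV[R]_N * 'rV[R]_N)%type.
Implicit Types (A X : set 'rV[R]_N) (ab : corners).
Local Open Scope ereal_scope.
Local Notation outer := (@lebesgue_outer R N).

Lemma box_vol_ge0 ab : (0 <= box_vol ab)%R.
Proof. by rewrite prodr_ge0// => i _; rewrite le_max lexx. Qed.

Lemma box_volD1 i ab : box_vol ab = (Num.max 0 (ab.2 ord0 i - ab.1 ord0 i) *
  \prod_(j < N | j != i) Num.max 0 (ab.2 ord0 j - ab.1 ord0 j))%R.
Proof. by rewrite /box_vol (bigD1 i). Qed.

Lemma lebesgue_outer_box ab : outer (box ab) <= (box_vol ab)%:E.
Proof.
apply: ereal_inf_lbound; exists [set ab].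
  by split=> // x bx; exists ab.
by rewrite esum_set1// lee_fin box_vol_ge0.
Qed.

(** The sum runs over [C] and not over its image, so that [F] may send several boxes
    of a cover to the same box. *)
Lemma lebesgue_outer_le_esum (C : set corners) (F : corners -> corners) A :
  countable C -> A `<=` \bigcup_(c in C) box (F c) ->
  outer A <= \esum_(c in C) (box_vol (F c))%:E.
Proof.
move=> /countable_bijP[B]; rewrite card_eq_sym => /card_set_bijP[e eB] AC.
rewrite (reindex_esum _ _ _ _ eB).
have -> : \esum_(i in B) (box_vol (F (e i)))%:E =
    \sum_(n <oo | n \in B) (box_vol (F (e n)))%:E.
  rewrite nneseries_esum; last by move=> n _; rewrite lee_fin box_vol_ge0.
  by congr esum; apply/seteqP; split => x /=; rewrite inE.
pose G n := if n \in B then box (F (e n)) else set0.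
have AG : A `<=` \bigcup_n G n.
  move=> x /AC[c Cc xc]; have [b Bb ebc] := set_bij_surj eB Cc.
  by exists b => //; rewrite /G mem_set// ebc.
apply: (le_trans (le_outer_measure outer _ _ AG)).
apply: (le_trans (outer_measure_sigma_subadditive outer G)).
rewrite [leRHS]eseries_mkcond; apply: lee_nneseries => n _.
  by move=> _; exact: outer_measure_ge0.
by rewrite /G; case: ifPn => _; rewrite ?outer_measure0// lebesgue_outer_box.
Qed.

(** A bound on boxes extends to all sets, as every set is covered by boxes. *)
Lemma lebesgue_outer_le_scale (F : corners -> corners)
    (f : 'rV[R]_N -> 'rV[R]_N) (k : R) A :
  (0 < k)%R ->
  (forall ab x, box ab x -> box (F ab) (f x)) ->
  (forall ab, box_vol (F ab) = (k * box_vol ab)%R) ->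
  outer (f @` A) <= k%:E * outer A.
Proof.
move=> k0 Fbox Fvol; rewrite muleC -lee_pdivrMr//.
apply: le_ereal_inf_tmp => _ [C [cC AC] <-]; rewrite lee_pdivrMr// muleC.
have le_k : (\esum_(ab in C) (box_vol (F ab))%:E <=
    k%:E * (\esum_(ab in C) (box_vol ab)%:E))%E.
  apply: ge_ereal_sup => _ [D [finD DC] <-]; under eq_fsbigr do rewrite Fvol EFinM.
  rewrite -ge0_mule_fsumr; last by move=> ab; rewrite lee_fin box_vol_ge0.
  rewrite lee_pmul2l// ereal_sup_ubound//; exists D => //.
apply: le_trans le_k.
apply: lebesgue_outer_le_esum => // _ [x /AC[ab Cab xab] <-].
by exists ab => //; exact: Fbox.
Qed.

(** A hyperplane cuts each box of a cover into two boxes whose volumes add up. *)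
Lemma caratheodory_half_space (i : 'I_N) (c : R) :
  outer.-caratheodory [set x | (x ord0 i <= c)%R].
Proof.
apply: le_caratheodory_measurable => X; apply: le_ereal_inf_tmp => _ [C [cC XC] <-].
pose lo ab : corners := (ab.1, \row_j if j == i then Num.min c (ab.2 ord0 i) else ab.2 ord0 j).
pose hi ab : corners := (\row_j if j == i then Num.max c (ab.1 ord0 i) else ab.1 ord0 j, ab.2).
have -> : \esum_(ab in C) (box_vol ab)%:E =
    \esum_(ab in C) (box_vol (lo ab))%:E + \esum_(ab in C) (box_vol (hi ab))%:E.
  rewrite -esumD; [|by move=> *; rewrite lee_fin box_vol_ge0..].
  apply: eq_esum => ab _; rewrite -EFinD; congr EFin.
  rewrite !(box_volD1 i)/= !mxE eqxx.
  under [X in (_ = _ * X + _)%R]eq_bigr => j /negPf ji do rewrite !mxE ji.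
  under [X in (_ = _ + _ * X)%R]eq_bigr => j /negPf ji do rewrite !mxE ji.
  rewrite -mulrDl; congr (_ * _)%R; move: (ab.1 _ _) (ab.2 _ _) => a b.
  rewrite !maxEle !minEle; repeat case: ifPn; rewrite -?ltNge; lra.
apply: leeD; apply: lebesgue_outer_le_esum => // x [/XC[ab Cab xab] xc];
    exists ab => // j; rewrite !mxE; case: eqP => [->|_]; do ?exact: xab.
  by have /andP[-> ?] := xab i; rewrite le_min xc.
by have /andP[? ->] := xab i; rewrite gt_max ltNge andbT; apply/andP; split=> //; exact/negP.
Qed.
End outer_measure_boxes.

Section lebesgue_measure_facts.
Context (R : realType) (N : nat).
Local Notation V := 'rV[R]_N.
Local Notation LV := (lebesgue_rVType R N).
Local Notation mu := (@lebesgue_rV R N).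

Lemma le_lebesgue (A B : set V) : A `<=` B -> (mu A <= mu B)%E.
Proof. exact: (le_outer_measure (@lebesgue_outer R N)). Qed.

Lemma measurable_coord (i : 'I_N) :
  measurable_fun setT ((fun x : V => x ord0 i) : LV -> R).
Proof.
apply: (@measurability _ _ LV R setT _ (@RGenOInfty.G R)).
  exact: RGenOInfty.measurableE.
move=> _ [_ [c ->] <-]; rewrite setTI.
suff -> : (fun x : V => x ord0 i) @^-1` `]c, +oo[ = ~` [set x : V | x ord0 i <= c].
  by apply: (@measurableC _ LV); exact: caratheodory_half_space.
by apply/seteqP; split => x /=; rewrite in_itv/= andbT ltNge => /negP.
Qed.

Lemma box_preimage_measurable d (T : measurableType d) (h : T -> V) ab :
  (forall i, measurable_fun setT (fun t => h t ord0 i)) ->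
  measurable (h @^-1` box ab).
Proof.
move=> mh; have -> : h @^-1` box ab = \bigcap_(i in [set: 'I_N])
    ((fun t => h t ord0 i) @^-1` `]ab.1 ord0 i, ab.2 ord0 i]).
  apply/seteqP; split => t /=; first by move=> b i _ /=; have := b i; rewrite in_itv.
  by move=> b i; have := b i I; rewrite /= in_itv.
apply: fin_bigcap_measurable => // i _; rewrite -[X in measurable X]setTI; exact: mh.
Qed.

(** Rational boxes form a countable base of the topology, so measurability into
    the space can be tested on coordinates. *)
Lemma open_preimage_measurable d (T : measurableType d) (h : T -> V) (U : set V) :
  (forall i, measurable_fun setT (fun t => h t ord0 i)) -> open U ->
  measurable (h @^-1` U).
Proof.
move=> mh oU.
pose rbox (q : 'rV[rat]_N * 'rV[rat]_N) : set V :=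
  box (map_mx ratr q.1, map_mx ratr q.2).
have -> : h @^-1` U = \bigcup_q (if `[< rbox q `<=` U >] then h @^-1` (rbox q) else set0).
  apply/seteqP; split => [t Uht|t [q _]]; last by case: asboolP => // + ?; exact.
  have /nbhs_ballP[e /= e0 eU] := open_nbhs_nbhs (conj oU Uht).
  have lo i : {q : rat | h t ord0 i - e < ratr q < h t ord0 i}.
    apply/cid; have [|q] := @rat_in_itvoo R (h t ord0 i - e) (h t ord0 i); first lra.
    by rewrite in_itv/= => ?; exists q.
  have hi i : {q : rat | h t ord0 i < ratr q < h t ord0 i + e}.
    apply/cid; have [|q] := @rat_in_itvoo R (h t ord0 i) (h t ord0 i + e); first lra.
    by rewrite in_itv/= => ?; exists q.
  exists (\row_i sval (lo i), \row_i sval (hi i)) => //.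
  case: asboolP => [_ i|]; rewrite ?mxE/=.
    by case: (lo i) (hi i) => [a /= /andP[_ ->]] [b /= /andP[/ltW ->]].
  case=> x bx; apply: eU; split=> // i j; rewrite (ord1 i) /ball/=.
  move: (bx j); rewrite !mxE.
  case: (lo j) (hi j) => [a /= /andP[? ?]] [b /= /andP[? ?]] /andP[? ?].
  by rewrite ltr_distl; apply/andP; split; lra.
apply: countable_bigcupT_measurable => // q; case: asboolP => // _.
exact: box_preimage_measurable.
Qed.

Lemma measurable_fun_continuous_comp d (T : measurableType d) (h : T -> V) (f : V -> R) :
  (forall i, measurable_fun setT (fun t => h t ord0 i)) -> continuous f ->
  measurable_fun setT (f \o h).
Proof.
move=> mh /continuousP cf; apply: (@measurability _ _ T R setT _ (@RGenOInfty.G R)).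
  exact: RGenOInfty.measurableE.
move=> _ [_ [c ->] <-]; rewrite setTI comp_preimage.
apply: open_preimage_measurable => //; exact: cf.
Qed.

Lemma open_lebesgue_measurable (U : set V) : open U -> measurable (U : set LV).
Proof. exact: (open_preimage_measurable measurable_coord). Qed.

Lemma closed_lebesgue_measurable (F : set V) : closed F -> measurable (F : set LV).
Proof.
by move=> cF; rewrite -[F]setCK; apply/measurableC/open_lebesgue_measurable/closed_openC.
Qed.

Lemma continuous_lebesgue_measurable (f : V -> R) :
  continuous f -> measurable_fun setT (f : LV -> R).
Proof. exact: (measurable_fun_continuous_comp measurable_coord). Qed.

Let affine_box (r : R) (y : V) (ab : V * V) := (r *: ab.1 + y, r *: ab.2 + y).

Lemma lebesgue_outer_affine (r : R) (y : V) (A : set V) : 0 < r ->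
  (@lebesgue_outer R N ((fun x => r *: x + y)%R @` A) <= (r ^+ N)%:E * lebesgue_outer A)%E.
Proof.
move=> r0; apply: (@lebesgue_outer_le_scale _ _ (affine_box r y)).
- exact: exprn_gt0.
- by move=> ab x bx i; rewrite !mxE ltrD2r lerD2r ltr_pM2l// ler_pM2l.
move=> ab; rewrite /box_vol -[in r ^+ N](card_ord N) -prodr_const -big_split/=.
apply: eq_bigr => i _; rewrite !mxE.
rewrite -[in RHS](mulr0 r) maxr_pMr; last exact: ltW.
by rewrite mulr0; congr Num.max; lra.
Qed.

Lemma lebesgue_translation (y : V) (A : set V) : mu (+%R^~ y @` A) = mu A.
Proof.
have le y' B : (mu (+%R^~ y' @` B) <= mu B)%E.
  have -> : +%R^~ y' @` B = (fun x => 1 *: x + y')%R @` B.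
    by apply: eq_imagel => x _; rewrite scale1r.
  by have := @lebesgue_outer_affine 1 y' B ltr01; rewrite expr1n mul1e.
apply/eqP; rewrite eq_le le/=.
have {1}-> : A = +%R^~ (- y)%R @` (+%R^~ y @` A).
  by rewrite image_comp; apply/seteqP; split => [x Ax|_ [x Ax <-]];
    [exists x => //|]; rewrite /= addrK.
exact: le.
Qed.

Definition cube (r : R) : set V := [set x | forall i, 0 < x ord0 i <= r].

Lemma cubeE r : cube r = box (0, const_mx r).
Proof. by apply/seteqP; split => x xr i; have := xr i; rewrite /= !mxE. Qed.

Lemma measurable_cube r : measurable (cube r : set LV).
Proof. by rewrite cubeE; exact: (box_preimage_measurable _ measurable_coord). Qed.

Lemma lebesgue_cube_lty r : (mu (cube r) < +oo)%E.
Proof. by rewrite cubeE; apply: le_lt_trans (ltry _); exact: lebesgue_outer_box. Qed.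

(** The bound for dilations, applied to [r] and to its inverse. The measure of the unit cube
    is carried along as a constant: only ratios of volumes enter the estimates. *)
Lemma lebesgue_cube r : 0 < r -> (mu (cube r) = (r ^+ N)%:E * mu (cube 1))%E.
Proof.
have cube_image s t : 0 < t -> (fun x => t *: x + 0)%R @` cube s = cube (t * s).
  move=> t0; apply/seteqP; split => [_ [x xs <-] i|x xts].
    by rewrite !mxE addr0 pmulr_rgt0// ler_pM2l//; exact: xs.
  exists (t^-1 *: x); last by rewrite addr0 scalerA mulfV ?scale1r// gt_eqF.
  by move=> i; rewrite mxE pmulr_rgt0 ?invr_gt0// ler_pdivrMl//; exact: xts.
have le s t : 0 < t -> (mu (cube (t * s)) <= (t ^+ N)%:E * mu (cube s))%E.
  by move=> t0; rewrite -cube_image//; exact: lebesgue_outer_affine.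
move=> r0; apply/eqP; rewrite eq_le -{1}[r]mulr1 le//=.
have : (mu (cube (r^-1 * r)) <= (r^-1 ^+ N)%:E * mu (cube r))%E.
  by apply: le; rewrite invr_gt0.
by rewrite mulVf ?gt_eqF// exprVn lee_pdivlMl ?exprn_gt0.
Qed.

(** Half open, so that it is a box. *)
Definition centered_cube (r : R) : set V :=
  [set x | forall i, - r < x ord0 i <= r].

Lemma centered_cubeE r : centered_cube r = +%R^~ (const_mx (- r)) @` cube (r + r).
Proof.
apply/seteqP; split => [x xr|_ [x xr <-] i]; last first.
  by have := xr i; rewrite !mxE; lra.
exists (x + const_mx r); first by move=> i; have := xr i; rewrite !mxE; lra.
by apply/matrixP => i j; rewrite !mxE addrK.
Qed.

Lemma lebesgue_centered_cube r : 0 < r ->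
  (mu (centered_cube r) = ((r + r) ^+ N)%:E * mu (cube 1))%E.
Proof.
by move=> r0; rewrite centered_cubeE lebesgue_translation lebesgue_cube// addr_gt0.
Qed.

Lemma lebesgue_centered_cube_lty r : (mu (centered_cube r) < +oo)%E.
Proof. by rewrite centered_cubeE lebesgue_translation lebesgue_cube_lty. Qed.

Lemma measurable_centered_cube r : measurable (centered_cube r : set LV).
Proof.
have -> : centered_cube r = box (const_mx (- r), const_mx r).
  by apply/seteqP; split => x xr i; have := xr i; rewrite /= !mxE.
exact: (box_preimage_measurable _ measurable_coord).
Qed.

Lemma coord_le_norm (x : V) (i : 'I_N) : `|x ord0 i| <= `|x|.
Proof.
rewrite [leRHS]mx_normrE; exact: (le_bigmax_cond _ (fun ij => `|x ij.1 ij.2|) (j := (ord0, i))).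
Qed.

Lemma bigcup_centered_cube : \bigcup_n centered_cube n.+1%:R = [set: V].
Proof.
apply/seteqP; split => // x _; exists (Num.truncn `|x|) => // i.
have := le_lt_trans (coord_le_norm x i) (truncnS_gt _).
by rewrite ltr_norml => /andP[-> /ltW].
Qed.

Lemma lebesgue_sigma_finite : sigma_finite setT mu.
Proof.
exists (fun n => centered_cube n.+1%:R); first by rewrite bigcup_centered_cube.
move=> n; split; [exact: measurable_centered_cube|exact: lebesgue_centered_cube_lty].
Qed.

HB.instance Definition _ := @Measure_isSigmaFinite.Build _ LV R mu lebesgue_sigma_finite.

(** The constant [mu (cube 1)] may be divided by, since its vanishing would make all sets
    null and all estimates trivial. *)
Lemma lebesgue_cube_eq0 : mu (cube 1) = 0%E -> mu setT = 0%E.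
Proof.
move=> c0; apply/eqP; rewrite eq_le measure_ge0 andbT -bigcup_centered_cube.
apply: (le_trans (outer_measure_sigma_subadditive (@lebesgue_outer R N) _)).
by rewrite eseries0// => n _ _; rewrite [LHS]lebesgue_centered_cube// c0 mule0.
Qed.

(** Caratheodory's criterion refers to the outer measure only, which translations preserve. *)
Lemma measurable_translation (y : V) : measurable_fun setT (+%R^~ y : LV -> LV).
Proof.
move=> _ A mA; rewrite setTI.
suff : (@lebesgue_outer R N).-caratheodory (+%R^~ y @^-1` A) by [].
move=> X.
have shiftI (B : set V) : +%R^~ y @` (X `&` +%R^~ y @^-1` B) = (+%R^~ y @` X) `&` B.
  by apply/seteqP; split => [_ [x [Xx Bx] <-]|_ [[x Xx <-] Bx]]; [split=> //; exists x|exists x].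
have outer_shift (B : set V) : @lebesgue_outer R N B = lebesgue_outer (+%R^~ y @` B).
  by rewrite -[LHS](lebesgue_translation y).
rewrite outer_shift [X in _ = (X + _)%E]outer_shift [X in _ = (_ + X)%E]outer_shift.
by rewrite preimage_setC !shiftI; exact: mA.
Qed.

Lemma ge0_integral_translation (y : V) (f : V -> \bar R) :
  measurable_fun setT (f : LV -> \bar R) -> (forall x, 0 <= f x)%E ->
  (\int[mu]_x f (x + y)%R = \int[mu]_x f x)%E.
Proof.
move=> mf f0.
have shiftE : pushforward mu (+%R^~ y : LV -> LV) = mu.
  apply/funext => A; rewrite /pushforward -[LHS](lebesgue_translation y); congr (mu _).
  apply/seteqP; split => [_ [x Ax <-] //|x Ax].
  by exists (x - y); rewrite /= subrK.
have := @ge0_integral_pushforward _ _ LV LV R _ (measurable_translation y) mu setT f measurableT mf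
  (fun x _ => f0 x).
by rewrite preimage_setT shiftE => ->.
Qed.

End lebesgue_measure_facts.

(** * Test functions: difference quotients and integration by parts *)

Section translation_integral.
Context (R : realType) (N : nat).
Local Notation V := 'rV[R]_N.
Local Notation LV := (lebesgue_rVType R N).
Local Notation mu := (@lebesgue_rV R N).
Implicit Types (u p q : V -> R) (i : 'I_N).

Lemma integral_translation (y : V) (f : V -> \bar R) :
  measurable_fun setT (f : LV -> \bar R) ->
  (\int[mu]_x f (x + y)%R = \int[mu]_x f x)%E.
Proof.
move=> mf; rewrite integralE [RHS]integralE.
congr (_ - _)%E.
  rewrite -(ge0_integral_translation y (measurable_funepos mf)); last exact: funepos_ge0.
  by apply: eq_integral => x _; rewrite !funeposE.
rewrite -(ge0_integral_translation y (measurable_funeneg mf)); last exact: funeneg_ge0.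
by apply: eq_integral => x _; rewrite !funenegE.
Qed.

Definition bounded_support u := exists B : R, forall x, B < `|x| -> u x = 0.

Lemma closed_normball (B : R) : closed [set x : V | `|x| <= B].
Proof.
apply: (@preimage_closed _ _ (fun x : V => `|x|) [set r | r <= B]); last exact: closed_le.
by move=> x _; exact: norm_continuous.
Qed.

Lemma compact_normball (B : R) : compact [set x : V | `|x| <= B].
Proof.
apply: bounded_closed_compact; last exact: closed_normball.
exists B; split; first exact: num_real.
by move=> M BM x /= xB; apply: le_trans xB (ltW BM).
Qed.

Lemma lebesgue_normball_lty (B : R) : (mu [set x : V | (`|x| <= B)%R] < +oo)%E.
Proof.
apply: le_lt_trans (lebesgue_centered_cube_lty N (B + 1)).
apply: le_lebesgue.
move=> x /= xB i; have := le_trans (coord_le_norm x i) xB.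
by rewrite ler_norml; lra.
Qed.

Lemma continuous_bounded_support_bounded u : continuous u -> bounded_support u ->
  exists M : R, 0 < M /\ forall x, `|u x| <= M.
Proof.
move=> cu [B uB].
have [] := @EVT_max_rV R N (fun x => `|u x|) [set x | `|x| <= Num.max B 0].
- by exists 0; rewrite /= normr0 le_max lexx orbT.
- exact: compact_normball.
- apply: continuous_subspaceT => x; apply: continuous_comp; first exact: cu.
  exact: norm_continuous.
move=> c _ cmax; exists (`|u c| + 1); split=> [|x]; first by rewrite ltr_wpDl.
have [xB|Bx] := leP (`|x|) (Num.max B 0).
  by rewrite (le_trans (cmax x _))// ?inE// lerDl.
by rewrite uB ?normr0 ?addr_ge0// (le_lt_trans _ Bx)// le_max lexx.
Qed.

Lemma bounded_support_integrable u :
  measurable_fun setT (u : LV -> R) -> bounded_support u ->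
  (exists M : R, forall x, `|u x| <= M) -> mu.-integrable setT (EFin \o (u : LV -> R)).
Proof.
move=> mu_u [B uB] [M uM].
have mB : measurable ([set x : V | `|x| <= B] : set LV).
  exact/closed_lebesgue_measurable/closed_normball.
have -> : EFin \o u = (EFin \o u) \_ [set x : V | `|x| <= B].
  apply/funext => x; rewrite patchE; case: ifPn => //.
  by rewrite notin_setE /= => /negP; rewrite -ltNge => /uB ->.
apply/(integrable_mkcond _ mB).
apply: (@measurable_bounded_integrable _ LV R) => //; last 1 first.
- exists M; split; first exact: num_real.
  by move=> M' MM' x _; apply: le_trans (uM x) (ltW MM').
- exact: lebesgue_normball_lty.
- exact: measurable_funS mu_u.
Qed.

Lemma continuous_integrable u : continuous u -> bounded_support u ->
  mu.-integrable setT (EFin \o (u : LV -> R)).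
Proof.
move=> cu bu; apply: bounded_support_integrable => //.
  exact: continuous_lebesgue_measurable.
by have [M [_ uM]] := continuous_bounded_support_bounded cu bu; exists M.
Qed.

Local Notation e i := (delta_mx ord0 i : V).

Lemma difference_quotient_cvg u i x (t : nat -> R) :
  derivable u x (e i) -> (forall n, t n != 0) -> t @ \oo --> (0:R) ->
  (t n)^-1 * (u (x + t n *: e i) - u x) @[n --> \oo] --> partial i u x.
Proof.
move=> du t0 tcvg.
have t0' : t @ \oo --> (0 : R)^'.
  by move=> A /tcvg; rewrite !near_simpl /=; apply: filterS => n; apply.
have := cvg_comp _ _ t0' du.
have -> // : (fun h : R => h^-1 *: ((u \o shift x) (h *: e i) - u x)) \o t =
  (fun n => (t n)^-1 * (u (x + t n *: e i) - u x)).
by apply/funext => n /=; rewrite [_ + x]addrC.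
Qed.

Lemma partial_near0 u i x : (\forall y \near x, u y = 0) -> partial i u x = 0.
Proof.
move=> u0; rewrite /partial /derive; apply: cvg_lim => //; apply: cvg_near_cst.
have : \forall h \near (0:R)^', u (h *: e i + x) = 0.
  apply: (@cvg_within _ (nbhs (0:R))).
  have : (fun h : R => h *: e i + x) @ (0 : R) --> x.
    rewrite -[X in _ --> X]add0r -(scale0r (e i)).
    by apply: cvgD; [apply: cvgZr_tmp; exact: cvg_id|exact: cvg_cst].
  by move=> /(_ _ u0).
by apply: filterS => h /= ->; rewrite (nbhs_singleton u0) subrr scaler0.
Qed.

Lemma bounded_support_partial u i : bounded_support u -> bounded_support (partial i u).
Proof.
move=> [B uB]; exists B => x Bx; apply: partial_near0.
have oB : open [set y : V | B < `|y|].
  apply: (@open_comp _ _ (fun y : V => `|y|) [set r | B < r]); last exact: open_gt.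
  by move=> y _; exact: norm_continuous.
by apply: filterS (open_nbhs_nbhs (conj oB Bx)) => y; exact: uB.
Qed.

Lemma is_derive_line u i x (s : R) : (forall x, derivable u x (e i)) ->
  is_derive s 1 (fun s => u (x + s *: e i)) (partial i u (x + s *: e i)).
Proof.
move=> du.
have E h : ((fun s => u (x + s *: e i)) \o shift s) (h *: 1) - u (x + s *: e i) =
   (u \o shift (x + s *: e i)) (h *: e i) - u (x + s *: e i).
  by rewrite /= /shift/= [_ *: 1]mulr1 scalerDl addrCA.
split; rewrite /partial /derivable /derive.
  by under eq_fun do rewrite E; exact: du.
by under eq_fun do rewrite E.
Qed.

Lemma partial_lipschitz u i (K : R) : (forall x, derivable u x (e i)) ->
  (forall x, `|partial i u x| <= K) ->
  forall x t, `|u (x + t *: e i) - u x| <= K * `|t|.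
Proof.
move=> du uK x t.
have dl s := is_derive_line x s du.
have cl a b : {within `[a, b], continuous (fun s => u (x + s *: e i))}.
  by apply: derivable_within_continuous => s _; have [] := dl s.
have [t0|t0] := leP 0 t.
  have [c _] := MVT_segment t0 (fun s _ => dl s) (cl _ _).
  by rewrite scale0r addr0 subr0 => ->; rewrite normrM ler_wpM2r.
have [c _] := MVT_segment (ltW t0) (fun s _ => dl s) (cl _ _).
by rewrite scale0r addr0 distrC => ->; rewrite normrM add0r normrN ler_wpM2r.
Qed.

Definition C1c u := [/\ continuous u, bounded_support u,
  forall i, continuous (partial i u) & forall i x, derivable u x (e i)].

Lemma C1c_partial_bounded u i : C1c u ->
  exists K : R, 0 < K /\ forall x, `|partial i u x| <= K.
Proof.
move=> [cu bu cpu du]; apply: continuous_bounded_support_bounded => //.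
exact: bounded_support_partial.
Qed.

Local Notation J f := (Rintegral mu setT (f : LV -> R)).

Lemma Rintegral_translation y u : measurable_fun setT (u : LV -> R) ->
  J (fun x => u (x + y)) = J u.
Proof.
move=> mu_u; rewrite /Rintegral; congr fine.
by apply: (@integral_translation y (EFin \o u)); exact/measurable_EFinP.
Qed.

Lemma continuous_mulf p q : continuous p -> continuous q -> continuous (fun x => p x * q x).
Proof. by move=> cp cq x; exact: (continuousM (cp x) (cq x)). Qed.

Lemma continuous_subf p q : continuous p -> continuous q -> continuous (fun x => p x - q x).
Proof. by move=> cp cq x; exact: (continuousB (cp x) (cq x)). Qed.

Lemma continuous_cstf (c : R) : continuous (fun x : V => c).
Proof. by move=> x; exact: cst_continuous. Qed.

Lemma continuous_normf p : continuous p -> continuous (fun x => `|p x| : R).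
Proof. by move=> cp x; apply: continuous_comp; [exact: cp|exact: norm_continuous]. Qed.

Lemma continuous_shiftf p y : continuous p -> continuous (fun x : V => p (x + y)).
Proof.
move=> cp x; apply: continuous_comp; last exact: cp.
by apply: continuousD; [exact: cvg_id|exact: cst_continuous].
Qed.

Lemma Rintegral_dominated_cvg (g : nat -> V -> R) (h : V -> R) (M B : R) :
  (forall k, measurable_fun setT (g k : LV -> R)) -> measurable_fun setT (h : LV -> R) ->
  (forall k x, `|g k x| <= M) -> (forall k x, B < `|x| -> g k x = 0) ->
  (forall x, g k x @[k --> \oo] --> h x) ->
  J (g k) @[k --> \oo] --> J h.
Proof.
move=> mg mh gM gB gh.
have mB : measurable ([set x : V | `|x| <= B] : set LV).
  exact/closed_lebesgue_measurable/closed_normball.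
pose dom := M \o* \1_[set x : V | `|x| <= B] : V -> R.
have Idom : mu.-integrable setT (EFin \o (dom : LV -> R)).
  apply: bounded_support_integrable.
  - by apply: measurable_funM => //; exact: measurable_indic.
  - exists B => x Bx; rewrite /dom /= indicE memNset ?mul0r//=.
    by apply/negP; rewrite -ltNge.
  - exists `|M| => x; rewrite /dom/= indicE normrM.
    by case: (x \in _); rewrite ?normr0 ?normr1 ?mul1r ?mul0r.
have [] := @dominated_convergence _ LV R mu setT measurableT
  (fun k x => (g k x)%:E) (fun x => (h x)%:E) (EFin \o dom) _ _ _ Idom _.
- by move=> k; exact/measurable_EFinP.
- exact/measurable_EFinP.
- by apply: aeW => x _; apply: cvg_EFin; [exact: nearW|exact: gh].
- apply: aeW => x k _; rewrite /= lee_fin /dom/= indicE.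
  case: (boolP (x \in _)) => [_|]; first by rewrite mul1r; exact: gM.
  by rewrite notin_setE /= => /negP; rewrite -ltNge => /gB ->; rewrite normr0 mul0r.
move=> Ih _; rewrite -[X in _ --> X]fineK; last exact: integrable_fin_num.
by move/fine_cvg; apply.
Qed.

(** The quotients are bounded by the Lipschitz constant of [p] and [q] confines them to a
    bounded set, so dominated convergence applies. *)
Lemma difference_quotient_Rintegral_cvg p q i (t : nat -> R) :
  C1c p -> continuous q -> bounded_support q ->
  (forall n, t n != 0) -> t @ \oo --> (0:R) ->
  J (fun x => (t n)^-1 * (p (x + t n *: e i) - p x) * q x) @[n --> \oo] -->
  J (fun x => partial i p x * q x).
Proof.
move=> pC cq bq t0 tcvg; have [cp bp cpp dp] := pC.
have [K [K0 pK]] := C1c_partial_bounded i pC.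
have [M [M0 qM]] := continuous_bounded_support_bounded cq bq; have [B qB] := bq.
apply: (@Rintegral_dominated_cvg _ _ (K * M) B).
- move=> n; apply: continuous_lebesgue_measurable.
  apply: continuous_mulf => //; apply: continuous_mulf; first exact: continuous_cstf.
  by apply: continuous_subf => //; exact: continuous_shiftf.
- by apply: continuous_lebesgue_measurable; exact: continuous_mulf.
- move=> n x; rewrite normrM ler_pM// normrM normfV ler_pdivrMl ?normr_gt0// mulrC.
  exact: partial_lipschitz.
- by move=> n x /qB ->; rewrite mulr0.
- by move=> x; apply: cvgM; [exact: difference_quotient_cvg|exact: cvg_cst].
Qed.

Lemma continuous_integrableM p q : continuous p -> continuous q -> bounded_support q ->
  mu.-integrable setT (EFin \o (fun x : LV => p x * q x)).
Proof.
move=> cp cq [B qB]; apply: continuous_integrable; first exact: continuous_mulf.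
by exists B => x /qB ->; rewrite mulr0.
Qed.

Lemma eq_cvg_lim (a b : nat -> R) (la lb : R) : a @ \oo --> la -> b @ \oo --> lb ->
  (forall n, a n = b n) -> la = lb.
Proof. by move=> ala blb /funext ab; rewrite ab in ala; exact: (cvg_unique _ ala blb). Qed.

Lemma RintegralZB (c : R) p q :
  mu.-integrable setT (EFin \o (p : LV -> R)) -> mu.-integrable setT (EFin \o (q : LV -> R)) ->
  J (fun x => c * (p x - q x)) = c * (J p - J q).
Proof.
move=> Ip Iq; rewrite RintegralZl//; first by rewrite RintegralB.
exact: eq_integrable (integrableB measurableT Ip Iq).
Qed.

(** Discrete integration by parts: the translation invariance of the measure moves the
    difference from [p] to [q], with the opposite step. *)
Lemma difference_quotient_by_parts p q i (t : R) : t != 0 ->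
  continuous p -> bounded_support p -> continuous q -> bounded_support q ->
  J (fun x => t^-1 * (p (x + t *: e i) - p x) * q x) =
  - J (fun x => (- t)^-1 * (q (x + (- t) *: e i) - q x) * p x).
Proof.
move=> t0 cp bp cq bq.
have Ipq y : mu.-integrable setT (EFin \o (fun x : LV => p (x + y) * q x)).
  by apply: continuous_integrableM => //; exact: continuous_shiftf.
have Iqp y : mu.-integrable setT (EFin \o (fun x : LV => q (x + y) * p x)).
  by apply: continuous_integrableM => //; exact: continuous_shiftf.
have E y : J (fun x => p (x + y) * q x) = J (fun x => q (x - y) * p x).
  rewrite -[LHS](Rintegral_translation (- y)); last first.
    apply: continuous_lebesgue_measurable.
    by apply: continuous_mulf => //; exact: continuous_shiftf.
  by apply: eq_Rintegral => x _; rewrite subrK mulrC.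
transitivity (t^-1 * (J (fun x => p (x + t *: e i) * q x) - J (fun x => p (x + 0) * q x))).
  by rewrite -RintegralZB//; apply: eq_Rintegral => x _; rewrite addr0; lra.
rewrite !E; transitivity
    (- ((- t)^-1 * (J (fun x => q (x + - t *: e i) * p x) - J (fun x => q (x + 0) * p x)))).
  by rewrite invrN mulNr opprK scaleNr oppr0.
by congr (- _); rewrite -RintegralZB//; apply: eq_Rintegral => x _; rewrite addr0; lra.
Qed.

Lemma harmonic_neq0 n : (n.+1%:R^-1 : R) != 0.
Proof. by rewrite invr_neq0// pnatr_eq0. Qed.

Lemma harmonicN_neq0 n : - (n.+1%:R^-1 : R) != 0.
Proof. by rewrite oppr_eq0 harmonic_neq0. Qed.

Lemma harmonicN_cvg0 : (fun n => - (n.+1%:R^-1 : R)) @ \oo --> (0 : R).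
Proof. by rewrite -oppr0; apply: cvgN; exact: cvg_harmonic. Qed.

(** The limit of the discrete formula along the steps [1 / (n + 1)]. *)
Lemma Rintegral_by_parts p q i : C1c p -> C1c q ->
  J (fun x => partial i p x * q x) = - J (fun x => p x * partial i q x).
Proof.
move=> pC qC; have [cp bp _ _] := pC; have [cq bq _ _] := qC.
have lim1 := @difference_quotient_Rintegral_cvg _ _ i _ pC cq bq harmonic_neq0 (@cvg_harmonic R).
have lim2 := @difference_quotient_Rintegral_cvg _ _ i _ qC cp bp harmonicN_neq0 harmonicN_cvg0.
rewrite (_ : J (fun x => p x * _) = J (fun x => partial i q x * p x)); last first.
  by apply: eq_Rintegral => x _; rewrite mulrC.
apply: (eq_cvg_lim lim1 (cvgN lim2)) => n /=.
by rewrite difference_quotient_by_parts// harmonic_neq0.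
Qed.

Lemma C1c_shift p y : C1c p -> C1c (fun x => p (x + y)) /\
  forall i x, partial i (fun x => p (x + y)) x = partial i p (x + y).
Proof.
move=> [cp [B pB] cpp dp].
have E i (x : V) h : ((fun x => p (x + y)) \o shift x) (h *: e i) - p (x + y) =
    (p \o shift (x + y)) (h *: e i) - p (x + y) by rewrite /= addrA.
have partialE i (x : V) : partial i (fun x => p (x + y)) x = partial i p (x + y).
  by rewrite /partial /derive; under eq_fun do rewrite E.
split; last exact: partialE.
split.
- exact: continuous_shiftf.
- exists (B + `|y|) => x Bx; apply: pB.
  by have := ler_normB (x + y) y; rewrite addrK; lra.
- by move=> i; rewrite (funext (partialE i)); exact: continuous_shiftf.
- by move=> i x; rewrite /derivable; under eq_fun do rewrite E; exact: dp.
Qed.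

(** Mixed derivatives can be exchanged under the integral sign because partial
    derivatives commute with translations. *)
Lemma Rintegral_partialC p q i j : C1c p -> C1c q ->
  J (fun x => partial i p x * partial j q x) = J (fun x => partial j p x * partial i q x).
Proof.
move=> pC qC; have [cp bp cpp _] := pC; have [cq bq cqq _] := qC.
have lim1 := @difference_quotient_Rintegral_cvg _ _ i _ pC (cqq j) (bounded_support_partial j bq) harmonic_neq0 (@cvg_harmonic R).
have lim2 := @difference_quotient_Rintegral_cvg _ _ i _ qC (cpp j) (bounded_support_partial j bp) harmonicN_neq0 harmonicN_cvg0.
rewrite (_ : J (fun x => partial j p x * _) = J (fun x => partial i q x * partial j p x)); last first.
  by apply: eq_Rintegral => x _; rewrite mulrC.
apply: (eq_cvg_lim lim1 lim2) => n /=.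
set t := n.+1%:R^-1; have t0 : t != 0 := harmonic_neq0 n.
rewrite -[RHS]opprK -difference_quotient_by_parts//; last exact: bounded_support_partial.
have [ptC partial_pt] := C1c_shift (t *: e i) pC.
have [cpt _ cppt _] := ptC.
rewrite (_ : J (fun x => t^-1 * (p (x + t *: e i) - p x) * partial j q x) =
  t^-1 * (J (fun x => p (x + t *: e i) * partial j q x) - J (fun x => p x * partial j q x))); last first.
  rewrite -RintegralZB; [|by apply: continuous_integrableM => //; exact: bounded_support_partial..].
  by apply: eq_Rintegral => x _; lra.
rewrite (_ : J (fun x => t^-1 * (partial j p (x + t *: e i) - partial j p x) * q x) =
  t^-1 * (J (fun x => partial j (fun x => p (x + t *: e i)) x * q x) - J (fun x => partial j p x * q x))); last first.
  rewrite -RintegralZB; [|by apply: continuous_integrableM => //; exact: bounded_support_partial..].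
  by apply: eq_Rintegral => x _; rewrite partial_pt; lra.
by rewrite (Rintegral_by_parts j ptC qC) (Rintegral_by_parts j pC qC) -mulrN; congr (_ * _); lra.
Qed.

Lemma Rintegral_sum (I : Type) (r : seq I) (f : I -> V -> R) :
  (forall k, mu.-integrable setT (EFin \o (f k : LV -> R))) ->
  mu.-integrable setT (EFin \o (fun x : LV => \sum_(k <- r) f k x)) /\
  J (fun x => \sum_(k <- r) f k x) = \sum_(k <- r) J (f k).
Proof.
move=> If; elim: r => [|k r [Ir Er]].
  split; last by rewrite big_nil; under eq_Rintegral do rewrite big_nil; rewrite Rintegral_cst// mul0r.
  apply: eq_integrable (integrable0 mu setT) => // x _.
  by rewrite /= big_nil.
have E : (fun x => \sum_(k <- k :: r) f k x) = (fun x => f k x + \sum_(k <- r) f k x).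
  by apply/funext => x; rewrite big_cons.
rewrite E big_cons -Er; split; last by rewrite RintegralD.
exact: eq_integrable (integrableD measurableT (If k) Ir).
Qed.

Local Opaque partial.

(** Exchanging derivatives under the integral turns [(d_i d_j phi) ^ 2] into
    [(d_i d_i phi) * (d_j d_j phi)], and the double sum of these is the square of the Laplacian. *)
Lemma Rintegral_hessian (phi : V -> R) :
  C1c phi -> (forall i, C1c (partial i phi)) -> (forall i j, C1c (partial i (partial j phi))) ->
  \sum_i \sum_j J (fun x => partial i (partial j phi) x ^+ 2) = J (fun x => laplacian phi x ^+ 2).
Proof.
move=> C0 C1 C2.
have sym i j q : C1c q ->
    J (fun x => partial i (partial j phi) x * q x) = J (fun x => partial j (partial i phi) x * q x).
  move=> qC; apply: etrans (Rintegral_by_parts i (C1 j) qC) _.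
  apply: etrans _ (esym (Rintegral_by_parts j (C1 i) qC)).
  exact: (congr1 -%R (Rintegral_partialC j i C0 qC)).
have cC p : C1c p -> continuous p by case.
have bC p : C1c p -> bounded_support p by case.
have II i j k l : mu.-integrable setT (EFin \o (fun x : LV =>
    partial i (partial j phi) x * partial k (partial l phi) x)).
  exact: (continuous_integrableM (cC _ (C2 _ _)) (cC _ (C2 _ _)) (bC _ (C2 _ _))).
transitivity (\sum_i \sum_j J (fun x => partial i (partial i phi) x * partial j (partial j phi) x)).
  apply: eq_bigr => i _; apply: eq_bigr => j _.
  apply: etrans _ (esym (Rintegral_partialC i j (C1 i) (C1 j))).
  apply: etrans _ (sym i j _ (C2 i j)).
  by apply: eq_Rintegral => x _; rewrite expr2.
rewrite pair_bigA -(Rintegral_sum _ (fun k => II _ _ _ _)).2.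
apply: eq_Rintegral => x _; rewrite expr2 /laplacian mulr_suml.
under [RHS]eq_bigr do rewrite mulr_sumr.
by rewrite pair_bigA.
Qed.
End translation_integral.

(** * An isoperimetric estimate for level sets *)

Section level_estimate.
Context (R : realType) (N : nat).
Local Notation V := 'rV[R]_N.
Local Notation LV := (lebesgue_rVType R N).
Local Notation mu := (@lebesgue_rV R N).
Local Notation J f := (Rintegral mu setT (f : LV -> R)).
Local Notation e i := (delta_mx ord0 i : V).
Implicit Types (u f : V -> R) (i : 'I_N) (l : R).
Local Opaque partial.

(** Cuts [|s|] off to the upper half of the layer between [l] and [2 * l]: the
    margin below makes the support of its gradient lie in [l < |s| <= 2 * l]. *)
Definition layer (l s : R) : R := Num.max 0 (Num.min 1 (2 / l * `|s| - 3)).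

Lemma layer_eq0 l (s : R) : 0 < l -> `|s| <= 3 / 2 * l -> layer l s = 0.
Proof.
move=> l0 sl; apply/max_l; rewrite ge_min; apply/orP; right.
by rewrite subr_le0 mulrAC ler_pdivrMr//; lra.
Qed.

Lemma layer_eq1 l (s : R) : 0 < l -> 2 * l <= `|s| -> layer l s = 1.
Proof.
move=> l0 sl; rewrite /layer min_l ?max_r ?ler01//.
by rewrite lerBrDr mulrAC ler_pdivlMr//; lra.
Qed.

Lemma layer_lipschitz l (s t : R) : 0 < l -> `|layer l s - layer l t| <= 2 / l * `|s - t|.
Proof.
move=> l0; have l20 : 0 < 2 / l by rewrite divr_gt0.
apply: (@le_trans _ _ `|2 / l * `|s| - 2 / l * `|t| |); last first.
  rewrite -mulrBr normrM gtr0_norm// ler_pM2l//.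
  exact: ler_dist_dist.
rewrite /layer; move: (2 / l * `|s|) (2 / l * `|t|) => a b.
wlog ab : a b / a <= b => [H|].
  by have /orP[/H//|/H] := le_total a b; rewrite distrC [leRHS]distrC.
rewrite distrC [leRHS]distrC [leRHS]ger0_norm ?subr_ge0// ler_norml.
case: (leP 1 (a - 3)) => ?; case: (leP 1 (b - 3)) => ?;
  do ![case: (leP 0 _) => ?]; apply/andP; split; lra.
Qed.

Lemma continuous_layer l : 0 < l -> continuous (layer l).
Proof.
move=> l0 s; have l20 : 0 < 2 / l by rewrite divr_gt0.
apply/cvgrPdist_lt => eps eps0; near=> t.
apply: le_lt_trans (layer_lipschitz _ _ l0) _; rewrite mulrC -ltr_pdivlMr//.
by near: t; apply: cvgr_dist_lt; rewrite ?divr_gt0//; exact: cvg_id.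
Unshelve. all: by end_near. Qed.

Lemma continuous_layerf l u : 0 < l -> continuous u -> continuous (fun x => layer l (u x)).
Proof.
move=> l0 cu x.
have cl := continuous_layer l0.
exact: (continuous_comp (cu x) (cl (u x))).
Qed.

Lemma sqrD_le2 (a b : R) : (a + b) ^+ 2 <= 2 * a ^+ 2 + 2 * b ^+ 2.
Proof. by have := sqr_ge0 (a - b); rewrite sqrrB sqrrD; lra. Qed.

Lemma square_difference_integrable f (y z : V) : continuous f -> bounded_support f ->
  mu.-integrable setT (EFin \o (fun x : LV => (f (x + y) - f (x + z)) ^+ 2)).
Proof.
move=> cf [B fB]; have cD : continuous (fun x : V => f (x + y) - f (x + z)).
  by apply: continuous_subf; exact: continuous_shiftf.
apply: (continuous_integrableM cD cD).
exists (B + `|y| + `|z|) => x Bx; rewrite !fB ?subrr//.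
  by have := ler_normB (x + z) z; rewrite addrK; have := normr_ge0 y; lra.
by have := ler_normB (x + y) y; rewrite addrK; have := normr_ge0 z; lra.
Qed.

(** The triangle inequality in L^2 for a translation in two steps, squared. *)
Lemma Rintegral_differenceD f (y z : V) : continuous f -> bounded_support f ->
  J (fun x => (f (x + (y + z)) - f x) ^+ 2) <=
  2 * J (fun x => (f (x + y) - f x) ^+ 2) + 2 * J (fun x => (f (x + z) - f x) ^+ 2).
Proof.
move=> cf bf; have ID v w := square_difference_integrable v w cf bf.
have I0 v : mu.-integrable setT (EFin \o (fun x : LV => (f (x + v) - f x) ^+ 2)).
  by apply: eq_integrable (ID v 0) => // x _; rewrite /= addr0.
have E : J (fun x => (f (x + (y + z)) - f (x + y)) ^+ 2) = J (fun x => (f (x + z) - f x) ^+ 2).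
  apply: etrans (Rintegral_translation y (u := fun x => (f (x + z) - f x) ^+ 2) _).
    by apply: eq_Rintegral => x _; rewrite addrA.
  exact/measurable_EFinP/(measurable_int mu (I0 z)).
have I1 := integrableZl measurableT 2 (ID (y + z) y).
have I2 := integrableZl measurableT 2 (I0 y).
apply: (@le_trans _ _ (J (fun x => 2 * (f (x + (y + z)) - f (x + y)) ^+ 2 + 2 * (f (x + y) - f x) ^+ 2))).
  apply: le_Rintegral => //; first exact: eq_integrable (integrableD measurableT I1 I2).
  by move=> x _; apply: le_trans (sqrD_le2 _ _); rewrite subrKA.
rewrite RintegralD//.
by rewrite !RintegralZl// E addrC.
Qed.

(** Halving the step [k] times costs the factor [4 ^ k], which is what the square of the step
    gains: a quadratic bound for small steps extends to all steps without loss. *)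
Lemma Rintegral_difference_dyadic f i (t : R) k : continuous f -> bounded_support f ->
  J (fun x => (f (x + t *: e i) - f x) ^+ 2) <=
  4 ^+ k * J (fun x => (f (x + (t / 2 ^+ k) *: e i) - f x) ^+ 2).
Proof.
move=> cf bf; elim: k => [|k IH]; first by rewrite expr0 divr1 mul1r.
apply: le_trans IH _; rewrite exprSr -mulrA ler_pM2l ?exprn_gt0//.
have -> : t / 2 ^+ k = 2 * (t / 2 ^+ k.+1) by rewrite exprS; field; rewrite expf_neq0.
have -> : (2 * (t / 2 ^+ k.+1)) *: e i = (t / 2 ^+ k.+1) *: e i + (t / 2 ^+ k.+1) *: e i.
  by rewrite -scalerDl mulr_natl mulr2n.
apply: le_trans (Rintegral_differenceD _ _ cf bf) _.
by rewrite -mulrDl -natrD.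
Qed.

Definition shell u (l : R) : set V := [set x | l < `|u x| <= 2 * l].

Lemma measurable_norm_itv u (I : interval R) : continuous u ->
  measurable ([set x | `|u x| \in I] : set LV).
Proof.
move=> cu; have mu_u : measurable_fun setT ((fun x => `|u x|) : LV -> R).
  by apply: continuous_lebesgue_measurable; exact: continuous_normf.
by have := mu_u measurableT _ (measurable_itv I); rewrite setTI.
Qed.

Lemma measurable_shell u l : continuous u -> measurable (shell u l : set LV).
Proof.
move=> cu; have := measurable_norm_itv `]l, 2 * l] cu.
by congr (measurable _); apply/seteqP; split => x; rewrite /= in_itv.
Qed.

Lemma cvg_lower_bound (a : nat -> R) (la c : R) :
  a @ \oo --> la -> (forall n, c <= a n) -> c <= la.
Proof.
move=> cv ca; rewrite -(cvg_lim _ cv)//; apply: limr_ge; first exact: cvgP cv.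
exact: nearW.
Qed.

(** The truncation of [u] need not be differentiable. Its differences are reduced to small steps
    by halving; there they are dominated by those of [u] on the upper half of the shell, and
    in the limit they vanish at the other points, near which the truncation is constant. *)
Lemma Rintegral_layer_difference u l i (t : R) : 0 < l -> C1c u ->
  J (fun x => (layer l (u (x + t *: e i)) - layer l (u x)) ^+ 2) <=
  (2 / l) ^+ 2 * t ^+ 2 * \int[mu]_(x in shell u l) (partial i u x ^+ 2).
Proof.
move=> l0 uC; have [cu [B uB] cpu du] := uC.
have [K [K0 uK]] := C1c_partial_bounded i uC.
have [->|t0] := eqVneq t 0.
  rewrite expr0n mulr0 mul0r; under eq_Rintegral do rewrite scale0r addr0 subrr expr0n.
  by rewrite Rintegral_cst// mul0r.
pose f x := layer l (u x).
have cf : continuous f by exact: continuous_layerf.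
have bf : bounded_support f.
  by exists B => x /uB ux; rewrite /f ux layer_eq0// normr0; lra.
have l20 : 0 < 2 / l by rewrite divr_gt0.
pose s k := t / 2 ^+ k.
have s0 k : s k != 0 by rewrite mulf_neq0// invr_neq0// expf_neq0.
have scvg : s @ \oo --> (0 : R).
  have : geometric t 2^-1 @ \oo --> (0 : R).
    by apply: cvg_geometric; rewrite ger0_norm ?invr_ge0// invf_lt1// ltr1n.
  by rewrite /geometric /=; under eq_fun do rewrite exprVn.
have s_le k : `|s k| <= `|t|.
  rewrite normrM normfV ler_pdivrMr ?normr_gt0 ?expf_neq0// ler_peMr//.
  by rewrite normrX ger0_norm// exprn_ege1// ler1n.
pose S : set V := [set x | `|u x| \in `[3 / 2 * l, 2 * l]].
have mS : measurable (S : set LV) by exact: measurable_norm_itv.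
pose q k x := (s k)^-1 * (u (x + s k *: e i) - u x).
pose r k x := (s k)^-1 * (f (x + s k *: e i) - f x).
pose g k x := \1_S x * ((2 / l) ^+ 2 * q k x ^+ 2) + (1 - \1_S x) * r k x ^+ 2.
pose h x := \1_S x * ((2 / l) ^+ 2 * partial i u x ^+ 2).
have rq k x : r k x ^+ 2 <= (2 / l) ^+ 2 * q k x ^+ 2.
  rewrite -exprMn -[leLHS]real_normK ?num_real// -[leRHS]real_normK ?num_real//.
  rewrite ler_sqr ?nnegrE// normrM (mulrCA (2 / l)) normrM ler_wpM2l// normrM.
  by rewrite (gtr0_norm l20); exact: layer_lipschitz.
have gE k x : g k x = if x \in S then (2 / l) ^+ 2 * q k x ^+ 2 else r k x ^+ 2.
  by rewrite /g indicE; case: (x \in S); rewrite ?mul1r ?subrr ?mul0r ?addr0 ?subr0 ?mul1r ?add0r.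
have rg k x : r k x ^+ 2 <= g k x by rewrite gE; case: ifP.
have gq k x : g k x <= (2 / l) ^+ 2 * q k x ^+ 2 by rewrite gE; case: ifP.
have g_ge0 k x : 0 <= g k x by apply: le_trans (rg k x); exact: sqr_ge0.
have qK k x : q k x ^+ 2 <= K ^+ 2.
  rewrite -[leLHS]real_normK ?num_real// ler_sqr ?nnegrE ?(ltW K0)//.
  by rewrite normrM normfV ler_pdivrMl ?normr_gt0// mulrC; exact: partial_lipschitz.
have ul : 0 < (2 / l) ^+ 2 by rewrite exprn_gt0.
have gM k x : `|g k x| <= (2 / l) ^+ 2 * K ^+ 2.
  by rewrite ger0_norm// (le_trans (gq k x))// ler_wpM2l// sqr_ge0.
pose B' := B + `|t| * `|e i|.
have far k x : B' < `|x| -> B < `|x| /\ B < `|x + s k *: e i|.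
  rewrite /B' => Bx; have se : `|s k *: e i| <= `|t| * `|e i|.
    by rewrite normrZ ler_wpM2r.
  have := ler_normB (x + s k *: e i) (s k *: e i); rewrite addrK.
  by have := normr_ge0 (s k *: e i); lra.
have gB k x : B' < `|x| -> g k x = 0.
  move=> /(far k)[Bx Bxs]; rewrite gE /q /r /f !uB//.
  by rewrite !subrr mulr0 expr0n mulr0; case: ifP.
have ucvg x : u (x + s k *: e i) @[k --> \oo] --> u x.
  apply/cvgrPdist_lt => eps eps0.
  have Ks : K * `|s k| @[k --> \oo] --> (0 : R).
    rewrite -[X in _ --> X](mulr0 K); apply: cvgMl_tmp.
    by rewrite -[X in _ --> X](normr0 R); exact: cvg_norm.
  apply: (filterS _ (cvgr_lt _ Ks _ eps0)) => k /=.
  by apply: le_lt_trans; rewrite distrC; exact: partial_lipschitz.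
have uscvg x : `|u (x + s k *: e i)| @[k --> \oo] --> `|u x| by exact: cvg_norm.
have gh x : g k x @[k --> \oo] --> h x.
  under eq_fun do rewrite gE; rewrite /h indicE.
  have [xS|xS] := boolP (x \in S).
    rewrite mul1r; apply: cvgMl_tmp; rewrite expr2; under eq_fun do rewrite expr2.
    by apply: cvgM; exact: difference_quotient_cvg.
  rewrite mul0r; apply: cvg_near_cst.
  have : `|u x| < 3 / 2 * l \/ 2 * l < `|u x|.
    move: xS; rewrite notin_setE /S /= in_itv/= => /negP.
    by rewrite negb_and -!ltNge => /orP[]; [left|right].
  case=> ux.
    apply: (filterS _ (cvgr_lt _ (uscvg x) _ ux)) => k /= uk.
    by rewrite /r /f !layer_eq0 ?subrr ?mulr0 ?expr0n// ltW.
  apply: (filterS _ (cvgr_gt _ (uscvg x) _ ux)) => k /= uk.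
  by rewrite /r /f !layer_eq1 ?subrr ?mulr0 ?expr0n// ltW.
have cq k : continuous (q k).
  apply: continuous_mulf; first exact: continuous_cstf.
  by apply: continuous_subf => //; exact: continuous_shiftf.
have cr k : continuous (r k).
  apply: continuous_mulf; first exact: continuous_cstf.
  by apply: continuous_subf => //; exact: continuous_shiftf.
have mind : measurable_fun setT (\1_S : LV -> R) by exact: measurable_indic.
have msq (p : V -> R) : continuous p -> measurable_fun setT ((fun x => p x ^+ 2) : LV -> R).
  by move=> cp; apply: measurable_funX; exact: continuous_lebesgue_measurable.
have mg k : measurable_fun setT (g k : LV -> R).
  have m1 := measurable_funM mind (measurable_funM (measurable_cst ((2 / l) ^+ 2)) (msq _ (cq k))).
  have m2 := measurable_funM (measurable_funB (measurable_cst (1 : R)) mind) (msq _ (cr k)).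
  exact: (measurable_funD m1 m2).
have mh : measurable_fun setT (h : LV -> R).
  exact: (measurable_funM mind (measurable_funM (measurable_cst ((2 / l) ^+ 2)) (msq _ (cpu i)))).
have Ir k : mu.-integrable setT (EFin \o (fun x : LV => r k x * r k x)).
  apply: (continuous_integrableM (cr k) (cr k)).
  by exists B' => x /(far k)[? ?]; rewrite /r /f !uB// subrr mulr0.
have Ig k : mu.-integrable setT (EFin \o (g k : LV -> R)).
  by apply: bounded_support_integrable => //; [exists B'; exact: gB|exists ((2 / l) ^+ 2 * K ^+ 2)].
have lim_g : J (g k) @[k --> \oo] --> J h by exact: Rintegral_dominated_cvg mg mh gM gB gh.
have h_le : J h <= (2 / l) ^+ 2 * \int[mu]_(x in shell u l) (partial i u x ^+ 2).
  have Ip : mu.-integrable setT (EFin \o (fun x : LV => partial i u x ^+ 2)).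
    exact: (continuous_integrableM (cpu i) (cpu i) (bounded_support_partial i (ex_intro _ B uB))).
  have mE := measurable_shell l cu.
  have IE : mu.-integrable (shell u l : set LV) (EFin \o (fun x : LV => partial i u x ^+ 2)).
    exact: integrableS Ip.
  rewrite -RintegralZl// [X in _ <= X]Rintegral_mkcond; apply: le_Rintegral => //.
  - apply: bounded_support_integrable => //.
    + have [Bp pB] := bounded_support_partial i (ex_intro _ B uB).
      by exists Bp => x /pB p0; rewrite /h p0 expr0n !mulr0.
    + exists ((2 / l) ^+ 2 * K ^+ 2) => x.
      rewrite /h indicE normrM; case: (x \in S); rewrite ?normr1 ?normr0 ?mul1r ?mul0r.
        rewrite normrM (gtr0_norm ul) ler_pM2l// normrX ler_sqr ?nnegrE ?(ltW K0)//.
      by rewrite mulr_ge0 ?sqr_ge0.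
  - apply: eq_integrable ((integrable_mkcond _ mE).1 (integrableZl mE ((2 / l) ^+ 2) IE)) => //.
    by move=> x _; rewrite /= !patchE; case: ifP.
  move=> x _; rewrite patchE /h indicE; case: ifPn => [_|xE].
    case: (x \in S); rewrite ?mul1r// mul0r.
    by rewrite mulr_ge0// sqr_ge0.
  rewrite memNset ?mul0r// => xS; move: xE; rewrite notin_setE; apply.
  by move: xS; rewrite /S /shell /= in_itv/= => /andP[? ->]; rewrite andbT; lra.
have D_le k : J (fun x => (f (x + t *: e i) - f x) ^+ 2) <= t ^+ 2 * J (g k).
  apply: le_trans (Rintegral_difference_dyadic i t k cf bf) _.
  have -> : J (fun x => (f (x + (t / 2 ^+ k) *: e i) - f x) ^+ 2) = s k ^+ 2 * J (fun x => r k x * r k x).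
    rewrite -RintegralZl//; apply: eq_Rintegral => x _.
    by rewrite -expr2 -exprMn /r mulVKf.
  have -> : 4 ^+ k * (s k ^+ 2 * J (fun x => r k x * r k x)) = t ^+ 2 * J (fun x => r k x * r k x).
    rewrite mulrA; congr (_ * _); rewrite /s expr_div_n exprAC mulrCA (_ : 2 ^+ 2 = 4 :> R); last by ring.
    by rewrite divff ?mulr1// expf_neq0.
  by rewrite ler_wpM2l ?sqr_ge0//; apply: (le_Rintegral measurableT (Ir k) (Ig k)) => x _; rewrite -expr2; exact: rg.
rewrite mulrAC; apply: (@le_trans _ _ (t ^+ 2 * J h)); last first.
  by rewrite mulrC ler_pM2r// exprn_even_gt0.
by apply: (@cvg_lower_bound (fun k => t ^+ 2 * J (g k))) => //; apply: cvgMl_tmp.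
Qed.

Definition shell_energy u l := \sum_i \int[mu]_(x in shell u l) (partial i u x ^+ 2).

Lemma shell_energy_ge0 u l : 0 <= shell_energy u l.
Proof. by apply: sumr_ge0 => i _; apply: Rintegral_ge0 => x _; exact: sqr_ge0. Qed.

(** The translation by [y] is made along one coordinate after the other; each change of
    coordinate costs a factor 2. *)
Lemma Rintegral_layer_translation u l (r : R) (y : V) : 0 < l -> C1c u -> cube r y ->
  J (fun x => (layer l (u (x + y)) - layer l (u x)) ^+ 2) <=
  2 ^+ N * (2 / l) ^+ 2 * r ^+ 2 * shell_energy u l.
Proof.
move=> l0 uC yr; have [cu [B uB] _ _] := uC.
have cf := continuous_layerf l0 cu.
have bf : bounded_support (fun x => layer l (u x)).
  by exists B => x /uB ux; rewrite ux layer_eq0// normr0; lra.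
have step i : J (fun x => (layer l (u (x + y ord0 i *: e i)) - layer l (u x)) ^+ 2) <=
    (2 / l) ^+ 2 * r ^+ 2 * \int[mu]_(x in shell u l) (partial i u x ^+ 2).
  apply: le_trans (Rintegral_layer_difference i _ l0 uC) _.
  rewrite ler_wpM2r//; first by apply: Rintegral_ge0 => x _; exact: sqr_ge0.
  by rewrite ler_wpM2l ?sqr_ge0//; have := yr i; nra.
have double_le (a b c d C : R) n : a <= 2 ^+ n * (C * d) -> 0 <= c -> 0 <= C -> b <= C * c ->
    2 * b + 2 * a <= 2 ^+ n.+1 * (C * (c + d)).
  move=> ad c0 C0 bc; rewrite exprS -mulrA -mulrDr ler_pM2l// !mulrDr addrC [leRHS]addrC lerD//.
  by apply: le_trans bc _; rewrite ler_peMl ?exprn_ege1 ?ler1n// mulr_ge0.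
have sum_le (s : seq 'I_N) : J (fun x => (layer l (u (x + \sum_(i <- s) y ord0 i *: e i)) - layer l (u x)) ^+ 2) <=
    2 ^+ size s * ((2 / l) ^+ 2 * r ^+ 2 * \sum_(i <- s) \int[mu]_(x in shell u l) (partial i u x ^+ 2)).
  elim: s => [|i s IH].
    rewrite !big_nil !mulr0; under eq_Rintegral do rewrite addr0 subrr expr0n.
    by rewrite Rintegral_cst// mul0r.
  rewrite !big_cons.
  apply: le_trans (Rintegral_differenceD _ _ cf bf) _.
  apply: double_le IH _ _ (step i); last by rewrite mulr_ge0 ?sqr_ge0.
  by apply: Rintegral_ge0 => x _; exact: sqr_ge0.
have := sum_le (enum 'I_N); rewrite size_enum_ord !big_enum_cond/= -(row_sum_delta y).
by rewrite -!mulrA.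
Qed.

Lemma integral_scaled_indic (B : set V) (k : \bar R) : measurable (B : set LV) -> (0 <= k)%E ->
  (\int[mu]_x (k * (\1_B x)%:E) = k * mu B)%E.
Proof.
move=> mB k0.
have m1 : measurable_fun setT (EFin \o (\1_B : LV -> R)).
  exact/measurable_EFinP/measurable_indic.
have ind0 (x : LV) : setT x -> (0 <= (EFin \o (\1_B : LV -> R)) x)%E.
  by move=> _; rewrite lee_fin.
apply: etrans (ge0_integralZl mu measurableT m1 ind0 k0) _; congr (_ * _)%E.
by apply: etrans (integral_indic mu measurableT mB) _; rewrite setIT.
Qed.

(** For [x] in [A], the points [y] of [Q] that keep [x + y] out of [S] have measure at least
    [mu S], and for these the difference is 1. Tonelli's theorem then compares the
    average over [Q] of the integrals of the squared differences with [mu A]. *)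
Lemma measure_le_average f (A S Q : set V) (b : R) :
  continuous f -> measurable (A : set LV) -> measurable (S : set LV) -> measurable (Q : set LV) ->
  (forall x, A x -> f x = 1) -> (forall x, ~ S x -> f x = 0) -> 0 <= b ->
  (mu S < +oo)%E -> (0 < mu S)%E -> (mu Q = 2%:E * mu S)%E ->
  (forall y, Q y -> \int[mu]_x ((f (x + y) - f x) ^+ 2)%:E <= b%:E)%E ->
  (mu A <= (2 * b)%:E)%E.
Proof.
move=> cf mA mS mQ fA fS b0 Soo S0 QS fb.
pose F (z : LV * LV) : \bar R := (\1_A z.1 * \1_Q z.2 * (f (z.1 + z.2) - f z.1) ^+ 2)%:E.
have mF : measurable_fun setT F.
  apply/measurable_EFinP; apply: measurable_funM.
    apply: measurable_funM.
      by apply: measurableT_comp measurable_fst; exact: measurable_indic.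
    by apply: measurableT_comp measurable_snd; exact: measurable_indic.
  apply: measurable_funX; apply: measurable_funB.
    apply: (@measurable_fun_continuous_comp _ _ _ _ (fun z : LV * LV => z.1 + z.2) _ _ cf) => i.
    rewrite [X in measurable_fun _ X](_ : _ =
        (fun z : LV * LV => (z.1 : V) ord0 i + (z.2 : V) ord0 i)); last first.
      by apply/funext => z; rewrite mxE.
    have m1 := measurableT_comp (measurable_coord i) (@measurable_fst _ _ LV LV).
    have m2 := measurableT_comp (measurable_coord i) (@measurable_snd _ _ LV LV).
    exact: (measurable_funD m1 m2).
  by apply: measurableT_comp measurable_fst; exact: continuous_lebesgue_measurable.
have F0 z : (0 <= F z)%E.
  by rewrite lee_fin mulr_ge0 ?sqr_ge0// mulr_ge0.
have fub := @fubini_tonelli _ _ LV LV R mu mu F mF F0.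
have mdiff y : measurable_fun setT (fun x : LV => ((f (x + y) - f x) ^+ 2)%:E).
  apply/measurable_EFinP/measurable_funX/continuous_lebesgue_measurable.
  by apply: continuous_subf => //; exact: continuous_shiftf.
have ind (B : set V) : measurable (B : set LV) -> measurable_fun setT (EFin \o (\1_B : LV -> R)).
  by move=> mB; exact/measurable_EFinP/measurable_indic.
have le_r : (\int[mu]_y \int[mu]_x F (x, y) <= b%:E * (2%:E * mu S))%E.
  rewrite -QS -(integral_scaled_indic mQ) ?lee_fin//.
  apply: (@ge0_le_integral _ LV R mu setT measurableT).
  - by move=> y _; apply: integral_ge0 => x _; exact: F0.
  - exact: measurable_fun_fubini_tonelli_G.
  - exact: (emeasurable_funM (measurable_cst _) (ind _ mQ)).
  move=> y _; rewrite indicE; have [yQ|yQ] := boolP (y \in Q); last first.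
    rewrite mule0 integral0_eq// => x _.
    by rewrite /F /= [\1_Q y]indicE (negbTE yQ) mulr0 mul0r.
  rewrite mule1; apply: le_trans (fb y _); last by rewrite inE in yQ.
  apply: (@ge0_le_integral _ LV R mu setT measurableT).
  - by move=> x _; exact: F0.
  - exact: (measurableT_comp mF (pair2_measurable y)).
  - exact: mdiff.
  - move=> x _; rewrite lee_fin /= ler_piMl ?sqr_ge0// mulr_ile1//.
have le_l : (mu A * mu S <= \int[mu]_x \int[mu]_y F (x, y))%E.
  rewrite muleC -(integral_scaled_indic mA (measure_ge0 _ _)).
  apply: (@ge0_le_integral _ LV R mu setT measurableT).
  - by move=> x _; rewrite mule_ge0// lee_fin.
  - exact: (emeasurable_funM (measurable_cst _) (ind _ mA)).
  - exact: measurable_fun_fubini_tonelli_F.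
  move=> x _; rewrite indicE; have [xA|xA] := boolP (x \in A); last first.
    by rewrite mule0; apply: integral_ge0 => y _; exact: F0.
  rewrite mule1; rewrite inE in xA.
  pose T := +%R^~ (- x) @` S.
  have mT : measurable (T : set LV).
    rewrite (_ : T = +%R^~ x @^-1` S); first by rewrite -[X in measurable X]setTI; exact: measurable_translation.
    by apply/seteqP; split => [_ [y Sy <-]|y Sy]; [rewrite /= subrK|exists (y + x); rewrite //= addrK].
  have muT : mu T = mu S by exact: lebesgue_translation.
  have mQT : measurable (Q `\` T : set LV) by exact: measurableD.
  apply: (@le_trans _ _ (mu (Q `\` T))).
    have Sfin : mu S \is a fin_num by rewrite ge0_fin_numE.
    rewrite -[leLHS](addeK _ Sfin) (leeBlDr _ _ Sfin).
    apply: (@le_trans _ _ (mu Q)); first by rewrite QS mule_natl mule2n.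
    rewrite (measureDI mu mQ mT); apply: leeD2l; rewrite -muT.
    exact: (le_lebesgue (@subIsetr _ Q T)).
  rewrite -[leLHS]mul1e -(integral_scaled_indic mQT)//.
  apply: (@ge0_le_integral _ LV R mu setT measurableT).
  - by move=> y _; rewrite mul1e lee_fin.
  - exact: (emeasurable_funM (measurable_cst _) (ind _ mQT)).
  - exact: (measurableT_comp mF (pair1_measurable x)).
  have ind1 (B : set V) z : B z -> \1_B z = 1 :> R by move=> Bz; rewrite indicE mem_set.
  move=> y _; rewrite mul1e /F lee_fin (ind1 A x xA) (fA _ xA) mul1r.
  have [yQT|yQT] := boolP (y \in Q `\` T); last first.
    by rewrite [leLHS]indicE (negbTE yQT) mulr_ge0 ?sqr_ge0.
  rewrite inE in yQT; have [Qy Ty] := yQT.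
  rewrite (ind1 _ _ yQT) (ind1 _ _ Qy) fS ?sub0r ?sqrrN ?expr1n ?mulr1//.
  by move=> Sxy; apply: Ty; exists (x + y) => //; rewrite addrC addKr.
have := le_trans le_l (le_trans _ le_r); rewrite fub lexx => /(_ isT).
rewrite muleA (_ : b%:E * 2%:E = (2 * b)%:E)%E; last by rewrite -EFinM mulrC.
have Sfin : mu S \is a fin_num by rewrite (ge0_fin_numE (measure_ge0 mu S)).
by rewrite (lee_pmul2r Sfin S0).
Qed.

(** Translate the layer by the cube whose volume is twice that of the set [l < |u|]: its side
    squared is proportional to the power [2 / N] of this volume. *)
Lemma level_set_estimate u l : (0 < N)%N -> 0 < l -> C1c u ->
  l ^+ 2 * fine (mu [set x | 2 * l < `|u x|]%R) <=
  2 ^+ (N + 3) * (2 / fine (mu (cube 1))) `^ (2 / N%:R) *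
  (fine (mu [set x | l < `|u x|]%R)) `^ (2 / N%:R) * shell_energy u l.
Proof.
move=> N0 l0 uC; have [cu [B uB] _ _] := uC.
set A := [set x | _]; set S := [set x | l < _].
have AS : A `<=` S by move=> x; rewrite /A /S /=; lra.
have mA : measurable (A : set LV).
  have := measurable_norm_itv `]2 * l, +oo[ cu; congr (measurable _).
  by apply/seteqP; split => x; rewrite /= in_itv/= andbT.
have mS : measurable (S : set LV).
  have := measurable_norm_itv `]l, +oo[ cu; congr (measurable _).
  by apply/seteqP; split => x; rewrite /= in_itv/= andbT.
have Soo : (mu S < +oo)%E.
  apply: le_lt_trans (lebesgue_normball_lty N B); apply: le_lebesgue => x Sx /=.
  by rewrite leNgt; apply/negP => /uB ux; move: Sx; rewrite /S /= ux normr0; lra.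
have E0 := shell_energy_ge0 u l.
have [S0|S0] := eqVneq (mu S) 0%E.
  have -> : mu A = 0%E by apply/eqP; rewrite eq_le measure_ge0 andbT -S0; exact: le_lebesgue.
  by rewrite mulr0 !mulr_ge0 ?powR_ge0 ?exprn_ge0.
have S_gt0 : (0 < mu S)%E by rewrite lt0e S0 measure_ge0.
have Sfin : mu S \is a fin_num by rewrite ge0_fin_numE.
set a := fine (mu S); have a0 : 0 < a by apply: fine_gt0; rewrite S_gt0.
have c_gt0 : (0 < mu (cube 1))%E.
  rewrite lt0e measure_ge0 andbT; apply/eqP => /lebesgue_cube_eq0 T0.
  move/eqP: S0; apply; apply/eqP; rewrite eq_le measure_ge0 andbT -T0; exact: le_lebesgue.
set c := fine (mu (cube 1)); have c0 : 0 < c by apply: fine_gt0; rewrite c_gt0 lebesgue_cube_lty.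
pose r := (2 / c * a) `^ N%:R^-1.
have ca0 : 0 < 2 / c * a by rewrite mulr_gt0// divr_gt0.
have r0 : 0 < r by rewrite powR_gt0.
have QS : (mu (cube r) = 2%:E * mu S)%E.
  rewrite lebesgue_cube// -(@fineK _ (mu (cube 1))) ?ge0_fin_numE ?lebesgue_cube_lty//.
  rewrite -(fineK Sfin) -!EFinM -/c -/a; congr EFin.
  rewrite -powR_mulrn ?powR_ge0// -powRrM mulVf ?pnatr_eq0 -?lt0n//.
  by rewrite powRr1 ?(ltW ca0)//; field; rewrite gt_eqF.
pose f x := layer l (u x).
have cf : continuous f by exact: continuous_layerf.
have bf : bounded_support f.
  by exists B => x /uB ux; rewrite /f ux layer_eq0// normr0; lra.
pose b := 2 ^+ N * (2 / l) ^+ 2 * r ^+ 2 * shell_energy u l.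
have b0 : 0 <= b by rewrite mulr_ge0// mulr_ge0 ?sqr_ge0// mulr_ge0 ?sqr_ge0 ?exprn_ge0.
have fA x : A x -> f x = 1 by move=> Ax; rewrite /f layer_eq1// ltW.
have fS x : ~ S x -> f x = 0.
  move=> Sx; rewrite /f layer_eq0//; have : `|u x| <= l by rewrite leNgt; apply/negP.
  by lra.
have fb y : cube r y -> (\int[mu]_x ((f (x + y) - f x) ^+ 2)%:E <= b%:E)%E.
  move=> Qy; have If : mu.-integrable setT (EFin \o (fun x : LV => (f (x + y) - f x) ^+ 2)).
    by apply: eq_integrable (square_difference_integrable y 0 cf bf) => // x _; rewrite /= addr0.
  rewrite -(fineK (integrable_fin_num measurableT If)) lee_fin.
  exact: Rintegral_layer_translation.
have := measure_le_average cf mA mS (measurable_cube r) fA fS b0 Soo S_gt0 QS fb.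
have Afin : mu A \is a fin_num.
  by rewrite ge0_fin_numE// (le_lt_trans _ Soo)//; exact: le_lebesgue.
rewrite -(fineK Afin) lee_fin => Ab.
apply: (@le_trans _ _ (l ^+ 2 * (2 * b))); first by rewrite ler_pM2l// exprn_gt0.
have -> : r ^+ 2 = (2 / c) `^ (2 / N%:R) * a `^ (2 / N%:R) -> l ^+ 2 * (2 * b) =
   2 ^+ (N + 3) * (2 / c) `^ (2 / N%:R) * a `^ (2 / N%:R) * shell_energy u l.
  by rewrite /b => ->; rewrite exprD expr_div_n; field; rewrite gt_eqF.
- by [].
rewrite -powRM ?(ltW a0) ?divr_ge0 ?(ltW c0)// -powR_mulrn ?powR_ge0// /r -powRrM.
by rewrite [N%:R^-1 * 2]mulrC.
Qed.
End level_estimate.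

(** * Estimates summed over dyadic levels *)

Section level_sums.
Context (R : realType).

(** Half of each term is absorbed by the sum itself, at the price of the last term, which
    tends to 0 when the sum is prolonged. *)
Lemma sum_le_absorb (x G : nat -> R) (b : R) :
  (forall j, 0 <= x j) -> (forall j, x j <= x j.+1 / 2 + G j) ->
  x @ \oo --> (0 : R) -> (forall J, \sum_(j < J) G j <= b) ->
  forall J, \sum_(j < J) x j <= 2 * b.
Proof.
move=> x0 xG xcvg Gb J.
have S_le K : \sum_(j < K) x j <= 2 * \sum_(j < K) G j + x K.
  elim: K => [|K IH]; first by rewrite !big_ord0 mulr0 add0r.
  by rewrite !big_ord_recr/=; have := xG K; lra.
have le k : \sum_(j < J) x j <= 2 * b + x (k + J)%N.
  apply: (@le_trans _ _ (\sum_(j < k + J) x j)).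
    elim: k => [|k IH]; first by rewrite add0n.
    by rewrite addSn big_ord_recr/= (le_trans IH)// lerDl.
  by have := S_le (k + J)%N; have := Gb (k + J)%N; lra.
apply: (cvg_lower_bound (a := fun k => 2 * b + x (k + J)%N)) => //.
rewrite -[X in _ --> X]addr0; apply: cvgD; first exact: cvg_cst.
by rewrite (cvg_shiftn J x (nbhs 0)).
Qed.

(** The tangent inequality of the concave power [1 - d], by Young's inequality. *)
Lemma powR_concave_step (a b f d : R) : 0 <= b -> b <= f -> f <= a -> 0 < d -> d < 1 ->
  (1 - d) * (a `^ (- d) * (f - b)) <= f `^ (1 - d) - b `^ (1 - d).
Proof.
move=> b0 bf fa d0 d1; have [f0|f0] := eqVneq f 0.
  have b_0 : b = 0 by lra.
  by rewrite f0 b_0 !subrr !mulr0.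
have fgt0 : 0 < f by rewrite lt0r f0 (le_trans b0).
have d1' : 0 < 1 - d by rewrite subr_gt0.
have af : a `^ (- d) <= f `^ (- d).
  rewrite !powRN lef_pV2 ?posrE ?powR_gt0 ?(lt_le_trans fgt0)//.
  by rewrite ge0_ler_powR// ?nnegrE ?(ltW d0) ?(ltW fgt0)// ltW// (lt_le_trans fgt0).
apply: (@le_trans _ _ ((1 - d) * (f `^ (- d) * (f - b)))).
  by rewrite ler_pM2l// ler_wpM2r ?subr_ge0.
have fE : f `^ (- d) * f = f `^ (1 - d).
  by rewrite powRD ?powRr1 ?(ltW fgt0)// ?(gt_eqF fgt0) ?implybT// mulrC.
rewrite [f `^ _ * (f - b)]mulrBr fE.
pose A := b `^ (1 - d) * f `^ (- d * (1 - d)); pose B := f `^ (d * (1 - d)).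
have AB : A * B = b `^ (1 - d).
  by rewrite /A /B -mulrA -powRD ?(gt_eqF fgt0) ?implybT// mulNr addNr powRr0 mulr1.
have Ap : A `^ (1 - d)^-1 = b * f `^ (- d).
  by rewrite powRM ?powR_ge0// -!powRrM -mulrA mulfV ?gt_eqF// mulr1 powRr1.
have Bq : B `^ d^-1 = f `^ (1 - d).
  by rewrite -powRrM mulrAC mulfV ?gt_eqF// mul1r.
have := @conjugate_powR R A B (1 - d)^-1 d^-1 (mulr_ge0 (powR_ge0 _ _) (powR_ge0 _ _)) (powR_ge0 _ _).
rewrite !invr_gt0 !invrK => /(_ d1' d0 (subrK _ _)); rewrite AB Ap Bq.
by move: (f `^ (1 - d)) (b `^ (1 - d)) (f `^ (- d)) => x y z; nra.
Qed.
End level_sums.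

Section weighted_estimate.
Context (R : realType) (N : nat).
Local Notation V := 'rV[R]_N.
Local Notation LV := (lebesgue_rVType R N).
Local Notation mu := (@lebesgue_rV R N).
Local Notation J f := (Rintegral mu setT (f : LV -> R)).
Implicit Types (u f : V -> R) (i : 'I_N) (l M : R).
Local Opaque partial.

Definition dist_fun u l : R := fine (mu [set x | l < `|u x|]%R).

(** The levels descend from [M], a bound of the function. *)
Definition dyadic (M : R) (j : nat) : R := M / 2 ^+ j.

Definition level_const : R := 2 ^+ (N + 3) * (2 / fine (mu (cube 1))) `^ (2 / N%:R).

Lemma dyadic_gt0 M j : 0 < M -> 0 < dyadic M j.
Proof. by move=> M0; rewrite divr_gt0// exprn_gt0. Qed.

Lemma dyadicS M j : dyadic M j = 2 * dyadic M j.+1.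
Proof. by rewrite /dyadic exprS; field; rewrite expf_neq0. Qed.

Lemma dist_fun_ge0 u l : 0 <= dist_fun u l.
Proof. exact: fine_ge0. Qed.

Lemma measurable_superlevel u l : continuous u -> measurable ([set x | l < `|u x|] : set LV).
Proof.
move=> cu; have := measurable_norm_itv `]l, +oo[ cu; congr (measurable _).
by apply/seteqP; split => x; rewrite /= in_itv/= andbT.
Qed.

Lemma superlevel_fin u l : continuous u -> bounded_support u -> 0 < l ->
  mu [set x | (l < `|u x|)%R] \is a fin_num.
Proof.
move=> cu [B uB] l0; rewrite ge0_fin_numE//.
apply: le_lt_trans (lebesgue_normball_lty N B); apply: le_lebesgue => x Sx /=.
by rewrite leNgt; apply/negP => /uB ux; move: Sx; rewrite /= ux normr0; lra.
Qed.

Lemma le_dist_fun u l l' : continuous u -> bounded_support u -> 0 < l -> l <= l' ->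
  dist_fun u l' <= dist_fun u l.
Proof.
move=> cu bu l0 ll'; apply: fine_le; rewrite ?superlevel_fin// ?(lt_le_trans l0)//.
by apply: le_lebesgue => x /=; apply: le_lt_trans.
Qed.

Lemma dist_fun_bounded u : bounded_support u ->
  exists m, forall l, 0 < l -> dist_fun u l <= m.
Proof.
move=> [B uB]; exists (fine (mu [set x : V | (`|x| <= B)%R])) => l l0.
have sub : [set x | l < `|u x|] `<=` [set x | `|x| <= B].
  by move=> x ux; rewrite /= leNgt; apply/negP => /uB; move: ux => /= + u0; rewrite u0 normr0; lra.
apply: fine_le; last exact: le_lebesgue.
- by rewrite ge0_fin_numE// (le_lt_trans (le_lebesgue sub))// lebesgue_normball_lty.
- by rewrite ge0_fin_numE// lebesgue_normball_lty.
Qed.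

Lemma dyadic_cvg0 M : dyadic M @ \oo --> (0 : R).
Proof.
have : geometric M 2^-1 @ \oo --> (0 : R).
  by apply: cvg_geometric; rewrite ger0_norm ?invr_ge0// invf_lt1// ltr1n.
by rewrite /geometric /=; under eq_fun do rewrite exprVn.
Qed.

(** A level at which the distribution function grows by a bounded factor is controlled by
    [level_set_estimate]; at the other levels the term is at most half of the next one. *)
Lemma level_sum_estimate (theta eta b M : R) u :
  (0 < N)%N -> 0 < theta -> eta = 2 / N%:R + theta - 1 -> C1c u ->
  0 < M ->
  (forall n, \sum_(j < n) dist_fun u (dyadic M j.+1) `^ eta * shell_energy u (dyadic M j.+1) <= b) ->
  forall n, \sum_(j < n) dyadic M j ^+ 2 * dist_fun u (dyadic M j) `^ theta <=
    2 * (4 * level_const * 8 `^ theta^-1 * b).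
Proof.
move=> N0 th0 etaE uC M0 bE; have [cu bu _ _] := uC.
set C := 4 * level_const * 8 `^ theta^-1.
have lc0 : 0 <= level_const by rewrite mulr_ge0 ?exprn_ge0 ?powR_ge0.
have C0 : 0 <= C by rewrite mulr_ge0 ?powR_ge0// mulr_ge0.
pose a j := dist_fun u (dyadic M j).
have aS j : a j <= a j.+1.
  apply: le_dist_fun => //; first exact: dyadic_gt0.
  by rewrite (dyadicS M j); have := dyadic_gt0 j.+1 M0; lra.
apply: (@sum_le_absorb R (fun j => dyadic M j ^+ 2 * a j `^ theta)
  (fun j => C * (a j.+1 `^ eta * shell_energy u (dyadic M j.+1))) (C * b)).
- by move=> j; rewrite mulr_ge0 ?sqr_ge0 ?powR_ge0.
- move=> j; rewrite -/(a j) -/(a j.+1).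
  set l := dyadic M j.+1; have l0 : 0 < l by exact: dyadic_gt0.
  have E0 := shell_energy_ge0 u l.
  rewrite (dyadicS M j) -/l exprMn.
  (* Halving the level loses a factor 4 in its square, so a growth of the power [theta] of
     the distribution function by 8 leaves a factor 2 for [sum_le_absorb]. *)
  have [bad|good] := leP (8 `^ theta^-1 * a j) (a j.+1).
    have : (8 `^ theta^-1 * a j) `^ theta <= a j.+1 `^ theta.
      by rewrite ge0_ler_powR ?nnegrE ?mulr_ge0 ?powR_ge0 ?dist_fun_ge0 ?(ltW th0).
    rewrite powRM ?powR_ge0 ?dist_fun_ge0// -powRrM mulVf ?gt_eqF// powRr1// => le8.
    have R0 : 0 <= C * (a j.+1 `^ eta * shell_energy u l).
      by rewrite mulr_ge0// mulr_ge0// powR_ge0.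
    rewrite -[leLHS]addr0; apply: lerD => //.
    rewrite [leRHS](_ : _ = l ^+ 2 * (a j.+1 `^ theta / 2)); last by ring.
    rewrite mulrAC [leLHS]mulrC ler_pM2l ?exprn_gt0//.
    by move: le8; move: (a j `^ theta) (a j.+1 `^ theta) => p q; lra.
  have aj0 : 0 < a j.
    have := le_lt_trans (aS j) good; rewrite ltNge => /negP H.
    rewrite lt0r dist_fun_ge0 andbT; apply/negP => /eqP aj; apply: H.
    by rewrite aj mulr0.
  have ajS0 := lt_le_trans aj0 (aS j).
  have est : l ^+ 2 * a j <= level_const * a j.+1 `^ (2 / N%:R) * shell_energy u l.
    by have := level_set_estimate N0 l0 uC; rewrite -[2 * l]dyadicS.
  have etaD : a j.+1 `^ eta = a j.+1 `^ (2 / N%:R) * a j.+1 `^ (theta - 1).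
    by rewrite etaE -addrA [LHS]powRD// implybE (gt_eqF ajS0) orbT.
  have thE : a j.+1 `^ theta = a j.+1 * a j.+1 `^ (theta - 1).
    by rewrite mulr_powRB1 ?ltW.
  have p0 : 0 < a j.+1 `^ (theta - 1) by rewrite powR_gt0.
  apply: (@le_trans _ _ (C * (a j.+1 `^ eta * shell_energy u l))); last first.
    by rewrite lerDr divr_ge0// mulr_ge0 ?sqr_ge0 ?powR_ge0.
  apply: (@le_trans _ _ (2 ^+ 2 * l ^+ 2 * a j.+1 `^ theta)).
    rewrite ler_wpM2l//; first by rewrite mulr_ge0 ?sqr_ge0.
    by rewrite ge0_ler_powR ?nnegrE ?(ltW th0) ?dist_fun_ge0.
  rewrite thE etaD /C; have D0 : 0 < 8 `^ theta^-1 :> R by rewrite powR_gt0.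
  apply: (@le_trans _ _ (4 * 8 `^ theta^-1 * a j.+1 `^ (theta - 1) * (l ^+ 2 * a j))).
    rewrite [leRHS](_ : _ = 2 ^+ 2 * l ^+ 2 * ((8 `^ theta^-1 * a j) * a j.+1 `^ (theta - 1))); last by ring.
    by rewrite ler_pM2l ?mulr_gt0 ?exprn_gt0// ler_pM2r// ltW.
  rewrite [leRHS](_ : _ = 4 * 8 `^ theta^-1 * a j.+1 `^ (theta - 1) *
    (level_const * a j.+1 `^ (2 / N%:R) * shell_energy u l)); last by ring.
  by rewrite ler_pM2l// mulr_gt0// mulr_gt0.
- have [m um] := dist_fun_bounded bu.
  have m0 : 0 <= m by apply: le_trans (um 1 ltr01); exact: dist_fun_ge0.
  apply: (@squeeze_cvgr _ _ _ _ (cst 0) (fun j => dyadic M j * dyadic M j * m `^ theta)).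
  + apply: nearW => j; rewrite mulr_ge0 ?sqr_ge0 ?powR_ge0//= expr2 ler_wpM2l//.
      by rewrite -expr2 sqr_ge0.
    by rewrite ge0_ler_powR ?nnegrE ?(ltW th0) ?dist_fun_ge0// um// dyadic_gt0.
  + exact: cvg_cst.
  + have -> : 0 = 0 * 0 * m `^ theta :> R by rewrite !mul0r.
    by apply: cvgMr_tmp; apply: cvgM; exact: dyadic_cvg0.
- by move=> n; rewrite -mulr_sumr ler_wpM2l.
Qed.

Lemma superlevelS u M n : 0 < M ->
  [set x | dyadic M n.+1 < `|u x|] = [set x | dyadic M n < `|u x|] `|` shell u (dyadic M n.+1).
Proof.
move=> M0; apply/seteqP; split => y; rewrite /shell /= (dyadicS M n).
  by move=> ly; have [?|?] := ltP (2 * dyadic M n.+1) `|u y|; [left|right; rewrite ly].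
by have := dyadic_gt0 n.+1 M0 => ? [|/andP[//]]; lra.
Qed.

Lemma superlevel_shell_disjoint u M n :
  [set x | dyadic M n < `|u x|] `&` shell u (dyadic M n.+1) = set0.
Proof.
apply/seteqP; split => // y [] /=; rewrite /shell /= (dyadicS M n).
by rewrite ltNge => /negP ? /andP[].
Qed.

(** On a shell [u ^ 2] is comparable to the square of the level, so the hypothesis on [W] turns
    the integral into the sum that [level_sum_estimate] bounds. *)
Lemma weighted_estimate (theta eta K b M : R) (W : V -> \bar R) u :
  (0 < N)%N -> 0 < theta -> eta = 2 / N%:R + theta - 1 -> C1c u ->
  0 < M -> (forall x, `|u x| <= M) -> 0 <= K ->
  measurable_fun setT (W : LV -> \bar R) -> (forall x, 0 <= W x)%E ->
  (forall F : set V, measurable (F : set LV) -> mu F < +oo ->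
    \int[mu]_(x in F) W x <= (K * fine (mu F) `^ theta)%:E)%E ->
  (forall n, \sum_(j < n) dist_fun u (dyadic M j.+1) `^ eta * shell_energy u (dyadic M j.+1) <= b) ->
  (\int[mu]_x (W x * (u x ^+ 2)%:E) <= (32 * level_const * 8 `^ theta^-1 * K * b)%:E)%E.
Proof.
move=> N0 th0 etaE uC M0 uM K0 mW W0 WK bE; have [cu bu _ _] := uC.
pose x j := dyadic M j ^+ 2 * dist_fun u (dyadic M j) `^ theta.
have x0 j : 0 <= x j by rewrite mulr_ge0 ?sqr_ge0 ?powR_ge0.
have Sx := level_sum_estimate N0 th0 etaE uC M0 bE.
pose L n : set V := [set x | dyadic M n < `|u x|].
have mL n : measurable (L n : set LV) by exact: measurable_superlevel.
pose f x : \bar R := (W x * (u x ^+ 2)%:E)%E.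
have f0 y : (0 <= f y)%E by rewrite mule_ge0// lee_fin sqr_ge0.
have mu_u : measurable_fun setT (u : LV -> R) by exact: continuous_lebesgue_measurable.
have mf : measurable_fun setT (f : LV -> \bar R).
  have mu2 : measurable_fun setT (fun x : LV => (u x ^+ 2)%:E).
    exact/measurable_EFinP/measurable_funX.
  exact: (emeasurable_funM mW mu2).
have mshell n := measurable_shell (dyadic M n) cu.
have step n : (\int[mu]_(y in shell u (dyadic M n.+1)) f y <= (4 * K * x n.+1)%:E)%E.
  set l := dyadic M n.+1; have l0 : 0 < l by exact: dyadic_gt0.
  have sub : shell u l `<=` [set y | l < `|u y|] by move=> y /andP[].
  have Sfin := superlevel_fin cu bu l0.
  have shell_lty : (mu (shell u l) < +oo)%E.
    by rewrite (le_lt_trans (le_lebesgue sub))// -ge0_fin_numE.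
  have mWs : measurable_fun (shell u l : set LV) W by exact: measurable_funS mW.
  apply: (@le_trans _ _ (\int[mu]_(y in shell u l) (((2 * l) ^+ 2)%:E * W y))%E).
    apply: (@ge0_le_integral _ LV R mu _ (mshell n.+1)).
    - by move=> y _; exact: f0.
    - exact: measurable_funS mf.
    - exact: (emeasurable_funM (measurable_cst _) mWs).
    move=> y /andP[_ uy]; rewrite muleC lee_wpmul2l// lee_fin.
    rewrite -[leLHS]real_normK ?num_real// ler_pXn2r// nnegrE mulr_ge0//.
    exact: ltW.
  rewrite (ge0_integralZl mu (mshell n.+1) mWs (fun y _ => W0 y)) ?lee_fin ?sqr_ge0//.
  apply: (@le_trans _ _ (((2 * l) ^+ 2)%:E * (K * fine (mu (shell u l)) `^ theta)%:E)%E).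
    by rewrite lee_wpmul2l ?lee_fin ?sqr_ge0//; exact: WK.
  rewrite -EFinM lee_fin /x -/l.
  rewrite [leLHS](_ : _ = 4 * K * (l ^+ 2 * fine (mu (shell u l)) `^ theta)); last by ring.
  apply: ler_wpM2l; first exact: mulr_ge0 (ler0n _ 4) K0.
  apply: ler_wpM2l; first exact: sqr_ge0.
  rewrite ge0_ler_powR ?nnegrE ?(ltW th0) ?fine_ge0//.
  by apply: fine_le => //; [rewrite ge0_fin_numE|exact: le_lebesgue].
have LS n : L n.+1 = L n `|` shell u (dyadic M n.+1) by exact: superlevelS.
have L_le n : (\int[mu]_(y in L n) f y <= (4 * K * \sum_(j < n) x j.+1)%:E)%E.
  elim: n => [|n IH].
    rewrite (_ : L 0 = set0) ?integral_set0 ?big_ord0 ?mulr0//.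
    apply/seteqP; split => // y; rewrite /L /dyadic /= expr0 divr1.
    by have := uM y; rewrite leNgt => /negP.
  rewrite LS ge0_integral_setU//; last 2 first.
  - exact: measurable_funS mf.
  - by apply/eqP; exact: superlevel_shell_disjoint.
  by rewrite big_ord_recr /= mulrDr EFinD; exact: leeD.
have L_le' n : (\int[mu]_(y in L n) f y <= (32 * level_const * 8 `^ theta^-1 * K * b)%:E)%E.
  apply: le_trans (L_le n) _; rewrite lee_fin.
  have := Sx n.+1; rewrite big_ord_recl/= => Sn.
  have : 4 * K * \sum_(j < n) x j.+1 <= 4 * K * (2 * (4 * level_const * 8 `^ theta^-1 * b)).
    apply: ler_wpM2l; first exact: mulr_ge0 (ler0n _ 4) K0.
    by apply: le_trans Sn; rewrite lerDr; exact: x0.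
  by move=> /le_trans; apply; rewrite le_eqVlt; apply/orP; left; apply/eqP; ring.
have homoL : {homo L : n m / (n <= m)%N >-> (n <= m)%O}.
  apply/nondecreasing_seqP => n; apply/subsetPset; rewrite LS; exact: subsetUl.
have Lcvg := @ge0_nondecreasing_set_cvg_integral _ LV R L f mu homoL mL
  (fun n => measurable_funS measurableT (@subsetT _ _) mf) (fun n y _ => f0 y).
have -> : (\int[mu]_y f y = \int[mu]_(y in \bigcup_n L n) f y)%E.
  rewrite [RHS]integral_mkcond; apply: eq_integral => y _; rewrite patchE; case: ifPn => //.
  rewrite notin_setE => Ly; suff uy : u y = 0 by rewrite /f uy expr0n mule0.
  apply/eqP; apply: contra_notT Ly; rewrite -normr_gt0 => uy0.
  have [n _ nP] := cvgr_lt _ (dyadic_cvg0 M) _ uy0.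
  by exists n => //; rewrite /L /=; apply: nP => /=.
rewrite -(cvg_lim _ Lcvg)//; apply: lime_le; first exact: cvgP Lcvg.
by apply: nearW => n; exact: L_le'.
Qed.
End weighted_estimate.

(** * A Rellich inequality with potential *)

Section rellich_sobolev.
Context (R : realType) (N : nat).
Local Notation V := 'rV[R]_N.
Local Notation LV := (lebesgue_rVType R N).
Local Notation mu := (@lebesgue_rV R N).
Local Notation J f := (Rintegral mu setT (f : LV -> R)).
Implicit Types (u v : V -> R) (i : 'I_N) (c : nat -> R) (M : R).
Local Opaque partial.

Definition step_fun c u M n (x : V) : R :=
  \sum_(j < n) c j * \1_(shell u (dyadic M j.+1)) x.

Lemma step_funS c u M n x :
  step_fun c u M n.+1 x = step_fun c u M n x + c n * \1_(shell u (dyadic M n.+1)) x.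
Proof. by rewrite /step_fun big_ord_recr. Qed.

Lemma step_fun_ge0 c u M n x : (forall j, 0 <= c j) -> 0 <= step_fun c u M n x.
Proof. by move=> c0; apply: sumr_ge0 => j _; rewrite mulr_ge0. Qed.

Lemma measurable_step_fun c u M n : continuous u ->
  measurable_fun setT (step_fun c u M n : LV -> R).
Proof.
move=> cu; elim: n => [|n IH].
  by rewrite (_ : step_fun _ _ _ _ = cst 0)//; apply/funext => x; rewrite /step_fun big_ord0.
rewrite (funext (step_funS c u M n)).
have m1 := measurable_funM (measurable_cst (c n)) (measurable_indic (R := R) (measurable_shell (dyadic M n.+1) cu)).
by apply: (measurable_funD IH); exact: m1.
Qed.

Lemma step_fun1_le1 u M n x : 0 < M -> step_fun (fun=> 1) u M n x <= 1.
Proof.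
move=> M0; apply: (@le_trans _ _ (\1_[set x | dyadic M n < `|u x|] x : R)); last first.
  by rewrite indicE lern1 leq_b1.
elim: n => [|n IH]; first by rewrite /step_fun big_ord0.
rewrite step_funS mul1r superlevelS//; apply: le_trans (lerD IH (lexx _)) _.
rewrite !indicE in_setU.
have D : ~~ ((x \in [set y | dyadic M n < `|u y|]) && (x \in shell u (dyadic M n.+1))).
  apply/negP => /andP[/set_mem xL /set_mem xE].
  by suff : set0 x by []; rewrite -(superlevel_shell_disjoint u M n).
by move: D; do 2![case: (x \in _)] => //= _; rewrite ?addr0 ?add0r.
Qed.

(** The part of [F] above a level is at most as large as the superlevel set, whose measure
    enters the potential; the tangent inequality of the concave power [1 - d] then makes
    the sum over the shells telescope. *)
Lemma integral_step_potential u M n (d : R) (F : set V) :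
  continuous u -> bounded_support u -> 0 < M -> (forall x, `|u x| <= M) ->
  0 < d -> d < 1 -> measurable (F : set LV) -> (mu F < +oo)%E ->
  (\int[mu]_(x in F) (step_fun (fun j => dist_fun u (dyadic M j.+1) `^ (- d)) u M n x)%:E <=
   ((1 - d)^-1 * fine (mu F) `^ (1 - d))%:E)%E.
Proof.
move=> cu bu M0 uM d0 d1 mF Foo.
pose c j := dist_fun u (dyadic M j.+1) `^ (- d).
have c0 j : 0 <= c j by exact: powR_ge0.
pose f k := fine (mu (F `&` [set x | (dyadic M k < `|u x|)%R])).
have d1' : 0 < 1 - d by rewrite subr_gt0.
suff H : (\int[mu]_(x in F) (step_fun c u M n x)%:E <= ((1 - d)^-1 * f n `^ (1 - d))%:E)%E.
  apply: le_trans H _; rewrite lee_fin ler_pM2l ?invr_gt0//.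
  rewrite ge0_ler_powR ?nnegrE ?fine_ge0 ?(ltW d1')//; apply: fine_le.
  - by rewrite ge0_fin_numE// (le_lt_trans (le_lebesgue (@subIsetl _ _ _))).
  - by rewrite ge0_fin_numE.
  - exact: le_lebesgue (@subIsetl _ _ _).
elim: n => [|n IH].
  rewrite integral0_eq => [|x _]; last by rewrite /step_fun big_ord0.
  by rewrite lee_fin mulr_ge0 ?invr_ge0 ?(ltW d1')// powR_ge0.
set E := shell u (dyadic M n.+1).
have mE : measurable (E : set LV) by exact: measurable_shell.
have mL : measurable ([set x | dyadic M n < `|u x|] : set LV) by exact: measurable_superlevel.
have fin_sub (A : set V) : A `<=` F -> mu A \is a fin_num.
  by move=> AF; rewrite ge0_fin_numE// (le_lt_trans (le_lebesgue AF)).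
have EF : fine (mu (E `&` F)) = f n.+1 - f n.
  apply/eqP; rewrite eq_sym subr_eq /f superlevelS// setIUr addrC setIC [F `&` shell _ _]setIC.
  rewrite measureU ?fineD//; first exact: fin_sub.
  - exact: fin_sub.
  - exact: measurableI.
  - exact: measurableI.
  by rewrite setIACA superlevel_shell_disjoint set0I.
have -> : (\int[mu]_(x in F) (step_fun c u M n.+1 x)%:E =
    \int[mu]_(x in F) (step_fun c u M n x)%:E + (c n * (f n.+1 - f n))%:E)%E.
  have -> : (fun x : LV => (step_fun c u M n.+1 x)%:E) =
      (fun x : LV => (step_fun c u M n x)%:E + (c n)%:E * (\1_E x)%:E)%E.
    by apply/funext => x; rewrite step_funS EFinD EFinM.
  have m1 : measurable_fun (F : set LV) (fun x : LV => (step_fun c u M n x)%:E).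
    have mS : measurable_fun setT (EFin \o (step_fun c u M n : LV -> R)).
      exact/measurable_EFinP/measurable_step_fun.
    exact: measurable_funS mS.
  have m2 : measurable_fun (F : set LV) (fun x : LV => (\1_E x : R)%:E).
    exact/measurable_EFinP/measurable_indic.
  have c0n : (0 <= (c n)%:E)%E by rewrite lee_fin.
  have m3 := emeasurable_funM (measurable_cst (c n)%:E) m2.
  rewrite (ge0_integralD mu mF _ m1 _ m3); last 2 first.
  - by move=> x _; rewrite lee_fin; exact: step_fun_ge0.
  - by move=> x _; rewrite mule_ge0 ?lee_fin.
  congr (_ + _)%E; rewrite (ge0_integralZl mu mF m2 _ c0n); last by move=> x _; rewrite lee_fin.
  by rewrite integral_indic// -EF EFinM fineK//; apply: fin_sub; exact: subIsetr.
apply: le_trans (leeD IH (lexx _)) _; rewrite -EFinD lee_fin.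
have f_ge0 k : 0 <= f k by exact: fine_ge0.
have fle : f n <= f n.+1 by rewrite -subr_ge0 -EF; exact: fine_ge0.
have fa : f n.+1 <= dist_fun u (dyadic M n.+1).
  apply: fine_le; last exact: le_lebesgue (@subIsetr _ _ _).
    by apply: fin_sub; exact: subIsetl.
  by apply: superlevel_fin => //; exact: dyadic_gt0.
have := powR_concave_step (f_ge0 n) fle fa d0 d1; rewrite -/(c n) => step.
rewrite -(ler_pM2l d1') mulrDr !mulVKf ?(gt_eqF d1')//.
by rewrite -lerBrDl.
Qed.

Lemma Rintegral_step_fun c u M n h : continuous u -> continuous h -> bounded_support h ->
  mu.-integrable setT (EFin \o (fun x : LV => step_fun c u M n x * h x ^+ 2)) /\
  J (fun x => step_fun c u M n x * h x ^+ 2) =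
  \sum_(j < n) c j * \int[mu]_(x in shell u (dyadic M j.+1)) (h x ^+ 2).
Proof.
move=> cu ch bh.
have Ih : mu.-integrable setT (EFin \o (fun x : LV => h x ^+ 2)).
  exact: (continuous_integrableM ch ch bh).
pose E j := shell u (dyadic M j.+1).
have mE j : measurable (E j : set LV) by exact: measurable_shell.
have patchE' j : (fun x : LV => \1_(E j) x * h x ^+ 2) = (fun x : LV => h x ^+ 2) \_ (E j).
  by apply/funext => x; rewrite patchE indicE; case: ifP; rewrite ?mul1r ?mul0r.
have I1 j : mu.-integrable setT (EFin \o (fun x : LV => \1_(E j) x * h x ^+ 2)).
  have IE : mu.-integrable (E j : set LV) (EFin \o (fun x : LV => h x ^+ 2)).
    exact: integrableS Ih.
  apply: eq_integrable ((integrable_mkcond _ (mE j)).1 IE) => // x _.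
  by rewrite patchE' /= !patchE; case: ifP.
have Ic (j : 'I_n) : mu.-integrable setT (EFin \o (fun x : LV => c j * (\1_(E j) x * h x ^+ 2))).
  exact: eq_integrable (integrableZl measurableT (c j) (I1 j)).
have [Is Es] := Rintegral_sum (index_enum 'I_n) Ic.
have sE : (fun x : LV => step_fun c u M n x * h x ^+ 2) =
    (fun x : LV => \sum_(j < n) c j * (\1_(E j) x * h x ^+ 2)).
  by apply/funext => x; rewrite /step_fun mulr_suml; apply: eq_bigr => j _; rewrite -mulrA.
rewrite sE; split => //; rewrite Es; apply: eq_bigr => j _.
by rewrite RintegralZl// patchE' -Rintegral_mkcond.
Qed.

Definition rellich_const : R :=
  let d := 2 / N%:R in
  32 * level_const R N * 8 `^ (1 - 2 * d)^-1 *
  (32 * level_const R N * 8 `^ (1 - d)^-1 * (1 - d)^-1).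

(** [weighted_estimate] is applied twice. Applied to [phi] it leaves the squares of the first
    derivatives with a weight that is a power of the distribution function of [phi]; on
    each shell this weight is constant, so it is a step potential. Applied to the derivatives with
    this potential it leaves the Hessian without weight. *)
Lemma weighted_rellich (K : R) (W : V -> \bar R) (phi : V -> R) :
  (5 <= N)%N -> C1c phi -> (forall i, C1c (partial i phi)) ->
  (forall i j, C1c (partial i (partial j phi))) -> 0 <= K ->
  measurable_fun setT (W : LV -> \bar R) -> (forall x, 0 <= W x)%E ->
  (forall F : set V, measurable (F : set LV) -> mu F < +oo ->
    \int[mu]_(x in F) W x <= (K * fine (mu F) `^ (1 - 4 / N%:R))%:E)%E ->
  (\int[mu]_x (W x * (phi x ^+ 2)%:E) <=
    (rellich_const * K * J (fun x => laplacian phi x ^+ 2))%:E)%E.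
Proof.
move=> N5 C0 C1 C2 K0 mW W0 WF.
have N0 : (0 < N)%N by apply: leq_trans N5.
set d : R := 2 / N%:R.
have dE : 4 / N%:R = 2 * d by rewrite /d; ring.
have NR : 5 <= N%:R :> R by rewrite (ler_nat _ 5).
have d0 : 0 < d by rewrite divr_gt0 ?ltr0n.
have d2 : 2 * d < 1 by rewrite -dE ltr_pdivrMr ?ltr0n// mul1r; lra.
have d1 : d < 1 by lra.
pose H i := \sum_k J (fun x => partial k (partial i phi) x ^+ 2).
(* For [theta = 1 - d] the exponent [eta] is 0, so the second derivatives carry no weight. *)
have first i n M u : continuous u -> bounded_support u -> 0 < M -> (forall x, `|u x| <= M) ->
    \sum_(j < n) dist_fun u (dyadic M j.+1) `^ (- d) *
      \int[mu]_(x in shell u (dyadic M j.+1)) (partial i phi x ^+ 2) <=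
    32 * level_const R N * 8 `^ (1 - d)^-1 * (1 - d)^-1 * H i.
  move=> cu bu Mu0 uM; have [cp bp cpp _] := C1 i.
  have [Is <-] := Rintegral_step_fun (fun j => dist_fun u (dyadic M j.+1) `^ (- d)) M n cu cp bp.
  rewrite -lee_fin (fineK (integrable_fin_num measurableT Is)).
  have [Mp [Mp0 pM]] := continuous_bounded_support_bounded cp bp.
  pose S x := step_fun (fun j => dist_fun u (dyadic M j.+1) `^ (- d)) u M n x.
  have th0 : 0 < 1 - d by rewrite subr_gt0.
  have eta0 : 0 = 2 / N%:R + (1 - d) - 1 by rewrite -/d; ring.
  have d1V : 0 <= (1 - d)^-1 by rewrite invr_ge0 ltW.
  have mS : measurable_fun setT (EFin \o S : LV -> \bar R).
    exact/measurable_EFinP/measurable_step_fun.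
  have S0 x : (0 <= (EFin \o S) x)%E.
    by rewrite lee_fin; apply: step_fun_ge0 => j; exact: powR_ge0.
  apply: (weighted_estimate N0 th0 eta0 (C1 i) Mp0 pM d1V mS S0).
    by move=> F mF Foo; exact: integral_step_potential.
  move=> m; under eq_bigr do rewrite powRr0 mul1r.
  rewrite exchange_big/=; apply: ler_sum => k _.
  have bk := bounded_support_partial k bp.
  have [Ik Ek] := Rintegral_step_fun (fun=> 1) Mp m cp (cpp k) bk.
  apply: (@le_trans _ _ (J (fun x => step_fun (fun=> 1) (partial i phi) Mp m x * partial k (partial i phi) x ^+ 2))).
    by rewrite Ek; apply: ler_sum => j _; rewrite mul1r.
  apply: (le_Rintegral measurableT Ik (continuous_integrableM (cpp k) (cpp k) bk)) => x _.
  by rewrite -expr2 ler_piMl ?sqr_ge0// step_fun1_le1.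
have [cphi bphi _ _] := C0.
have [M [M0 phiM]] := continuous_bounded_support_bounded cphi bphi.
have -> : J (fun x => laplacian phi x ^+ 2) = \sum_i H i.
  exact: etrans (esym (Rintegral_hessian C0 C1 C2)) (exchange_big _ _ _ _ _ _).
have th0 : 0 < 1 - 4 / N%:R :> R by rewrite dE subr_gt0.
have etaE : - d = 2 / N%:R + (1 - 4 / N%:R) - 1 by rewrite dE -/d; ring.
have bE n : \sum_(j < n) dist_fun phi (dyadic M j.+1) `^ (- d) * shell_energy phi (dyadic M j.+1) <=
    32 * level_const R N * 8 `^ (1 - d)^-1 * (1 - d)^-1 * \sum_i H i.
  under eq_bigr do rewrite mulr_sumr.
  by rewrite exchange_big mulr_sumr/=; apply: ler_sum => i _; exact: first.
have := weighted_estimate N0 th0 etaE C0 M0 phiM K0 mW W0 WF bE.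
move=> /le_trans; apply; rewrite lee_fin le_eqVlt; apply/orP; left; apply/eqP.
by rewrite /rellich_const -/d -dE; ring.
Qed.
End rellich_sobolev.

(** * Potentials of weak type *)

Section weak_type.
Context (R : realType) (N : nat).
Local Notation V := 'rV[R]_N.
Local Notation LV := (lebesgue_rVType R N).
Local Notation mu := (@lebesgue_rV R N).

Lemma mine_cvg (c : nat -> R) (w : \bar R) : c @ \oo --> +oo%R ->
  (-oo < w)%E -> mine w (c m)%:E @[m --> \oo] --> w.
Proof.
move=> coo; case: w => [r| |] // _.
  apply: cvg_near_cst; move/cvgryPge : coo => /(_ r); apply: filterS => m rm.
  by apply/min_idPl; rewrite lee_fin.
by under eq_fun do rewrite minye; exact/cvgeryP.
Qed.

Lemma mine_double (w : \bar R) (a : R) : 0 <= a ->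
  (mine w (2 * a)%:E <= mine w a%:E + (if (a%:E < w)%E then a else 0)%:E)%E.
Proof.
move=> a0; case: ltP => aw; last by rewrite adde0 ge_min lexx.
have -> : ((2 * a)%:E = a%:E + a%:E)%E by rewrite -EFinD; congr EFin; ring.
by rewrite ge_min lexx orbT.
Qed.

Lemma integral_le_limit (D : set V) (f : nat -> V -> \bar R) (W : V -> \bar R) (b : \bar R) :
  measurable (D : set LV) -> (forall m, measurable_fun (D : set LV) (f m : LV -> \bar R)) ->
  (forall m x, D x -> 0 <= f m x)%E ->
  (forall x, D x -> {homo f^~ x : m n / (m <= n)%N >-> (m <= n)%E}) ->
  (forall x, D x -> f m x @[m --> \oo] --> W x) ->
  (forall m, \int[mu]_(x in D) f m x <= b)%E ->
  (\int[mu]_(x in D) W x <= b)%E.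
Proof.
move=> mD mf f0 fnd fW fb.
have cvg_int := @cvg_monotone_convergence _ LV R mu D mD f mf f0 fnd.
rewrite (_ : (\int[mu]_(x in D) W x)%E = \int[mu]_(x in D) limn (f^~ x))%E; last first.
  by apply: eq_integral => x /set_mem Dx; apply/esym/cvg_lim => //; exact: fW.
rewrite -(cvg_lim _ cvg_int)//; apply: lime_le; first exact: cvgP cvg_int.
by apply: nearW => m; exact: fb.
Qed.

Lemma integral_le_trunc (D : set V) (W : V -> \bar R) (c : nat -> R) (b : \bar R) :
  measurable (D : set LV) -> measurable_fun (D : set LV) (W : LV -> \bar R) ->
  (forall x, 0 <= W x)%E -> {homo c : m n / (m <= n)%N >-> m <= n} -> (forall m, 0 <= c m) ->
  c @ \oo --> +oo%R ->
  (forall m, \int[mu]_(x in D) mine (W x) (c m)%:E <= b)%E ->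
  (\int[mu]_(x in D) W x <= b)%E.
Proof.
move=> mD mW W0 cnd c0 coo Hb.
apply: (@integral_le_limit D (fun m x => mine (W x) (c m)%:E) W b mD _ _ _ _ Hb).
- by move=> m; apply: measurable_mine; [exact: mW|exact: measurable_cst].
- by move=> m x _; rewrite le_min W0 lee_fin c0.
- by move=> x _ m n mn; rewrite le_min !ge_min lexx/= lee_fin cnd// orbT.
- by move=> x _; apply: mine_cvg => //; exact: lt_le_trans (W0 x).
Qed.

Lemma geometric_sum_le (q : R) n : 0 <= q -> q < 1 -> \sum_(k < n) q ^+ k <= (1 - q)^-1.
Proof.
move=> q0 q1; have q1' : 0 < 1 - q by rewrite subr_gt0.
rewrite -(ler_pM2l q1') mulfV ?gt_eqF//.
suff -> : (1 - q) * \sum_(k < n) q ^+ k = 1 - q ^+ n by rewrite gerBl exprn_ge0.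
by rewrite -opprB mulNr -subrX1 opprB.
Qed.

(** Truncation at the level [s] contributes [s * mu F], and each further doubling of the level
    adds a term of a geometric series with first term [A * s `^ (1 - p)]; the choice of [s]
    makes both contributions equal. *)
Lemma weak_type_integral (p A : R) (W : V -> \bar R) (F : set V) :
  1 < p -> 0 < A -> measurable_fun setT (W : LV -> \bar R) -> (forall x, 0 <= W x)%E ->
  (forall s : R, 0 < s -> (mu [set x | (s%:E < W x)%E] <= (A * s `^ (- p))%:E)%E) ->
  measurable (F : set LV) -> (mu F < +oo)%E ->
  (\int[mu]_(x in F) W x <=
    ((1 + (1 - 2 `^ (1 - p))^-1) * A `^ p^-1 * fine (mu F) `^ (1 - p^-1))%:E)%E.
Proof.
move=> p1 A0 mW W0 WA mF Foo.
have Ffin : mu F \is a fin_num by rewrite ge0_fin_numE.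
set q : R := 2 `^ (1 - p).
have p0 : 0 < p by apply: lt_trans p1.
have q0 : 0 < q by rewrite powR_gt0.
have q1 : q < 1.
  have one : 1 `^ (p - 1) = 1 :> R by rewrite powR1.
  rewrite /q -opprB powRN invf_lt1 ?powR_gt0// -[X in X < _]one.
  by rewrite gt0_ltr_powR ?nnegrE ?ltr1n// subr_gt0.
have q1' : 0 <= (1 - q)^-1 by rewrite invr_ge0; lra.
have mWF : measurable_fun (F : set LV) W by exact: measurable_funS mW.
have pow2oo (s : R) : 0 < s -> (fun m => 2 ^+ m * s) @ \oo --> +oo%R.
  move=> s0; apply/cvgryPge => r; exists (Num.truncn `|r / s|).+1 => // m /= rm.
  rewrite -ler_pdivrMr// (le_trans (ler_norm _))//.
  apply: le_trans (ltW (truncnS_gt _)) _; rewrite (le_trans (_ : _ <= m%:R))//; first by rewrite ler_nat.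
  by rewrite -natrX ler_nat ltnW// ltn_expl.
have pow2nd (s : R) : 0 < s -> {homo (fun m => 2 ^+ m * s) : m n / (m <= n)%N >-> m <= n}.
  by move=> s0 m n mn; rewrite ler_pM2r// ler_weXn2l// ler1n.
have pow2_ge0 (s : R) m : 0 < s -> 0 <= 2 ^+ m * s by move=> s0; rewrite mulr_ge0 ?exprn_ge0// ltW.
have mmin (c : R) : measurable_fun (F : set LV) (fun x : LV => mine (W x) c%:E).
  by apply: measurable_mine => //; exact: measurable_cst.
have min0 (c : R) x : 0 <= c -> (0 <= mine (W x) c%:E)%E by move=> c0; rewrite le_min W0 lee_fin.
have le_cst (s : R) : 0 < s -> (\int[mu]_(x in F) mine (W x) s%:E <= (s * fine (mu F))%:E)%E.
  move=> s0; rewrite EFinM fineK// -[leRHS](integral_cst mu mF s%:E).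
  apply: (@ge0_le_integral _ LV R mu F mF).
  - by move=> x _; rewrite min0// ltW.
  - exact: mmin.
  - exact: measurable_cst.
  - by move=> x _; rewrite ge_min lexx orbT.
set a := fine (mu F); have a_ge0 : 0 <= a by exact: fine_ge0.
have [a0|a0] := eqVneq a 0.
  have two0 : 0 < 2 :> R by [].
  apply: (integral_le_trunc mF mWF W0 (pow2nd _ ltr01) (fun m => pow2_ge0 1 m ltr01) (pow2oo _ ltr01)) => m.
  apply: le_trans (le_cst _ _) _; first by rewrite mulr_gt0 ?exprn_gt0.
  by rewrite -/a a0 mulr0 lee_fin !mulr_ge0 ?powR_ge0//; lra.
have agt0 : 0 < a by rewrite lt0r a0.
pose s : R := A `^ p^-1 * a `^ (- p^-1).
have s0 : 0 < s by rewrite mulr_gt0 ?powR_gt0.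
have powD (x y z : R) : 0 < x -> x `^ y * x `^ z = x `^ (y + z).
  by move=> x0; rewrite powRD// (gt_eqF x0) implybT.
have powD1 (x y : R) : 0 < x -> x `^ y * x = x `^ (y + 1).
  by move=> x0; rewrite -powD// powRr1 ?ltW.
have E1 : s * a = A `^ p^-1 * a `^ (1 - p^-1).
  by rewrite /s -mulrA powD1// addrC.
have E2 : A * s `^ (1 - p) = A `^ p^-1 * a `^ (1 - p^-1).
  rewrite /s powRM ?powR_ge0// -!powRrM mulrA [A * _]mulrC powD1//.
  by congr (_ `^ _ * _ `^ _); field; rewrite gt_eqF.
have step m : (\int[mu]_(x in F) mine (W x) (2 ^+ m * s)%:E <=
    (s * a + \sum_(k < m) A * s `^ (1 - p) * q ^+ k)%:E)%E.
  elim: m => [|m IH]; first by rewrite big_ord0 addr0 mul1r; exact: le_cst.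
  set c := 2 ^+ m * s; have c0 : 0 < c by rewrite mulr_gt0 ?exprn_gt0.
  pose L := [set x | (c%:E < W x)%E].
  have mL : measurable (L : set LV).
    by have := emeasurable_fun_o_infty measurableT mW c%:E; rewrite setTI.
  have m1 : measurable_fun (F : set LV) (fun x : LV => (\1_L x : R)%:E).
    exact/measurable_EFinP/measurable_indic.
  have m2 := emeasurable_funM (measurable_cst c%:E) m1.
  have c0E : (0 <= c%:E)%E by rewrite lee_fin ltW.
  have ind0 (x : LV) : F x -> (0 <= (\1_L x : R)%:E)%E by move=> _; rewrite lee_fin.
  have min_ge0 (x : LV) : F x -> (0 <= mine (W x) c%:E)%E by move=> _; rewrite min0// ltW.
  have cind0 (x : LV) : F x -> (0 <= c%:E * (\1_L x : R)%:E)%E by move=> _; rewrite mule_ge0// lee_fin.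
  apply: (@le_trans _ _ (\int[mu]_(x in F) (mine (W x) c%:E + c%:E * (\1_L x)%:E))%E).
    apply: (@ge0_le_integral _ LV R mu F mF).
    - by move=> x _; apply: min0; rewrite mulr_ge0 ?exprn_ge0// ltW.
    - exact: mmin.
    - exact: (emeasurable_funD (mmin c) m2).
    move=> x _; rewrite exprS -mulrA; apply: le_trans (mine_double _ (ltW c0)) _.
    apply: leeD => //; rewrite indicE; have [xL|xL] := boolP (x \in L).
      by rewrite mule1; case: ifP; rewrite // lee_fin ltW.
    by rewrite mule0; case: ifPn => // cW; move: xL; rewrite notin_setE.
  rewrite (ge0_integralD mu mF min_ge0 (mmin c) cind0 m2).
  rewrite (ge0_integralZl mu mF m1 ind0 c0E) (integral_indic mu mF mL).
  rewrite big_ord_recr/= addrA [leRHS]EFinD; apply: leeD => //.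
  apply: (@le_trans _ _ (c%:E * (A * c `^ (- p))%:E)%E).
    by apply: lee_wpmul2l => //; apply: le_trans (WA c c0); exact: le_lebesgue (@subIsetl _ _ _).
  rewrite -EFinM lee_fin le_eqVlt; apply/orP; left; apply/eqP.
  rewrite mulrCA -mulrA; congr (A * _); rewrite mulrC powD1// addrC.
  rewrite /c powRM ?exprn_ge0 ?(ltW s0)// mulrC; congr (_ * _).
  by rewrite -powR_mulrn// -powRrM mulrC powRrM powR_mulrn// powR_ge0.
apply: (integral_le_trunc mF mWF W0 (pow2nd _ s0) (fun m => pow2_ge0 s m s0) (pow2oo _ s0)) => m.
apply: le_trans (step m) _; rewrite lee_fin -mulr_sumr E1 E2 -[leRHS]mulrA mulrDl mul1r lerD2l.
rewrite [leLHS]mulrC ler_wpM2r ?mulr_ge0 ?powR_ge0//; apply: geometric_sum_le => //; exact: ltW.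
Qed.
End weak_type.

Section weak_Lp_distribution.
Context (R : realType) (N : nat).
Local Notation V := 'rV[R]_N.
Local Notation LV := (lebesgue_rVType R N).
Local Notation mu := (@lebesgue_rV R N).
Implicit Types (Omega : set V) (g : V -> \bar R).
Local Open Scope ereal_scope.

(** If the distribution function at [s] were larger than the bound, it would be at least some [t]
    larger than the bound at all levels up to [s], and the rearrangement at [t]
    would be at least [s]. *)
Lemma weak_Lp_distribution Omega (p : R) g : (0 < p)%R -> weak_Lp Omega p g ->
  exists2 A : R, (0 < A)%R &
    forall s : R, (0 < s)%R -> distribution_fun Omega g s <= (A * s `^ (- p))%:E.
Proof.
move=> p0 [_ _ supoo].
have [M M0 MP] : exists2 M : R, (0 < M)%R & forall t : R, (0 < t)%R ->
    (t `^ p^-1)%:E * decreasing_rearrangement Omega g t <= M%:E.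
  move: supoo; set S := ereal_sup _ => Soo.
  exists (Num.max 1 (fine S))%R; first by rewrite lt_max ltr01.
  move=> t t0; apply: (@le_trans _ _ S); first by apply: ereal_sup_ubound; exists t.
  move: Soo; case: S => [r| |] // _; last exact: leNye.
  by rewrite lee_fin le_max lexx orbT.
exists (M `^ p)%R; first by rewrite powR_gt0.
move=> s s0; rewrite leNgt; apply/negP => lt.
have [t t_gt t_le] : exists2 t : R, (M `^ p * s `^ (- p) < t)%R & t%:E <= distribution_fun Omega g s.
  move: lt; case: (distribution_fun Omega g s) => [r| |] // rlt; first by exists r => //; rewrite -lte_fin.
  by exists (M `^ p * s `^ (- p) + 1)%R; [rewrite ltrDl|rewrite leey].
have t0 : (0 < t)%R by apply: le_lt_trans t_gt; rewrite mulr_ge0 ?powR_ge0.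
have s_le : s%:E <= decreasing_rearrangement Omega g t.
  apply: le_ereal_inf_tmp => _ [s' [s'0 s't] <-]; rewrite lee_fin leNgt; apply/negP => s's.
  have : distribution_fun Omega g s <= distribution_fun Omega g s'.
    by apply: le_lebesgue => x [Ox gx]; split=> //; apply: le_lt_trans gx; rewrite lee_fin ltW.
  by move=> /(le_trans t_le) /le_lt_trans /(_ s't); rewrite ltxx.
have : (t `^ p^-1 * s)%:E <= M%:E.
  apply: le_trans (MP t t0); rewrite EFinM; apply: lee_wpmul2l => //.
  by rewrite lee_fin powR_ge0.
rewrite lee_fin -ler_pdivlMr// => tM.
have : ((t `^ p^-1) `^ p <= (M / s) `^ p)%R.
  by rewrite ge0_ler_powR ?nnegrE ?powR_ge0 ?(ltW p0)// divr_ge0 ?ltW.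
rewrite -powRrM mulVf ?gt_eqF// powRr1 ?(ltW t0)// powRM ?(ltW M0) ?invr_ge0 ?(ltW s0)//.
move=> /(lt_le_trans t_gt); rewrite -powR_inv1 ?(ltW s0)// -powRrM mulN1r.
by rewrite ltxx.
Qed.
End weak_Lp_distribution.

Section weak_Lp_potential.
Context (R : realType) (N : nat).
Local Notation V := 'rV[R]_N.
Local Notation LV := (lebesgue_rVType R N).
Local Notation mu := (@lebesgue_rV R N).

(** Extended by 0, [g] is of weak type on the whole space, and [weak_type_integral] gives
    the exponent [1 - 4 / N] for which [weighted_rellich] holds. *)
Lemma weak_Lp_test_inequality (Omega : set V) (g : V -> \bar R) :
  (5 <= N)%N -> open Omega -> lebesgue_measurable_fun Omega g ->
  (forall x, Omega x -> (0 <= g x)%E) -> weak_Lp Omega (N%:R / 4%:R) g ->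
  exists2 C : R, 0 < C & forall phi : V -> R, C1c phi -> (forall i, C1c (partial i phi)) ->
    (forall i j, C1c (partial i (partial j phi))) ->
    (\int[mu]_(x in Omega) (g x * (phi x ^+ 2)%:E) <=
      (C * Rintegral mu setT ((fun x => laplacian phi x ^+ 2) : LV -> R))%:E)%E.
Proof.
move=> N5 oO mg g0 wg.
have N0 : 0 < N%:R :> R by rewrite ltr0n (leq_trans _ N5).
have p0 : 0 < N%:R / 4%:R :> R by rewrite divr_gt0.
have p1 : 1 < N%:R / 4%:R :> R.
  by rewrite ltr_pdivlMr// mul1r ltr_nat (leq_trans _ N5).
have [A A0 AP] := weak_Lp_distribution p0 wg.
have mO : measurable (Omega : set LV) by exact: open_lebesgue_measurable.
pose W := g \_ Omega.
have W0 x : (0 <= W x)%E by rewrite /W patchE; case: ifPn => // /set_mem /g0.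
have mW : measurable_fun setT (W : LV -> \bar R) by exact/(measurable_restrictT _ mO).
have WA (s : R) : 0 < s -> (mu [set x | (s%:E < W x)%E] <= (A * s `^ (- (N%:R / 4%:R)))%:E)%E.
  move=> s0; apply: le_trans (AP s s0); apply: le_lebesgue => x /=.
  rewrite /W patchE; case: ifPn => [/set_mem Ox sg|_]; last by rewrite lte_fin ltNge (ltW s0).
  by split=> //; rewrite gee0_abs// g0.
pose K := (1 + (1 - 2 `^ (1 - N%:R / 4%:R))^-1) * A `^ (N%:R / 4%:R)^-1.
have K0 : 0 <= K.
  rewrite mulr_ge0 ?powR_ge0// addr_ge0// invr_ge0 subr_ge0.
  rewrite -opprB powRN invf_le1 ?powR_gt0//.
  have one : 1 `^ (N%:R / 4%:R - 1) = 1 :> R by rewrite powR1.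
  by rewrite -[X in X <= _]one ge0_ler_powR ?nnegrE ?ler1n// subr_ge0 ltW.
have WF (F : set V) : measurable (F : set LV) -> (mu F < +oo)%E ->
    (\int[mu]_(x in F) W x <= (K * fine (mu F) `^ (1 - 4 / N%:R))%:E)%E.
  move=> mF Foo; have := weak_type_integral p1 A0 mW W0 WA mF Foo.
  have pV : (N%:R / 4%:R)^-1 = 4 / N%:R :> R by rewrite invf_div.
  by rewrite [X in fine _ `^ (1 - X)]pV.
pose C := rellich_const R N * K + 1.
have rc0 : 0 <= rellich_const R N.
  have NR : 5 <= N%:R :> R by rewrite (ler_nat _ 5).
  have d1 : 2 / N%:R < 1 :> R by rewrite ltr_pdivrMr// mul1r; lra.
  have lc0 : 0 <= level_const R N by rewrite mulr_ge0 ?exprn_ge0 ?powR_ge0.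
  by rewrite /rellich_const !mulr_ge0 ?powR_ge0// invr_ge0 subr_ge0 ltW.
exists C; first by rewrite ltr_wpDl// mulr_ge0.
move=> phi C0 C1 C2; rewrite integral_mkcond.
rewrite (_ : (_ \_ Omega)%E = fun x => W x * (phi x ^+ 2)%:E)%E; last first.
  by apply/funext => x; rewrite /W !patchE; case: ifP; rewrite ?mul0e.
apply: le_trans (weighted_rellich N5 C0 C1 C2 K0 mW W0 WF) _; rewrite lee_fin ler_wpM2r ?lerDl//.
by apply: Rintegral_ge0 => x _; exact: sqr_ge0.
Qed.
End weak_Lp_potential.

(** * From test functions to the completion *)

Section test_functions.
Context (R : realType) (N : nat).
Local Notation V := 'rV[R]_N.
Local Notation LV := (lebesgue_rVType R N).
Local Notation mu := (@lebesgue_rV R N).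
Implicit Types (f : V -> R) (i : 'I_N) (Omega : set V).

Lemma smooth_partial f i : smooth f -> smooth (partial i f).
Proof. by move=> sf s; have := sf (rcons s i); rewrite foldr_rcons. Qed.

Lemma smooth_C1c f : smooth f -> bounded_support f -> C1c f.
Proof.
move=> sf bf; have [cf df] := sf [::].
by split=> // i; have [] := sf [:: i].
Qed.

Lemma Cc_infty_bounded_support Omega f : Cc_infty Omega f -> bounded_support f.
Proof.
move=> [_ /compact_bounded[B [_ HB]] _]; exists (B + 1) => x Bx.
apply/eqP; apply: contraTT (Bx) => fx; rewrite -leNgt.
by apply: (HB (B + 1)) => /=; [rewrite ltrDl|exact: subset_closure].
Qed.

Lemma Cc_infty_C1c Omega f : Cc_infty Omega f ->
  [/\ C1c f, forall i, C1c (partial i f) & forall i j, C1c (partial i (partial j f))].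
Proof.
move=> Cf; have [sf _ _] := Cf; have bf := Cc_infty_bounded_support Cf.
have b1 i := bounded_support_partial i bf; have s1 i := smooth_partial i sf.
split => [|i|i j]; first exact: (smooth_C1c sf bf).
  exact: (smooth_C1c (s1 i) (b1 i)).
exact: (smooth_C1c (smooth_partial i (s1 j)) (bounded_support_partial i (b1 j))).
Qed.

Lemma laplacian_outside Omega f x : Cc_infty Omega f -> ~ Omega x -> laplacian f x = 0.
Proof.
move=> [_ _ KO] Ox; set K := closure _ in KO.
have oK : open (~` K) by exact/closed_openC/closed_closure.
have f0 : forall y, (~` K) y -> f y = 0.
  move=> y Ky; apply/eqP; apply: contrapT => /negP fy; apply: Ky; exact: subset_closure.
rewrite /laplacian big1// => i _; apply: partial_near0.
have Kx : (~` K) x by move=> /KO.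
apply: filterS (open_nbhs_nbhs (conj oK Kx)) => y Ky; apply: partial_near0.
by apply: filterS (open_nbhs_nbhs (conj oK Ky)).
Qed.

Lemma continuous_laplacian Omega f : Cc_infty Omega f -> continuous (laplacian f).
Proof.
move=> /Cc_infty_C1c[_ _ C2].
have -> : laplacian f = \sum_(i < N) partial i (partial i f).
  by apply/funext => x; rewrite fct_sumE.
elim/big_ind : _ => [|p q cp cq|i _]; first exact: (@continuous_cstf R N 0).
- by move=> x; apply: continuousD; [exact: cp|exact: cq].
- by have [] := C2 i i.
Qed.

Lemma measurable_laplacian Omega (D : set V) f : Cc_infty Omega f -> measurable (D : set LV) ->
  measurable_fun (D : set LV) (laplacian f : LV -> R).
Proof.
move=> Cf mD; apply: measurable_funS (measurableT) _ _ => //.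
exact: continuous_lebesgue_measurable (continuous_laplacian Cf).
Qed.

Lemma integral_laplacian Omega f : Cc_infty Omega f ->
  (\int[mu]_(x in Omega) ((laplacian f x) ^+ 2)%:E =
   (Rintegral mu setT ((fun x => laplacian f x ^+ 2) : LV -> R))%:E)%E.
Proof.
move=> Cf; have [_ C1 C2] := Cc_infty_C1c Cf.
have cl := continuous_laplacian Cf.
have bl : bounded_support (laplacian f).
  have [sf cK _] := Cf; set K := closure _ in cK.
  have CK : Cc_infty K f by split => //; exact: subset_refl.
  have [B [_ KB]] := compact_bounded cK; exists (B + 1) => x Bx.
  apply: (laplacian_outside CK) => Kx; move: Bx; rewrite ltNge => /negP; apply.
  by apply: KB Kx; rewrite ltrDl.
have I2 := continuous_integrableM cl cl bl.
rewrite /Rintegral fineK; last exact: integrable_fin_num I2.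
rewrite [LHS]integral_mkcond; apply: (@eq_integral _ LV R mu setT) => x _; rewrite patchE.
case: ifPn => // /negP Ox; rewrite (laplacian_outside Cf) ?expr0n//.
by move=> Ox'; apply: Ox; rewrite inE.
Qed.
End test_functions.

Section density.
Context (R : realType) (N : nat).
Local Notation V := 'rV[R]_N.
Local Notation LV := (lebesgue_rVType R N).
Local Notation mu := (@lebesgue_rV R N).
Implicit Types (Omega : set V).

(** The usual exhaustion of an open set by compact sets. *)
Definition exhaustion Omega m : set V :=
  [set x | `|x| <= m%:R] `&` \bigcap_(y in ~` Omega) [set x : V | m.+1%:R^-1 <= `|x - y|].

Lemma exhaustion_closed Omega m : closed (exhaustion Omega m).
Proof.
apply: closedI; first exact: closed_normball.
apply: closed_bigI => y _.
apply: (@preimage_closed _ _ (fun x : V => `|x - y|) [set r | m.+1%:R^-1 <= r]); last exact: closed_ge.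
move=> x _; apply: (@continuous_comp _ _ _ (fun x : V => x - y) (fun x : V => `|x|)).
  by apply: continuousB; [exact: cvg_id|exact: cst_continuous].
exact: norm_continuous.
Qed.

Lemma exhaustion_compact Omega m : compact (exhaustion Omega m).
Proof.
apply: bounded_closed_compact; last exact: exhaustion_closed.
exists m%:R; split; first exact: num_real.
by move=> M mM x [/= xm _]; exact: le_trans xm (ltW mM).
Qed.

Lemma exhaustion_sub Omega m : exhaustion Omega m `<=` Omega.
Proof.
move=> x [_ xO]; apply: contrapT => Ox.
by have := xO x Ox; rewrite /= subrr normr0 leNgt invr_gt0 ltr0n.
Qed.

Lemma exhaustion_nd Omega m n : (m <= n)%N -> exhaustion Omega m `<=` exhaustion Omega n.
Proof.
move=> mn x [xm xO]; split; first by apply: le_trans xm _; rewrite ler_nat.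
move=> y /xO; apply: le_trans; rewrite lef_pV2 ?posrE ?ltr0n//; by rewrite ler_nat ltnS.
Qed.

Lemma exhaustion_near Omega x : open Omega -> Omega x ->
  \forall m \near \oo, exhaustion Omega m x.
Proof.
move=> oO Ox.
have /nbhs_normP[e /= e0 eO] := open_nbhs_nbhs (conj oO Ox).
pose m := maxn (Num.truncn `|x|).+1 (Num.truncn e^-1).+1.
exists m => // n /= mn; apply: (exhaustion_nd mn); split.
  rewrite /= (le_trans (ltW (truncnS_gt _)))// ler_nat; exact: leq_maxl.
move=> y Oy; rewrite /= leNgt; apply/negP => xy; apply: Oy; apply: eO => /=.
apply: lt_trans xy _; rewrite -[ltRHS]invrK ltf_pV2 ?posrE ?invr_gt0//.
apply: lt_le_trans (truncnS_gt _) _; rewrite ler_nat leqW// leq_maxr//.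
Qed.

(** Squares of truncated values are Lipschitz with constant [2 * c]; this is what makes
    convergence in L^1 sufficient for a quadratic integrand. *)
Lemma sqr_trunc_le (c a b : R) : 0 <= c ->
  Num.min `|a| c ^+ 2 <= b ^+ 2 + 2 * c * `|b - a|.
Proof.
move=> c0; set p := Num.min `|a| c; set q := Num.min `|b| c.
have p0 : 0 <= p by rewrite le_min normr_ge0.
have q0 : 0 <= q by rewrite le_min normr_ge0.
have pc : p <= c by rewrite ge_min lexx orbT.
have qc : q <= c by rewrite ge_min lexx orbT.
have qb : q ^+ 2 <= b ^+ 2.
  by rewrite -[b ^+ 2]real_normK ?num_real// ler_sqr ?nnegrE// ge_min lexx.
have pq : p <= q + `|b - a|.
  have ab : `|a| <= `|b| + `|b - a|.
    by rewrite -{1}[a](subrK b) addrC distrC (le_trans (ler_normD _ _)).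
  rewrite /q; case: (leP `|b| c) => bc.
    by apply: le_trans ab; rewrite ge_min lexx.
  by rewrite (le_trans pc)// lerDl.
apply: (@le_trans _ _ (q ^+ 2 + 2 * c * `|b - a|)); last by rewrite lerD2r.
have d0 : 0 <= `|b - a| by exact: normr_ge0.
case: (leP p q) => h.
  by rewrite (le_trans (_ : _ <= q ^+ 2)) ?ler_sqr// lerDl !mulr_ge0.
nra.
Qed.

Lemma L2dist2_le (D : set V) (v w : V -> R) : measurable (D : set LV) ->
  measurable_fun (D : set LV) (v : LV -> R) -> measurable_fun (D : set LV) (w : LV -> R) ->
  (\int[mu]_(x in D) (v x ^+ 2)%:E <=
    2%:E * L2dist2 D v w + 2%:E * \int[mu]_(x in D) (w x ^+ 2)%:E)%E.
Proof.
move=> mD mv mw; rewrite /L2dist2.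
have m1 : measurable_fun (D : set LV) (fun x : LV => ((v x - w x) ^+ 2)%:E).
  by apply/measurable_EFinP; apply: measurable_funX; exact: measurable_funB.
have m2 : measurable_fun (D : set LV) (fun x : LV => (w x ^+ 2)%:E).
  by apply/measurable_EFinP; apply: measurable_funX.
have m3 : measurable_fun (D : set LV) (fun x : LV => (v x ^+ 2)%:E).
  by apply/measurable_EFinP; apply: measurable_funX.
have p1 (x : LV) : D x -> (0 <= ((v x - w x) ^+ 2)%:E)%E by move=> _; rewrite lee_fin sqr_ge0.
have p2 (x : LV) : D x -> (0 <= (w x ^+ 2)%:E)%E by move=> _; rewrite lee_fin sqr_ge0.
have z2 : (0 <= 2%:E :> \bar R)%E by rewrite lee_fin.
rewrite -(ge0_integralZl mu mD m1 p1 z2) -(ge0_integralZl mu mD m2 p2 z2).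
have p1' (x : LV) : D x -> (0 <= 2%:E * ((v x - w x) ^+ 2)%:E)%E by move=> Dx; rewrite mule_ge0// p1.
have p2' (x : LV) : D x -> (0 <= 2%:E * (w x ^+ 2)%:E)%E by move=> Dx; rewrite mule_ge0// p2.
have m1' := emeasurable_funM (measurable_cst 2%:E) m1.
have m2' := emeasurable_funM (measurable_cst 2%:E) m2.
rewrite -(ge0_integralD mu mD p1' m1' p2' m2').
apply: (@ge0_le_integral _ LV R mu D mD).
- by move=> x _; rewrite lee_fin sqr_ge0.
- exact: m3.
- exact: (emeasurable_funD m1' m2').
- move=> x _; rewrite -!EFinM -EFinD lee_fin -subr_ge0.
  have -> : 2 * (v x - w x) ^+ 2 + 2 * w x ^+ 2 - v x ^+ 2 = (v x - 2 * w x) ^+ 2 by ring.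
  exact: sqr_ge0.
Qed.

(** Lower semicontinuity of the weighted integral: on a compact set and with [g] and [u] truncated
    at [m], the integral is stable under convergence in L^1; monotone
    convergence in [m] then removes the truncations. The Laplacians converge in L^2, and
    [L2dist2_le] accounts for the factor 2 in the constant. *)
Lemma test_inequality_admissible Omega (g : V -> \bar R) (C : R) : open Omega ->
  lebesgue_measurable_fun Omega g -> (forall x, Omega x -> (0 <= g x)%E) -> 0 < C ->
  (forall phi, Cc_infty Omega phi ->
    (\int[mu]_(x in Omega) (g x * (phi x ^+ 2)%:E) <=
     C%:E * \int[mu]_(x in Omega) (laplacian phi x ^+ 2)%:E)%E) ->
  admissible Omega g.
Proof.
move=> oO mg g0 C0 HC; exists (2 * C); split; first by rewrite mulr_gt0.
move=> u w _ [phi [[Cphi _ [mu_ L1]] mw L2]].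
have mO : measurable (Omega : set LV) by exact: open_lebesgue_measurable.
have -> : (\int[mu]_(x in Omega) (`|w x| ^+ 2)%:E = \int[mu]_(x in Omega) (w x ^+ 2)%:E)%E.
  by apply: eq_integral => x _; rewrite real_normK ?num_real.
have I0 : (0 <= \int[mu]_(x in Omega) (w x ^+ 2)%:E)%E.
  by apply: integral_ge0 => x _; rewrite lee_fin sqr_ge0.
set I := (\int[mu]_(x in Omega) (w x ^+ 2)%:E)%E in I0 *.
have [Ioo|Ifin] := eqVneq I +oo%E.
  by rewrite Ioo gt0_muley ?leey// lte_fin mulr_gt0.
have {}Ifin : I \is a fin_num by rewrite ge0_fin_numE// ltey.
pose h m x : \bar R := (mine (g x) m%:R%:E * (Num.min `|u x| m%:R ^+ 2)%:E)%E.
pose f m := (h m \_ (exhaustion Omega m))%E.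
have mE m : measurable (exhaustion Omega m : set LV).
  by apply: closed_lebesgue_measurable; exact: exhaustion_closed.
have EO m : exhaustion Omega m `<=` Omega := @exhaustion_sub Omega m.
have h0 m x : Omega x -> (0 <= h m x)%E.
  move=> Ox; rewrite mule_ge0 ?lee_fin ?sqr_ge0//.
  by rewrite le_min g0//= lee_fin.
have mh m : measurable_fun (Omega : set LV) (h m : LV -> \bar R).
  apply: emeasurable_funM.
    by apply: measurable_mine => //; exact: measurable_cst.
  apply/measurable_EFinP; apply: measurable_funX.
  apply: measurable_minr; last exact: measurable_cst.
  by apply: measurableT_comp.
apply: (@integral_le_limit R N Omega f) => //.
- move=> m; apply/(measurable_restrict _ (mE m) mO).
  by rewrite setIidr//; exact: measurable_funS (mh m).
- by move=> m x Ox; rewrite /f patchE; case: ifP => // _; exact: h0.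
- move=> x Ox m n mn; rewrite /f !patchE; case: ifPn => [/set_mem xm|_]; last first.
    by case: ifP => // _; exact: h0.
  rewrite ifT; last by rewrite inE; exact: exhaustion_nd xm.
  apply: lee_pmul.
  + by rewrite le_min g0//= lee_fin.
  + by rewrite lee_fin sqr_ge0.
  + by rewrite le_min !ge_min lexx/= lee_fin ler_nat mn orbT.
  + rewrite lee_fin ler_sqr ?nnegrE ?le_min ?normr_ge0 ?ler0n// !ge_min lexx/= ler_nat mn orbT //.
- move=> x Ox.
  have noo : (fun m => m%:R : R) @ \oo --> +oo%R by exact: cvgr_idn.
  have gc : mine (g x) m%:R%:E @[m --> \oo] --> g x.
    by apply: mine_cvg => //; apply: lt_le_trans (g0 x Ox); rewrite ltNy0.
  apply: cvg_trans (cvgeZr (_ : (u x ^+ 2)%:E \is a fin_num) gc) => //.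
  apply: near_eq_cvg; move/cvgryPge : noo => /(_ `|u x|) um.
  have um' := exhaustion_near oO Ox.
  near=> m; rewrite /f patchE ifT; last by rewrite inE; near: m.
  rewrite /h; congr (_ * _%:E)%E.
  have /min_idPl -> : `|u x| <= m%:R by near: m.
  by rewrite real_normK ?num_real.
- move=> m; rewrite -integral_mkcondr setIidr//.
  pose eps n := (\int[mu]_(x in exhaustion Omega m) (`|phi n x - u x|)%:E)%E.
  have eps_cvg : eps n @[n --> \oo] --> 0%E.
    by apply: L1; [exact: exhaustion_compact|exact: EO].
  pose b n := (C%:E * (2%:E * L2dist2 Omega (laplacian (phi n)) w + 2%:E * I) +
    (2 * m%:R ^+ 2)%:E * eps n)%E.
  have b_cvg : b n @[n --> \oo] --> (C%:E * (2%:E * 0 + 2%:E * I) + (2 * m%:R ^+ 2)%:E * 0)%E.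
    apply: cvgeD.
    - by rewrite !mule0 add0e fin_num_adde_defl.
    - apply: cvgeZl => //; apply: cvgeD; last exact: cvg_cst.
        by rewrite mule0 fin_num_adde_defr.
      exact: cvgeZl.
    - exact: cvgeZl.
  have -> : ((2 * C)%:E * I = C%:E * (2%:E * 0 + 2%:E * I) + (2 * m%:R ^+ 2)%:E * 0)%E.
    by rewrite !mule0 adde0 add0e muleA -EFinM [C * 2]mulrC.
  apply: cvge_ge b_cvg; apply: nearW => n.
  have [cphi _ _ _] : C1c (phi n) by have [] := Cc_infty_C1c (Cphi n).
  have mphi : measurable_fun setT (phi n : LV -> R) by exact: continuous_lebesgue_measurable.
  have mphiO : measurable_fun (Omega : set LV) (phi n : LV -> R) by exact: measurable_funS mphi.
  have m1 : measurable_fun (Omega : set LV) (fun x : LV => (g x * (phi n x ^+ 2)%:E)%E).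
    apply: emeasurable_funM; first exact: mg.
    by apply/measurable_EFinP; exact: (measurable_funX 2 mphiO).
  have m2 : measurable_fun (Omega : set LV) (fun x : LV => (`|phi n x - u x|)%:E).
    have mD := measurable_funB mphiO mu_.
    apply/measurable_EFinP; exact: (measurableT_comp (@normr_measurable _ _) mD).
  have p1 (x : LV) : Omega x -> (0 <= g x * (phi n x ^+ 2)%:E)%E.
    by move=> Ox; rewrite mule_ge0 ?g0// lee_fin sqr_ge0.
  have c_ge0 : (0 <= (2 * m%:R ^+ 2 : R)%:E)%E by rewrite lee_fin mulr_ge0 ?exprn_ge0.
  have p2 (x : LV) : exhaustion Omega m x -> (0 <= (`|phi n x - u x|)%:E)%E by rewrite lee_fin.
  have p2' (x : LV) : exhaustion Omega m x -> (0 <= (2 * m%:R ^+ 2 : R)%:E * (`|phi n x - u x|)%:E)%E.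
    by move=> Ox; rewrite mule_ge0// p2.
  have m1E := measurable_funS mO (EO m) m1.
  have m2E := measurable_funS mO (EO m) m2.
  have m2E' := emeasurable_funM (measurable_cst (2 * m%:R ^+ 2 : R)%:E) m2E.
  have p1E (x : LV) : exhaustion Omega m x -> (0 <= g x * (phi n x ^+ 2)%:E)%E.
    by move=> /EO; exact: p1.
  apply: (@le_trans _ _ (\int[mu]_(x in exhaustion Omega m)
     (g x * (phi n x ^+ 2)%:E + (2 * m%:R ^+ 2)%:E * (`|phi n x - u x|)%:E))%E).
    apply: (@ge0_le_integral _ LV R mu _ (mE m)).
    - by move=> x /EO; exact: h0.
    - exact: measurable_funS (mh m).
    - exact: (emeasurable_funD m1E m2E').
    move=> x /EO Ox; rewrite /h.
    have k0 : (0 <= mine (g x) m%:R%:E)%E by rewrite le_min g0//= lee_fin.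
    apply: (@le_trans _ _ (mine (g x) m%:R%:E * ((phi n x ^+ 2)%:E + (2 * m%:R * `|phi n x - u x|)%:E))%E).
      by apply: lee_wpmul2l => //; rewrite -EFinD lee_fin; exact: sqr_trunc_le.
    rewrite ge0_muleDr ?lee_fin ?sqr_ge0 ?mulr_ge0//; apply: leeD.
      by apply: lee_wpmul2r; rewrite ?lee_fin ?sqr_ge0// ge_min lexx.
    apply: (@le_trans _ _ (m%:R%:E * (2 * m%:R * `|phi n x - u x|)%:E)%E).
      by apply: lee_wpmul2r; rewrite ?lee_fin ?mulr_ge0// ge_min lexx orbT.
    by rewrite -!EFinM lee_fin le_eqVlt; apply/orP; left; apply/eqP; ring.
  rewrite (ge0_integralD mu (mE m) p1E m1E p2' m2E') (ge0_integralZl mu (mE m) m2E p2 c_ge0).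
  apply: leeD; last exact: lexx.
  apply: (le_trans (ge0_subset_integral mu (mE m) mO m1 p1 (EO m))).
  apply: (le_trans (HC _ (Cphi n))); apply: lee_wpmul2l; first by rewrite lee_fin ltW.
  exact: (L2dist2_le mO (measurable_laplacian (Cphi n) mO) mw).
Unshelve. all: by end_near. Qed.
End density.

(** * A smooth bump and its derivatives *)

Section bump.
Context (R : realType).
Implicit Types (s t r : R) (m k : nat) (P : {poly R}).

(** The derivatives of [exp (- 1 / s)], extended by 0 to [s <= 0], are combinations of these
    functions. *)
Definition flat m s : R := if 0 < s then s^-1 ^+ m * expR (- s^-1) else 0.

Lemma flat_neg m s : s <= 0 -> flat m s = 0.
Proof. by move=> s0; rewrite /flat ltNge s0. Qed.

Lemma flat_ge0 m s : 0 <= flat m s.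
Proof. by rewrite /flat; case: ifP => // s0; rewrite mulr_ge0 ?expR_ge0// exprn_ge0// invr_ge0 ltW. Qed.

Lemma flatS m s : flat m s = s * flat m.+1 s.
Proof.
rewrite /flat; case: ifPn => s0; last by rewrite mulr0.
by rewrite exprS !mulrA mulfV ?mul1r// gt_eqF.
Qed.

(** For [n = m + 2], [exp (1 / s)] is the [n]-th power of [exp (1 / (n * s))], which exceeds
    [1 / (n * s)]. *)
Lemma flat_le m s : flat m s <= m.+2%:R ^+ m.+2 * s ^+ 2.
Proof.
rewrite /flat; case: ifPn => s0; last by rewrite mulr_ge0 ?sqr_ge0 ?exprn_ge0.
set n : R := m.+2%:R; have n0 : 0 < n by rewrite ltr0n.
have h : (n * s)^-1 ^+ m.+2 <= expR (s^-1).
  have -> : s^-1 = n * (n * s)^-1 by rewrite invfM mulrA mulfV ?mul1r// gt_eqF.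
  rewrite expRM_natl lerXn2r ?nnegrE ?expR_ge0 ?invr_ge0 ?mulr_ge0 ?ltW//.
  by apply: le_lt_trans (expR_gt1Dx _); rewrite ?lerDr// gt_eqF// invr_gt0 mulr_gt0.
have ns0 : 0 < n * s by rewrite mulr_gt0.
rewrite expRN; apply: (@le_trans _ _ (s^-1 ^+ m * (n * s) ^+ m.+2)).
  rewrite ler_wpM2l ?exprn_ge0 ?invr_ge0 ?(ltW s0)//.
  by rewrite -[leRHS]invrK lef_pV2 ?posrE ?expR_gt0 ?invr_gt0 ?exprn_gt0// -exprVn.
rewrite exprMn mulrCA ler_wpM2l ?exprn_ge0 ?(ltW n0)//.
by rewrite -addn2 exprD mulrA -exprMn mulVf ?gt_eqF// expr1n mul1r.
Qed.

(** At 0 the difference quotient tends to 0 because [flat m] vanishes to second order. *)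
Lemma is_derive_flat m s : is_derive s 1 (flat m) (flat m.+2 s - m%:R * flat m.+1 s).
Proof.
have [s0|s0|->] := ltgtP s 0.
- rewrite !flat_neg ?(ltW s0)// mulr0 subr0.
  have dc : is_derive s 1 (cst 0 : R -> R) 0 by exact: is_derive_cst.
  apply: near_eq_is_derive dc.
  have : \forall t \near s, t < 0 by exact: lt_nbhsl.
  by apply: filterS => t t0; rewrite flat_neg// ltW.
- have sn0 : s != 0 by rewrite gt_eqF.
  have dV : is_derive s 1 (fun t : R => t^-1) (- s ^- 2 *: 1).
    by apply: is_deriveV; exact: sn0.
  have dE := @is_derive1_comp R expR (fun t => - t^-1) _ _ _ (is_derive_expR (- s^-1)) (is_deriveN dV).
  have := is_deriveM (is_deriveX m dV) dE.
  set d := (X in is_derive _ _ _ X) => H.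
  have -> : flat m.+2 s - m%:R * flat m.+1 s = d.
    rewrite /d /flat s0/=.
    rewrite !fctE/= /GRing.scale/= -exprVn.
    by case: m {H d dE} => [|m] /=; rewrite ?exprS; ring.
  apply: near_eq_is_derive H.
  have : \forall t \near s, 0 < t by exact: lt_nbhsr.
  by apply: filterS => t t0; rewrite /flat t0 !fctE.
- rewrite !(@flat_neg _ 0)// mulr0 subr0.
  have cvg0 : (fun h : R => h^-1 *: ((flat m \o shift 0) (h *: 1) - flat m 0)) @ (0 : R)^' --> (0 : R).
    apply/cvgr0Pnorm_lt => e e0.
    set K : R := m.+2%:R ^+ m.+2; have K0 : 0 < K by rewrite exprn_gt0// ltr0n.
    have eK : 0 < e / K by rewrite divr_gt0.
    have : \forall h \near (0 : R)^', `|h| < e / K by apply: dnbhs0_lt.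
    have : \forall h \near (0 : R)^', h != 0 by exact: nbhs_dnbhs_neq.
    apply: filterS2 => h h0 hK; rewrite /= [_ *: 1]mulr1 addr0 (@flat_neg _ 0)// subr0.
    rewrite normrZ normfV (ger0_norm (flat_ge0 _ _)) mulrC ltr_pdivrMr ?normr_gt0//.
    apply: le_lt_trans (flat_le _ _) _; rewrite -/K -(real_normK (num_real h)) expr2 mulrA.
    by rewrite ltr_pM2r ?normr_gt0// mulrC -ltr_pdivlMr.
  split; first by apply/cvg_ex; exists 0.
  exact: cvg_lim cvg0.
Qed.

Definition bump_term P m t : R := P.[t] * flat m (1 - t ^+ 2).

(** The effect of a derivative on [bump_term P m]: as [flat m s = s ^ 2 * flat (m + 2) s], the terms
    of different orders that arise can be brought to the common order [m + 2]. *)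
Definition bump_step (Pm : {poly R} * nat) : {poly R} * nat :=
  let Q : {poly R} := 1 - 'X ^+ 2 in
  (Pm.1^`() * Q ^+ 2 + 2%:R *: 'X * Pm.1 * (Pm.2%:R *: Q - 1), Pm.2.+2).

Lemma is_derive_bump_term P m t :
  is_derive t 1 (bump_term P m) (let Pm := bump_step (P, m) in bump_term Pm.1 Pm.2 t).
Proof.
have dQ : is_derive t 1 (fun t : R => 1 - t ^+ 2) (- (2 * t)).
  have := is_derive_poly (1 - 'X ^+ 2) t.
  rewrite (_ : horner _ = fun t : R => 1 - t ^+ 2); last first.
    by apply/funext => y; rewrite !hornerE.
  have -> : (1 - 'X^2 : {poly R})^`() = - ('X *+ 2) by rewrite !poly.derivE sub0r.
  by rewrite !hornerE mulr_natl.
have := is_deriveM (is_derive_poly P t) 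
  (@is_derive1_comp R (flat m) (fun t => 1 - t ^+ 2) _ _ _ (is_derive_flat m (1 - t ^+ 2)) dQ).
set d := (X in is_derive _ _ _ X) => H.
rewrite (_ : (let _ := _ in _) = d)//.
rewrite /d /bump_term /= !hornerE (flatS m) (flatS m.+1) /= /GRing.scale/=.
ring.
Qed.

(** The [k]-th derivative of [exp (- 1 / (1 - t ^ 2))], extended by 0 to [|t| >= 1]. *)
Definition bump k t : R :=
  let Pm := iter k bump_step (1, 0%N) in bump_term Pm.1 Pm.2 t.

Lemma is_derive_bump k t : is_derive t 1 (bump k) (bump k.+1 t).
Proof.
by rewrite /bump iterS; case: (iter k _ _) => P m; exact: is_derive_bump_term.
Qed.

Lemma bump_outside k t : 1 <= `|t| -> bump k t = 0.
Proof.
move=> t1; rewrite /bump /bump_term flat_neg ?mulr0// subr_le0.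
by rewrite -(real_normK (num_real t)) expr_ge1.
Qed.

Lemma bump0_ge t : `|t| <= 2^-1 -> expR (- 2) <= bump 0 t.
Proof.
move=> t2; rewrite /bump /bump_term /= hornerC mul1r.
have t4 : t ^+ 2 <= 4^-1.
  rewrite -(real_normK (num_real t)); have -> : 4^-1 = 2^-1 ^+ 2 :> R by rewrite exprVn; congr (_^-1); ring.
  by rewrite ler_sqr ?nnegrE ?invr_ge0.
rewrite /flat ifT; last by lra.
rewrite expr0 mul1r ler_expR lerN2 -[leRHS]invrK lef_pV2 ?posrE ?invr_gt0//; lra.
Qed.

Lemma continuous_bump k : continuous (bump k).
Proof.
move=> t; apply: differentiable_continuous; apply/derivable1_diffP.
by have [] := is_derive_bump k t.
Qed.

Lemma bump_bounded k : exists B : R, forall t, `|bump k t| <= B.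
Proof.
have [] := @EVT_max R (fun t => `|bump k t|) (-1) 1.
- lra.
- apply: continuous_subspaceT => t; apply: continuous_comp; first exact: continuous_bump.
  exact: norm_continuous.
move=> c _ cmax; exists `|bump k c| => t.
have [t1|t1] := leP 1 `|t|; first by rewrite bump_outside// normr0.
by apply: cmax; rewrite in_itv/= -ler_norml ltW.
Qed.

(** The [k]-th derivative of the dilated bump [bump 0 (t / r)]. *)
Definition scaled_bump r k t : R := r^-1 ^+ k * bump k (t / r).

Lemma is_derive_scaled_bump r k t :
  is_derive t 1 (scaled_bump r k) (scaled_bump r k.+1 t).
Proof.
have dr : is_derive t 1 (fun t : R => t / r) r^-1.
  have := is_deriveM (@is_derive_id R R t 1) (@is_derive_cst R R R r^-1 t 1).
  by rewrite /= scaler0 add0r [_ *: 1]mulr1.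
have H := is_deriveZ (r^-1 ^+ k) (@is_derive1_comp R (bump k) (fun t => t / r) _ _ _ (is_derive_bump k (t / r)) dr).
rewrite (_ : scaled_bump r k.+1 t = r^-1 ^+ k *: (bump k.+1 (t / r) * r^-1))//.
by rewrite /scaled_bump exprS /GRing.scale/=; ring.
Qed.
End bump.

(** * Bumps on cubes *)

Section product_bump.
Context (R : realType) (N : nat).
Local Notation V := 'rV[R]_N.
Implicit Types (k : 'I_N -> nat) (r : R) (j : 'I_N) (x : V).

(** The derivative with multi-index [k] of the product over [i] of the functions
    [bump 0 (x_i / r)]. *)
Definition prod_bump r k x : R := \prod_(i < N) scaled_bump r (k i) (x ord0 i).

Definition incr j k : 'I_N -> nat := fun i => (k i + (i == j))%N.

Lemma is_derive_prod_bump r k j x :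
  is_derive x (delta_mx ord0 j : V) (prod_bump r k) (prod_bump r (incr j k) x).
Proof.
have [dd dE] := is_derive_scaled_bump r (k j) (x ord0 j).
pose P := \prod_(i < N | i != j) scaled_bump r (k i) (x ord0 i).
have prodE (h : R) : prod_bump r k (h *: delta_mx ord0 j + x) = scaled_bump r (k j) (h + x ord0 j) * P.
  rewrite /prod_bump (bigD1 j)//= !mxE !eqxx mulr1; congr (_ * _).
  by apply: eq_bigr => i ij; rewrite !mxE eqxx/= (negbTE ij) mulr0 add0r.
have prod0 : prod_bump r k x = scaled_bump r (k j) (x ord0 j) * P.
  by rewrite -[x in LHS]add0r -(scale0r (delta_mx ord0 j : V)) prodE add0r.
have prod1 : prod_bump r (incr j k) x = scaled_bump r (k j).+1 (x ord0 j) * P.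
  rewrite /prod_bump (bigD1 j)//= /incr eqxx addn1; congr (_ * _).
  by apply: eq_bigr => i /negbTE ->; rewrite addn0.
have quotE : (fun h : R => h^-1 *: ((prod_bump r k \o shift x) (h *: (delta_mx ord0 j : V)) - prod_bump r k x)) =
    (fun h : R => h^-1 *: ((scaled_bump r (k j) \o shift (x ord0 j)) (h *: 1) - scaled_bump r (k j) (x ord0 j)) * P).
  apply/funext => h; rewrite /= /shift/= prodE prod0 [h *: 1]mulr1 -mulrBl.
  by rewrite /GRing.scale/= mulrA.
have cvgP : (fun h : R => h^-1 *: ((prod_bump r k \o shift x) (h *: (delta_mx ord0 j : V)) - prod_bump r k x)) @
    (0 : R)^' --> prod_bump r (incr j k) x.
  by rewrite quotE prod1 -dE; apply: cvgMr_tmp; exact: dd.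
split; first by apply/cvg_ex; eexists; exact: cvgP.
exact: cvg_lim cvgP.
Qed.

Lemma partial_prod_bump r k j : partial j (prod_bump r k) = prod_bump r (incr j k).
Proof. by apply/funext => x; have [_ <-] := is_derive_prod_bump r k j x. Qed.

Lemma continuous_prod_bump r k : continuous (prod_bump r k).
Proof.
have -> : prod_bump r k = \prod_(i < N) (fun x : V => scaled_bump r (k i) (x ord0 i)).
  by apply/funext => x; rewrite fct_prodE.
elim/big_ind : _ => [|p q cp cq|i _]; first exact: (@continuous_cstf R N 1).
  exact: continuous_mulf.
have c1 : continuous (fun x : V => x ord0 i / r).
  by apply: continuous_mulf; [exact: coord_continuous|exact: continuous_cstf].
apply: continuous_mulf; first exact: continuous_cstf.
move=> x; apply: (@continuous_comp V R R (fun x : V => x ord0 i / r) (bump (k i))).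
  exact: c1.
exact: continuous_bump.
Qed.

Lemma smooth_prod_bump r k : smooth (prod_bump r k).
Proof.
move=> s; have [k' ->] : exists k', foldr (@partial R N) (prod_bump r k) s = prod_bump r k'.
  elim: s => [|i s [k' /= ->]]; first by exists k.
  by exists (incr i k'); rewrite partial_prod_bump.
split; first exact: continuous_prod_bump.
by move=> i x; have [] := is_derive_prod_bump r k' i x.
Qed.

Lemma prod_bump_bound r k (B : R) x : 0 < r -> (forall i t, `|bump (k i) t| <= B) ->
  `|prod_bump r k x| <= r^-1 ^+ (\sum_(i < N) k i) * B ^+ N.
Proof.
move=> r0 kB; rewrite /prod_bump normr_prod.
apply: (@le_trans _ _ (\prod_(i < N) (r^-1 ^+ k i * B))).
  apply: ler_prod => i _; rewrite normr_ge0/= normrM normrX normfV (gtr0_norm r0).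
  by rewrite ler_wpM2l ?exprn_ge0 ?invr_ge0 ?(ltW r0).
by rewrite big_split/= prodr_const card_ord -prodrXr.
Qed.

(** What matters is the dependence on [r]: the lower bound [c] on the half cube is uniform, and the
    Laplacian scales like [r ^- 2]. *)
Lemma cube_test_function : exists c M : R, [/\ 0 < c, 0 <= M & forall r, 0 < r ->
  exists eta : V -> R, [/\ smooth eta, forall x, r <= `|x| -> eta x = 0,
    forall x, `|x| <= r / 2 -> c <= eta x & forall x, `|laplacian eta x| <= M * r ^- 2]].
Proof.
have [B0 HB0] := bump_bounded R 0; have [B2 HB2] := bump_bounded R 2.
pose B := Num.max B0 B2.
have B_ge0 : 0 <= B by rewrite le_max (le_trans _ (HB0 0)).
exists (expR (- 2) ^+ N), (N%:R * B ^+ N); split.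
- by rewrite exprn_gt0 ?expR_gt0.
- by rewrite mulr_ge0 ?exprn_ge0.
move=> r r0; exists (prod_bump r (fun=> 0%N)); split.
- exact: smooth_prod_bump.
- move=> x rx; apply/eqP; apply: contraTT rx => px; rewrite -ltNge.
  rewrite [ltLHS]mx_normrE; apply: bigmax_lt => // -[i j] _ /=; rewrite (ord1 i).
  rewrite ltNge; apply: contra px => xj; rewrite /prod_bump (bigD1 j)//= /scaled_bump.
  by rewrite bump_outside ?mulr0 ?mul0r// normrM normfV (gtr0_norm r0) ler_pdivlMr ?mul1r.
- move=> x xr; rewrite /prod_bump -[X in _ ^+ X](card_ord N) -prodr_const.
  apply: ler_prod => i _; rewrite expR_ge0/= /scaled_bump expr0 mul1r; apply: bump0_ge.
  rewrite normrM normfV (gtr0_norm r0) ler_pdivrMr// mulrC; apply: le_trans xr.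
  exact: coord_le_norm.
- move=> x; rewrite /laplacian; apply: le_trans (ler_norm_sum _ _ _) _.
  rewrite -mulrA mulr_natl -[X in _ *+ X](card_ord N) -sumr_const; apply: ler_sum => j _.
  rewrite !partial_prod_bump mulrC -exprVn.
  have <- : (\sum_(i < N) incr j (incr j (fun=> 0)) i)%N = 2%N.
    rewrite (bigD1 j)//= big1 ?addn0; first by rewrite /incr eqxx.
    by move=> i /negbTE ij; rewrite /incr ij.
  apply: prod_bump_bound => // i t; rewrite /incr.
  by case: (i == j); [rewrite (le_trans (HB2 _))// le_max lexx orbT|
    rewrite (le_trans (HB0 _))// le_max lexx].
Qed.
End product_bump.

Section sufficiency.
Context (R : realType) (N : nat).

Lemma weak_Lp_admissible (Omega : set 'rV[R]_N) (g : 'rV[R]_N -> \bar R) :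
  (5 <= N)%N -> open Omega -> lebesgue_measurable_fun Omega g ->
  (forall x, Omega x -> (0 <= g x)%E) -> weak_Lp Omega (N%:R / 4%:R) g ->
  admissible Omega g.
Proof.
move=> N5 oO mg g0 /(weak_Lp_test_inequality N5 oO mg g0)[C C0 CP].
apply: (test_inequality_admissible oO mg g0 C0) => phi Cphi.
rewrite (integral_laplacian Cphi) -EFinM.
by have [c0 c1 c2] := Cc_infty_C1c Cphi; exact: CP.
Qed.
End sufficiency.

(** * Necessity for radially decreasing potentials *)

Section necessity.
Context (R : realType) (N : nat).
Local Notation V := 'rV[R]_N.
Local Notation LV := (lebesgue_rVType R N).
Local Notation mu := (@lebesgue_rV R N).
Implicit Types (Omega : set V) (g : V -> \bar R) (x y : V) (r : R).

(** A test function is represented in the completion by the constant sequence. *)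
Lemma admissible_test_inequality Omega g : open Omega -> admissible Omega g ->
  exists2 C : R, 0 < C & forall phi, Cc_infty Omega phi ->
    (\int[mu]_(x in Omega) (g x * (phi x ^+ 2)%:E) <=
     C%:E * \int[mu]_(x in Omega) (`|laplacian phi x| ^+ 2)%:E)%E.
Proof.
move=> oO [C [C0 CP]]; exists C => // phi Cphi.
have mO : measurable (Omega : set LV) by exact: open_lebesgue_measurable.
have [[cphi _ _ _] _ _] := Cc_infty_C1c Cphi.
have L2dist2_id v : L2dist2 Omega v v = 0%E.
  by apply: integral0_eq => x _; rewrite subrr expr0n.
have repr : D220_repr Omega (fun=> phi) phi.
  split => //.
    by move=> e e0; exists 0%N => m n _ _; rewrite L2dist2_id lte_fin.
  split.
    apply: measurable_funS (measurableT) _ _ => //.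
    exact: continuous_lebesgue_measurable.
  move=> K _ _; apply: cvg_near_cst; apply: nearW => n.
  by apply: integral0_eq => x _; rewrite subrr normr0.
apply: CP; first by exists (fun=> phi).
exists (fun=> phi); split => //; first exact: measurable_laplacian Cphi mO.
by apply: cvg_near_cst; apply: nearW => n; exact: L2dist2_id.
Qed.

(** At the level [s] for which [K * s `^ (- p) = t / 2], the distribution function is
    smaller than [t], so the rearrangement at [t] is at most [s]. *)
Lemma distribution_weak_Lp Omega g (p K : R) : 0 < p -> 0 < K ->
  lebesgue_measurable_fun Omega g ->
  {ae mu, forall x, Omega x -> g x \is a fin_num} ->
  (forall s : R, 0 < s -> (distribution_fun Omega g s <= (K * s `^ (- p))%:E)%E) ->
  weak_Lp Omega p g.
Proof.
move=> p0 K0 mg fing gK; split => //.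
apply: (@le_lt_trans _ _ ((2 * K) `^ p^-1)%:E); last exact: ltry.
apply: ge_ereal_sup => _ [t /= t0 <-].
pose s := (2 * K / t) `^ p^-1.
have Kt : 0 < 2 * K / t by rewrite divr_gt0// mulr_gt0.
have s0 : 0 < s by rewrite powR_gt0.
have st : (decreasing_rearrangement Omega g t <= s%:E)%E.
  apply: ereal_inf_lbound; exists s => //; split => //.
  apply: le_lt_trans (gK s s0) _; rewrite lte_fin /s -powRrM mulrN mulVf ?gt_eqF//.
  have -> : (2 * K / t) `^ (-1) = (2 * K / t)^-1 by exact: powR_inv1 (ltW Kt).
  have -> : K * (2 * K / t)^-1 = t / 2 by field; rewrite !gt_eqF.
  by rewrite ltr_pdivrMr// ltr_pMr// ltr1n.
apply: (@le_trans _ _ ((t `^ p^-1)%:E * s%:E)%E).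
  by apply: lee_wpmul2l => //; rewrite lee_fin powR_ge0.
rewrite -EFinM lee_fin /s -powRM ?(ltW t0) ?(ltW Kt)//.
by rewrite mulrC divfK// gt_eqF.
Qed.

Lemma enorm_ge0 x : 0 <= enorm x.
Proof. exact: sqrtr_ge0. Qed.

Lemma sqr_enorm x : enorm x ^+ 2 = \sum_(i < N) x ord0 i ^+ 2.
Proof. by rewrite sqr_sqrtr// sumr_ge0// => i _; exact: sqr_ge0. Qed.

Lemma coord_le_enorm x (i : 'I_N) : `|x ord0 i| <= enorm x.
Proof.
rewrite -(ler_sqr (normr_ge0 _) (enorm_ge0 x)) real_normK ?num_real// sqr_enorm.
by rewrite (bigD1 i)//= lerDl sumr_ge0// => j _; exact: sqr_ge0.
Qed.

Lemma enorm_le_norm x : enorm x <= N%:R * `|x|.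
Proof.
rewrite -(ler_sqr (enorm_ge0 x)) ?nnegrE ?mulr_ge0// sqr_enorm exprMn.
apply: (@le_trans _ _ (N%:R * `|x| ^+ 2)).
  rewrite mulr_natl -[X in _ *+ X](card_ord N) -sumr_const; apply: ler_sum => i _.
  by rewrite -(real_normK (num_real (x ord0 i))) ler_sqr ?nnegrE// coord_le_norm.
rewrite ler_wpM2r ?sqr_ge0// -natrX ler_nat; case: (N) => // n; by rewrite expnS leq_pmulr ?expn_gt0.
Qed.

Lemma enorm_gt0 x : x != 0 -> 0 < enorm x.
Proof.
move=> x0; rewrite lt0r enorm_ge0 andbT; apply: contra x0 => /eqP e0.
apply/eqP/rowP => i; rewrite mxE; apply/eqP; rewrite -normr_le0 -e0.
exact: coord_le_enorm.
Qed.

(** Test with a bump on a cube of half side [r] comparable to [enorm x], so small that [g] is at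
    least [g x] on it. Up to constants the left side is at least [g x * r ^ N] and the right side
    at most [r ^ (N - 4)]. *)
Lemma radial_decay Omega g : (0 < N)%N -> open Omega ->
  lebesgue_measurable_fun Omega g -> (forall x, Omega x -> (0 <= g x)%E) ->
  (forall x y, Omega x -> enorm y <= enorm x -> Omega y /\ (g x <= g y)%E) ->
  mu (cube 1) != 0%E -> admissible Omega g ->
  exists2 A : R, 0 < A & forall x, Omega x -> x != 0 -> (g x <= (A * enorm x ^- 4)%:E)%E.
Proof.
move=> N0 oO mg g0 gdecr c0 /(admissible_test_inequality oO)[C C0 CP].
have mO : measurable (Omega : set LV) by exact: open_lebesgue_measurable.
have [c [M [c_gt0 M0 test]]] := cube_test_function R N.
have NR : 0 < N%:R :> R by rewrite ltr0n.
pose A := C * M ^+ 2 * 4 ^+ N * N%:R ^+ 4 / c ^+ 2.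
have A0 : 0 <= A by rewrite divr_ge0 ?sqr_ge0// !mulr_ge0 ?exprn_ge0// ltW.
have [q q0 qE] : exists2 q : R, 0 < q & mu (cube 1 : set V) = q%:E.
  have qfin : mu (cube 1) \is a fin_num by rewrite ge0_fin_numE// lebesgue_cube_lty.
  exists (fine (mu (cube 1))); last by rewrite fineK.
  by rewrite fine_gt0// lt0e c0 measure_ge0 lebesgue_cube_lty.
exists (A + 1) => [|x Ox x0]; first by rewrite ltr_wpDl.
set n := enorm x; have n0 : 0 < n by exact: enorm_gt0.
pose r := n / N%:R; have r0 : 0 < r by rewrite divr_gt0.
have [eta [seta eta0 etac etaM]] := test r r0.
have ballO y : `|y| <= r -> Omega y /\ (g x <= g y)%E.
  move=> yr; apply: gdecr => //; apply: le_trans (enorm_le_norm y) _.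
  by rewrite mulrC -ler_pdivlMr.
pose D := [set y : V | `|y| <= r].
have KD : closure [set y | eta y != 0] `<=` D.
  have DE : D = closure D by apply/closure_id; exact: closed_normball.
  rewrite DE.
  apply: closureS => y /= ey; rewrite /D /= leNgt; apply: contra ey => yr.
  by rewrite eta0// ltW.
have Keta : compact (closure [set y | eta y != 0]).
  apply: bounded_closed_compact; last exact: closed_closure.
  exists r; split; first exact: num_real.
  by move=> s rs y /KD /= yr; exact: le_trans yr (ltW rs).
have CD : Cc_infty D eta by split.
have CO : Cc_infty Omega eta by split => // y /KD /ballO[].
pose Q : set V := centered_cube (r / 2).
have mQ : measurable (Q : set LV) by exact: measurable_centered_cube.
have Qr y : Q y -> `|y| <= r / 2.
  move=> Qy; rewrite [leLHS]mx_normrE; apply: bigmax_le => [|[i j] _ /=]; first by rewrite divr_ge0 ?ltW.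
  by rewrite (ord1 i); have /andP[/ltW h1 h2] := Qy j; rewrite ler_norml h1 h2.
have r2 : r / 2 <= r by rewrite ler_pdivrMr// ler_peMr ?ler1n// ltW.
have QO : Q `<=` Omega by move=> y /Qr yr; have [] := ballO y (le_trans yr r2).
have [[ceta _ _ _] _ _] := Cc_infty_C1c CO.
have mgeta : measurable_fun (Omega : set LV) (fun y : LV => (g y * (eta y ^+ 2)%:E)%E).
  have meta : measurable_fun (Omega : set LV) (eta : LV -> R).
    have := continuous_lebesgue_measurable ceta; exact: measurable_funS.
  have meta2 := measurable_funX 2 meta.
  apply: emeasurable_funM; first exact: mg.
  by apply/measurable_EFinP; exact: meta2.
have geta0 (y : LV) : Omega y -> (0 <= g y * (eta y ^+ 2)%:E)%E.
  by move=> Oy; rewrite mule_ge0 ?g0// lee_fin sqr_ge0.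
have lower : (g x * (c ^+ 2)%:E * (r ^+ N * q)%:E <= \int[mu]_(y in Omega) (g y * (eta y ^+ 2)%:E))%E.
  apply: le_trans (ge0_subset_integral mu mQ mO mgeta geta0 QO).
  have muQ : mu Q = (r ^+ N * q)%:E.
    by rewrite lebesgue_centered_cube ?divr_gt0// qE -EFinM; congr ((_ ^+ _ * _)%:E); field.
  rewrite -muQ -(integral_cst mu mQ (g x * (c ^+ 2)%:E)%E).
  apply: (@ge0_le_integral _ LV R mu Q mQ).
  - by move=> y _; rewrite mule_ge0 ?g0// lee_fin sqr_ge0.
  - exact: measurable_cst.
  - exact: measurable_funS mO QO mgeta.
  move=> y Qy; have yr := Qr y Qy; have [Oy gxy] := ballO y (le_trans yr r2).
  apply: lee_pmul => //; [exact: g0|by rewrite lee_fin sqr_ge0|].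
  have cy := etac y yr.
  by rewrite lee_fin ler_sqr ?nnegrE ?(ltW c_gt0)// (le_trans (ltW c_gt0)).
have upper : (\int[mu]_(y in Omega) (`|laplacian eta y| ^+ 2)%:E <=
    ((M * r ^- 2) ^+ 2 * ((4 * r) ^+ N * q))%:E)%E.
  pose E : set V := centered_cube (2 * r).
  have mE : measurable (E : set LV) by exact: measurable_centered_cube.
  have muE : mu E = ((4 * r) ^+ N * q)%:E.
    have rr : 0 < 2 * r by rewrite mulr_gt0.
    rewrite (lebesgue_centered_cube N rr) qE -EFinM; congr ((_ ^+ _ * _)%:E); ring.
  have Mr0 : 0 <= (M * r ^- 2) ^+ 2 by exact: sqr_ge0.
  have mind : measurable_fun setT (fun y : LV => (\1_E y : R)%:E).
    exact/measurable_EFinP/measurable_indic.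
  have mind2 := emeasurable_funM (measurable_cst ((M * r ^- 2) ^+ 2)%:E) mind.
  have ml : measurable_fun (Omega : set LV) (fun y : LV => (`|laplacian eta y| ^+ 2)%:E).
    have ml1 := measurable_laplacian CO mO.
    apply/measurable_EFinP; apply: measurable_funX.
    exact: (measurableT_comp (@normr_measurable _ _) ml1).
  apply: (@le_trans _ _ (\int[mu]_(y in Omega) (((M * r ^- 2) ^+ 2)%:E * (\1_E y)%:E))%E).
    apply: (@ge0_le_integral _ LV R mu Omega mO).
    - by move=> y _; rewrite lee_fin sqr_ge0.
    - exact: ml.
    - exact: measurable_funS (measurableT) _ mind2.
    move=> y Oy; rewrite indicE; have [yE|yE] := boolP (y \in E).
      rewrite mule1 lee_fin ler_sqr ?nnegrE ?mulr_ge0 ?invr_ge0 ?exprn_ge0 ?(ltW r0)//.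
    rewrite mule0 lee_fin (laplacian_outside CD) ?normr0 ?expr0n//= => yr.
    move: yE; rewrite notin_setE; apply => i; have yi := coord_le_norm y i.
    have : `|y ord0 i| < 2 * r by apply: le_lt_trans (le_trans yi yr) _; rewrite ltr_pMl// ltr1n.
    by rewrite ltr_norml => /andP[-> /ltW].
  have mindO : measurable_fun (Omega : set LV) (fun y : LV => (\1_E y : R)%:E).
    exact: measurable_funS (measurableT) _ mind.
  have ind0 (y : LV) : Omega y -> (0 <= (\1_E y : R)%:E)%E by move=> _; rewrite lee_fin.
  rewrite (ge0_integralZl mu mO mindO ind0); last by rewrite lee_fin.
  rewrite (integral_indic mu mO mE) [leRHS]EFinM; apply: lee_wpmul2l; first by rewrite lee_fin.
  by rewrite -muE; apply: le_lebesgue; exact: subIsetl.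
have := le_trans lower (le_trans (CP eta CO) (lee_wpmul2l _ upper)).
have gx0 := g0 x Ox.
have k0 : 0 < c ^+ 2 * (r ^+ N * q) by rewrite !mulr_gt0 ?exprn_gt0.
rewrite lee_fin (ltW C0) => /(_ isT); rewrite -muleA -!EFinM.
move: gx0; case: (g x) => [a| |] //; last first.
  by move=> _; rewrite gt0_mulye ?lte_fin// leye_eq.
move=> _; rewrite -EFinM !lee_fin -ler_pdivlMr// => /le_trans; apply.
apply: (@le_trans _ _ (A * n ^- 4)); last by rewrite ler_wpM2r ?invr_ge0 ?exprn_ge0 ?ltW// ltrDl.
rewrite le_eqVlt; apply/orP; left; apply/eqP.
have -> : n = r * N%:R by rewrite /r divfK ?gt_eqF.
have -> : (4 * r) ^+ N = 4 ^+ N * r ^+ N by rewrite exprMn.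
rewrite /A; have := exprn_gt0 N r0; move: (r ^+ N) => X X0.
by field; rewrite !gt_eqF.
Qed.

(** By [radial_decay] the set [g > s] lies in a cube of side proportional to [s `^ (- 1 / 4)],
    hence of volume proportional to [s `^ (- N / 4)]. The origin, where [g] may be infinite,
    is a null set. *)
Lemma radial_weak_Lp Omega g : (0 < N)%N -> open Omega ->
  lebesgue_measurable_fun Omega g -> (forall x, Omega x -> (0 <= g x)%E) ->
  (forall x y, Omega x -> enorm y <= enorm x -> Omega y /\ (g x <= g y)%E) ->
  admissible Omega g -> weak_Lp Omega (N%:R / 4%:R) g.
Proof.
move=> N0 oO mg g0 gdecr adm.
have p0 : 0 < N%:R / 4%:R :> R by rewrite divr_gt0 ?ltr0n.
have [c0|c0] := eqVneq (mu (cube 1)) 0%E.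
  have mu0 (S : set V) : (mu S <= 0)%E by rewrite -(lebesgue_cube_eq0 c0); exact: le_lebesgue.
  apply: (@distribution_weak_Lp _ _ _ 1) => //.
    exists setT; split => //; exact: lebesgue_cube_eq0.
  by move=> s s0; apply: le_trans (mu0 _) _; rewrite lee_fin mul1r powR_ge0.
have [A A0 AP] := radial_decay N0 oO mg g0 gdecr c0 adm.
have qfin : mu (cube 1) \is a fin_num by rewrite ge0_fin_numE// lebesgue_cube_lty.
set q := fine (mu (cube 1)); have q0 : 0 <= q by exact: fine_ge0.
have muc (s : R) : 0 < s -> mu ((centered_cube s : set V)) = ((s + s) ^+ N * q)%:E.
  by move=> s0; rewrite lebesgue_centered_cube// EFinM fineK.
pose K := 4 ^+ N * q * A `^ (N%:R / 4%:R) + 1.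
have K1 : 0 <= 4 ^+ N * q * A `^ (N%:R / 4%:R) by rewrite !mulr_ge0 ?powR_ge0 ?exprn_ge0.
apply: (@distribution_weak_Lp _ _ _ K) => //; first by rewrite ltr_wpDl.
  exists [set x : V | `|x| <= 0]; split.
  - by apply: closed_lebesgue_measurable; exact: closed_normball.
  - apply/eqP; rewrite eq_le measure_ge0 andbT; apply/lee_addgt0Pr => e e0; rewrite add0e.
    pose s := Num.min 1 (e / (q + 1)) / 2.
    have q1 : 0 < q + 1 by rewrite ltr_wpDl.
    have m0 : 0 < Num.min 1 (e / (q + 1)) by rewrite lt_min ltr01 divr_gt0.
    have s0 : 0 < s by rewrite divr_gt0.
    apply: (@le_trans _ _ (mu ((centered_cube s : set V)))).
      by apply: le_lebesgue => x /=; rewrite normr_le0 => /eqP -> i; rewrite !mxE oppr_lt0 s0 ltW.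
    rewrite muc// lee_fin.
    have -> : s + s = Num.min 1 (e / (q + 1)) by rewrite /s; field.
    apply: (@le_trans _ _ (Num.min 1 (e / (q + 1)) * q)).
      rewrite ler_wpM2r// -[leRHS]expr1 ler_wiXn2l ?(ltW m0)// ge_min lexx //.
    apply: (@le_trans _ _ (e / (q + 1) * (q + 1))); last by rewrite divfK ?gt_eqF.
    by apply: ler_pM => //; [exact: ltW|rewrite ge_min lexx orbT|rewrite lerDl].
  - move=> x /= gx; rewrite normr_le0; apply: contrapT => /negP x0; apply: gx => Ox.
    rewrite fin_numElt (lt_le_trans _ (g0 x Ox))//=.
    by apply: le_lt_trans (AP x Ox x0) _; exact: ltry.
move=> s s0; pose rho := (A / s) `^ 4%:R^-1.
have As0 : 0 < A / s by rewrite divr_gt0.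
have rho0 : 0 < rho by rewrite powR_gt0.
apply: (@le_trans _ _ (mu ((centered_cube (2 * rho) : set V)))).
  apply: le_lebesgue => x [Ox]; rewrite gee0_abs ?g0// => sg.
  have xrho : enorm x < 2 * rho.
    have [->|x0] := eqVneq x 0.
      by rewrite /enorm big1 ?sqrtr0 ?mulr_gt0// => i _; rewrite mxE expr0n.
    apply: (@lt_trans _ _ rho); last by rewrite ltr_pMl// ltr1n.
    have n0 := enorm_gt0 x0.
    have : s < A * enorm x ^- 4 by rewrite -lte_fin; apply: lt_le_trans sg (AP x Ox x0).
    rewrite ltr_pdivlMr ?exprn_gt0// mulrC -ltr_pdivlMr// => nA.
    have -> : enorm x = (enorm x ^+ 4) `^ 4%:R^-1.
      by rewrite -powR_mulrn ?ltW// -powRrM mulfV// powRr1// ltW.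
    by rewrite gt0_ltr_powR ?nnegrE ?exprn_ge0 ?invr_gt0 ?ltW.
  move=> i; have := le_lt_trans (coord_le_enorm x i) xrho.
  by rewrite ltr_norml => /andP[-> /ltW].
rewrite muc ?mulr_gt0// lee_fin.
have -> : 2 * rho + 2 * rho = 4 * rho by ring.
apply: (@le_trans _ _ (4 ^+ N * q * A `^ (N%:R / 4%:R) * s `^ (- (N%:R / 4%:R)))).
  rewrite le_eqVlt; apply/orP; left; apply/eqP.
  rewrite exprMn -[rho ^+ N]powR_mulrn ?(ltW rho0)// /rho -powRrM.
  rewrite powRM ?(ltW A0) ?invr_ge0 ?(ltW s0)// [4%:R^-1 * _]mulrC.
  rewrite -(powR_inv1 (ltW s0)) -powRrM mulN1r; ring.
by rewrite ler_wpM2r ?powR_ge0// lerDl.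
Qed.
End necessity.

Theorem theorem1p2 (R : realType) (N : nat) (Omega : set 'rV[R]_N)
    (g : 'rV[R]_N -> \bar R) :
  (5 <= N)%N ->
  open Omega ->
  lebesgue_measurable_fun Omega g ->
  (forall x, Omega x -> (0 <= g x)%E) ->
  (weak_Lp Omega (N%:R / 4%:R) g -> admissible Omega g) /\
  ((Omega = setT \/ exists r : R, 0 < r /\ Omega = eball r) ->
   radially_decreasing Omega g ->
   admissible Omega g -> weak_Lp Omega (N%:R / 4%:R) g).
Proof.
move=> N5 oO mg g0; split; first exact: weak_Lp_admissible.
move=> ball [h [hdecr gh]]; apply: radial_weak_Lp => //; first exact: leq_trans N5.
move=> x y Ox yx.
have Oy : Omega y.
  case: ball => [->//|[r [_ OE]]]; rewrite OE in Ox *.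
  exact: le_lt_trans yx Ox.
by split => //; rewrite !gh//; apply: hdecr => //; exact: enorm_ge0.
Qed.
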